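(* Let $f$ and $g$ be transcendental entire functions of bounded type with $f\circ g=g\circ f$. Then $\overline{I(f)}\cup\overline{I(g)}\subset\overline{I(f\circ g)}$.
   Context: For an entire function $f$, $f^n$ denotes the $n$-th iterate and $I(f)=\{z\in\mathbb{C}: f^n(z)\to\infty\}$ is its escaping set; $\overline{E}$ denotes closure in $\mathbb{C}$. A transcendental entire function is of bounded type if the set of its critical values and finite asymptotic values, together with their finite limit points, is bounded. *)

(* Defs.v *)
From Stdlib Require Import Reals List.
Open Scope R_scope.

Definition CC : Type := (R * R)%type.
Definition Cre (z : CC) : R := fst z.
Definition Cim (z : CC) : R := snd z.
Definition C0 : CC := (0, 0).
Definition C1 : CC := (1, 0).
Definition Cadd (z w : CC) : CC := (fst z + fst w, snd z + snd w).
Definition Copp (z : CC) : CC := (- fst z, - snd z).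
Definition Csub (z w : CC) : CC := Cadd z (Copp w).
Definition Cmul (z w : CC) : CC :=
  (fst z * fst w - snd z * snd w, fst z * snd w + snd z * fst w).
Definition Cnorm (z : CC) : R := sqrt (fst z * fst z + snd z * snd z).
Fixpoint Cpow (z : CC) (n : nat) : CC :=
  match n with O => C1 | S m => Cmul z (Cpow z m) end.

Definition has_cderiv (f : CC -> CC) (z l : CC) : Prop :=
  forall eps : R, eps > 0 -> exists delta : R, delta > 0 /\
    forall h : CC, 0 < Cnorm h < delta ->
      Cnorm (Csub (Csub (f (Cadd z h)) (f z)) (Cmul l h)) <= eps * Cnorm h.

Definition entire (f : CC -> CC) : Prop := forall z, exists l, has_cderiv f z l.

Fixpoint poly_eval (a : list CC) (z : CC) : CC :=
  match a with nil => C0 | cons c a' => Cadd c (Cmul z (poly_eval a' z)) end.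
Definition is_polynomial (f : CC -> CC) : Prop :=
  exists a : list CC, forall z, f z = poly_eval a z.

Definition transcendental_entire (f : CC -> CC) : Prop :=
  entire f /\ ~ is_polynomial f.

Definition critical_value (f : CC -> CC) (w : CC) : Prop :=
  exists z, has_cderiv f z C0 /\ f z = w.

Definition asymptotic_value (f : CC -> CC) (a : CC) : Prop :=
  exists gamma : R -> CC,
    (forall t, 0 <= t -> forall eps, eps > 0 -> exists delta, delta > 0 /\
       forall s, 0 <= s -> Rabs (s - t) < delta ->
         Cnorm (Csub (gamma s) (gamma t)) < eps) /\
    (forall M, exists T, forall t, t >= T -> Cnorm (gamma t) > M) /\
    (forall eps, eps > 0 -> exists T, forall t, t >= T ->
       Cnorm (Csub (f (gamma t)) a) < eps).

Definition Cclosure (E : CC -> Prop) (w : CC) : Prop :=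
  forall eps, eps > 0 -> exists z, E z /\ Cnorm (Csub z w) < eps.

Definition limit_point (E : CC -> Prop) (w : CC) : Prop :=
  forall eps, eps > 0 -> exists z, E z /\ z <> w /\ Cnorm (Csub z w) < eps.

Definition sing_values (f : CC -> CC) (w : CC) : Prop :=
  critical_value f w \/ asymptotic_value f w.

Definition bounded_type (f : CC -> CC) : Prop :=
  transcendental_entire f /\
  exists M, forall w, (sing_values f w \/ limit_point (sing_values f) w) ->
    Cnorm w <= M.

Definition iterate (f : CC -> CC) (n : nat) (z : CC) : CC := Nat.iter n f z.

Definition escaping (f : CC -> CC) (z : CC) : Prop :=
  forall M, exists N, forall n, (n >= N)%nat -> Cnorm (iterate f n z) > M.

(* Main.v *)
Require Import Defs.
From Stdlib Require Import Reals ZArith List Lra Lia ClassicalEpsilon.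
From Coquelicot Require Import Coquelicot.
Open Scope R_scope.

(** Let [h = f o g]. Since [f] commutes with [h], a point whose image under [f] escapes under [h]
    escapes itself, so it suffices to find points of [I(h)] near the forward orbit of a point of
    [I(f)].

    Over a half-plane [Re > ell] whose exponential contains no singular value of [f], every solution
    of [f (e^s) = e^w] extends to an inverse branch [Phi] with [f (e^Phi) = exp]. The image of [Phi]
    contains no closed disc of radius [pi]: otherwise it would contain two points differing by
    [2 pi i], so [Phi (u + 2 pi i k) = Phi u + 2 pi i]; then [Re Phi] grows linearly and Cauchy's
    formula on the loop [e^Phi] kills all high Taylor coefficients of [f], making it a polynomial.
    Bloch's theorem now gives the Eremenko-Lyubich estimate [|Phi'| <= 256 / (Re - ell)].

    Far to the right these branches contract. The inverse branches of [g] and [f] along an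
    alternating pseudo-orbit are shadowed by a genuine orbit, which yields a point of [I(h)] within
    distance 8, in logarithmic coordinates, of any given point far to the right. Pulling these
    points back along the orbit of a point of [I(f)] by branches of [f] shows that some iterate of
    it lies in the closure of [I(h)], and the open mapping theorem brings this back to the point
    itself. *)

(** * The topology of the complex plane *)

Lemma Cmod_minus_sym (a b : C) : Cmod (a - b) = Cmod (b - a).
Proof. now rewrite <- Cmod_opp, Copp_minus_distr. Qed.

Lemma Cmod_minus_diag (a : C) : Cmod (a - a) = 0.
Proof. unfold Cminus. rewrite Cplus_opp_r. apply Cmod_0. Qed.

Lemma Cmod_dist_triangle (a b c : C) : Cmod (a - c) <= Cmod (a - b) + Cmod (b - c).
Proof. replace (a - c)%C with ((a - b) + (b - c))%C by ring. apply Cmod_triangle. Qed.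

Lemma Cmod_minus_le (a b : C) : Cmod (a - b) <= Cmod a + Cmod b.
Proof. rewrite <- (Cmod_opp b). apply Cmod_triangle. Qed.

Lemma Cmod_minus_ge (a b : C) : Cmod a - Cmod b <= Cmod (a - b).
Proof.
  assert (H := Cmod_triangle (a - b) b).
  replace (a - b + b)%C with a in H by ring. lra.
Qed.

Lemma Cmod_le_0 (z : C) : Cmod z <= 0 -> z = RtoC 0.
Proof. intros H. apply Cmod_eq_0, Rle_antisym; [exact H|apply Cmod_ge_0]. Qed.

Lemma Ceq_of_dist_le_0 (a b : C) : Cmod (a - b) <= 0 -> a = b.
Proof. intros H. now apply Ceq_minus, Cmod_le_0. Qed.

Lemma Cmod_plus_minus_l (a h : C) : Cmod (a + h - a) = Cmod h.
Proof. f_equal. ring. Qed.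

Lemma Cmod_scal (r : R) (z : C) : Cmod (RtoC r * z) = Rabs r * Cmod z.
Proof. now rewrite Cmod_mult, Cmod_R. Qed.

Lemma RtoC_neq_0 (r : R) : r <> 0 -> RtoC r <> RtoC 0.
Proof. intros H E. now apply RtoC_inj in E. Qed.

Lemma Im_le_Cmod (z : C) : Rabs (Im z) <= Cmod z.
Proof. eapply Rle_trans; [apply Rmax_r | apply Rmax_Cmod]. Qed.

Lemma Re_minus (z w : C) : Re (z - w) = Re z - Re w.
Proof. reflexivity. Qed.

Lemma Im_minus (z w : C) : Im (z - w) = Im z - Im w.
Proof. reflexivity. Qed.

Lemma Re_dist_le (z w : C) : Rabs (Re z - Re w) <= Cmod (z - w).
Proof. rewrite <- Re_minus. apply re_le_Cmod. Qed.

Lemma Re_Im_decomp (z : C) : z = (RtoC (Re z) + Ci * RtoC (Im z))%C.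
Proof. apply injective_projections; simpl; unfold Re, Im; ring. Qed.

Lemma Cmod_le_Re_Im (z : C) : Cmod z <= Rabs (Re z) + Rabs (Im z).
Proof.
  rewrite (Re_Im_decomp z) at 1. eapply Rle_trans; [apply Cmod_triangle|].
  rewrite Cmod_mult, Cmod_Ci, !Cmod_R. lra.
Qed.

Lemma Cmod_sqr (z : C) : Cmod z * Cmod z = Re z * Re z + Im z * Im z.
Proof. assert (H := Cmod2_alt z). simpl in H. lra. Qed.

Definition Cdisc (a : C) (r : R) (z : C) : Prop := Cmod (z - a) < r.

Lemma Cdisc_center (a : C) (r : R) : 0 < r -> Cdisc a r a.
Proof. unfold Cdisc. now rewrite Cmod_minus_diag. Qed.

Lemma Cdisc_incl (a b : C) (r s : R) (z : C) : Cmod (b - a) + s <= r -> Cdisc b s z -> Cdisc a r z.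
Proof. unfold Cdisc. intros H Hz. assert (T := Cmod_dist_triangle z b a). lra. Qed.

Lemma locally_Cdisc (z : C) (P : C -> Prop) :
  locally z P <-> exists d, 0 < d /\ forall w, Cdisc z d w -> P w.
Proof.
  split.
  - intros H. destruct (locally_norm_le_locally (V := C_R_NormedModule) z P H) as [d Hd].
    exists d. split; [apply cond_pos|]. intros w Hw. apply Hd. unfold ball_norm.
    now rewrite <- Cmod_norm.
  - intros [d [Hd H]]. apply (locally_le_locally_norm (V := C_R_NormedModule)).
    exists (mkposreal d Hd). intros w Hw. apply H. unfold ball_norm in Hw.
    now rewrite <- Cmod_norm in Hw.
Qed.

Lemma continuous_C_dist {U : UniformSpace} (f : U -> C) (x : U) :
  continuous f x <-> forall e, 0 < e -> locally x (fun y => Cmod (f y - f x) < e).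
Proof.
  unfold continuous. rewrite (filterlim_locally_ball_norm (U := C_R_NormedModule)).
  unfold ball_norm. split.
  - intros H e He. generalize (H (mkposreal e He)). apply filter_imp.
    intros y. now rewrite <- Cmod_norm.
  - intros H e. generalize (H e (cond_pos e)). apply filter_imp.
    intros y. now rewrite <- Cmod_norm.
Qed.

Lemma continuous_C_eps (f : C -> C) (z : C) :
  continuous f z <->
  forall e, 0 < e -> exists d, 0 < d /\ forall w, Cdisc z d w -> Cmod (f w - f z) < e.
Proof.
  rewrite continuous_C_dist. split; intros H e He; apply locally_Cdisc; auto.
Qed.

Lemma continuous_curve_eps (f : R -> C) (t : R) :
  continuous f t <->
  forall e, 0 < e -> exists d, 0 < d /\ forall s, Rabs (s - t) < d -> Cmod (f s - f t) < e.
Proof.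
  rewrite continuous_C_dist. split; intros H e He; destruct (H e He) as [d Hd].
  - exists d. split; [apply cond_pos|exact Hd].
  - destruct Hd as [Hd K]. now exists (mkposreal d Hd).
Qed.

Section Continuity.
Context {U : UniformSpace}.
Implicit Types (f g : U -> C) (x : U).

Lemma continuous_Cplus f g x :
  continuous f x -> continuous g x -> continuous (fun u => (f u + g u)%C) x.
Proof. apply (continuous_plus (V := C_R_NormedModule)). Qed.

Lemma continuous_Copp f x : continuous f x -> continuous (fun u => (- f u)%C) x.
Proof. apply (continuous_opp (V := C_R_NormedModule)). Qed.

Lemma continuous_Cminus f g x :
  continuous f x -> continuous g x -> continuous (fun u => (f u - g u)%C) x.
Proof. apply (continuous_minus (V := C_R_NormedModule)). Qed.

Lemma continuous_Cmult f g x :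
  continuous f x -> continuous g x -> continuous (fun u => (f u * g u)%C) x.
Proof.
  intros Hf Hg. apply (continuous_scal (K := C_AbsRing) (V := C_NormedModule)); auto.
  intros P HP. apply Hf. now apply locally_C.
Qed.

Lemma continuous_Re f x : continuous f x -> continuous (fun u => Re (f u)) x.
Proof. intros H. apply (continuous_comp f); [exact H|apply continuous_fst]. Qed.

Lemma continuous_Im f x : continuous f x -> continuous (fun u => Im (f u)) x.
Proof. intros H. apply (continuous_comp f); [exact H|apply continuous_snd]. Qed.

Lemma continuous_RtoC (h : U -> R) x : continuous h x -> continuous (fun u => RtoC (h u)) x.
Proof.
  intros H. apply continuous_C_dist. intros e He.
  generalize (proj1 (filterlim_locally _ _) H (mkposreal e He)). apply filter_imp.
  intros y Hy. rewrite <- RtoC_minus, Cmod_R. exact Hy.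
Qed.

Lemma continuous_Cmod f x : continuous f x -> continuous (fun u => Cmod (f u)) x.
Proof.
  intros H. apply continuous_ext with (fun u => norm (V := C_R_NormedModule) (f u)).
  { intros u. symmetry. apply Cmod_norm. }
  apply (continuous_comp f); [exact H|]. apply (filterlim_norm (V := C_R_NormedModule)).
Qed.

Lemma continuous_Cconj f x : continuous f x -> continuous (fun u => Cconj (f u)) x.
Proof.
  rewrite !continuous_C_dist. intros H e He. generalize (H e He). apply filter_imp.
  intros y. now rewrite <- Cminus_conj, Cmod_conj.
Qed.

Lemma continuous_Cpow f x n : continuous f x -> continuous (fun u => (f u ^ n)%C) x.
Proof.
  intros H. induction n; simpl; [apply continuous_const|]. now apply continuous_Cmult.
Qed.

Lemma continuous_Cinv f x :
  continuous f x -> f x <> RtoC 0 -> continuous (fun u => (/ f u)%C) x.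
Proof.
  intros H Hn. apply Cmod_gt_0 in Hn. set (m := Cmod (f x)) in *.
  apply continuous_C_dist. intros e He. rewrite continuous_C_dist in H.
  assert (Hem : 0 < e * (m * m) / 2) by (assert (0 < m * m) by nra; nra).
  assert (Hm : 0 < m / 2) by lra.
  generalize (filter_and _ _ (H _ Hm) (H _ Hem)).
  apply filter_imp. intros y [H1 H2].
  assert (Hy := Cmod_minus_ge (f x) (f x - f y)).
  replace (f x - (f x - f y))%C with (f y) in Hy by ring.
  rewrite (Cmod_minus_sym (f x)) in Hy. fold m in Hy.
  assert (Nx : f x <> RtoC 0) by (apply Cmod_gt_0; exact Hn).
  assert (Ny : f y <> RtoC 0) by (apply Cmod_gt_0; lra).
  replace (/ f y - / f x)%C with (- (f y - f x) / (f y * f x))%C by (field; auto).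
  rewrite Cmod_div, Cmod_opp, Cmod_mult by now apply Cmult_neq_0. fold m.
  apply Rlt_div_l; nra.
Qed.

Lemma continuous_Cdiv f g x :
  continuous f x -> continuous g x -> g x <> RtoC 0 -> continuous (fun u => (f u / g u)%C) x.
Proof. intros. apply continuous_Cmult; auto. now apply continuous_Cinv. Qed.
End Continuity.

Create HintDb cont.
#[local] Hint Resolve continuous_const continuous_id continuous_Cplus continuous_Copp
  continuous_Cminus continuous_Cmult continuous_Re continuous_Im continuous_RtoC continuous_Cmod
  continuous_Cconj continuous_Cpow : cont.

Lemma continuous_C_ext_loc (f g : C -> C) (z : C) (r : R) :
  0 < r -> (forall w, Cdisc z r w -> f w = g w) -> continuous f z -> continuous g z.
Proof.
  intros Hr E. rewrite !continuous_C_dist, <- (E z) by now apply Cdisc_center.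
  intros H e He. assert (L : locally z (Cdisc z r)) by (apply locally_Cdisc; eauto).
  generalize (filter_and _ _ (H e He) L). apply filter_imp. intros w [K Hw]. now rewrite <- E.
Qed.

(** * Complex differentiation *)

Notation is_C_derive := (is_derive (K := C_AbsRing) (V := C_NormedModule)).

Lemma is_C_derive_eps (f : C -> C) (z l : C) :
  is_C_derive f z l <->
  forall e, 0 < e -> exists d, 0 < d /\ forall w, Cdisc z d w ->
    Cmod (f w - f z - l * (w - z)) <= e * Cmod (w - z).
Proof.
  assert (E : forall w, minus (minus (f w) (f z)) (scal (minus w z) l)
    = (f w - f z - l * (w - z))%C).
  { intros w. change (f w - f z - (w - z) * l = f w - f z - l * (w - z))%C. ring. }
  split.
  - intros [_ H] e He. apply locally_Cdisc, locally_C.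
    generalize (H z (fun P HP => HP) (mkposreal e He)). apply filter_imp.
    intros w. now rewrite E.
  - intros H. split; [apply is_linear_scal_l|].
    intros x Hx e.
    apply (is_filter_lim_locally_unique (V := AbsRing_NormedModule C_AbsRing)) in Hx. rewrite <- Hx.
    apply locally_C. generalize (proj2 (locally_Cdisc _ _) (H e (cond_pos e))). apply filter_imp.
    intros w. now rewrite <- E.
Qed.

Lemma is_C_derive_caratheodory (f : C -> C) (z l : C) :
  is_C_derive f z l <->
  exists phi : C -> C, continuous phi z /\ phi z = l /\
    forall w, (f w - f z)%C = (phi w * (w - z))%C.
Proof.
  rewrite is_C_derive_eps. split.
  - intros H. exists (fun w => if Ceq_dec w z then l else ((f w - f z) / (w - z))%C).
    assert (Ez : (if Ceq_dec z z then l else ((f z - f z) / (z - z))%C) = l).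
    { destruct (Ceq_dec z z) as [_|n]; [reflexivity|now contradict n]. }
    split; [|split; [exact Ez|]].
    + apply continuous_C_eps. intros e He. rewrite Ez.
      destruct (H (e / 2)) as [d [Hd K]]; [lra|]. exists d. split; auto. intros w Hw.
      destruct (Ceq_dec w z) as [->|n]; [now rewrite Cmod_minus_diag|].
      apply Cminus_eq_contra in n.
      replace ((f w - f z) / (w - z) - l)%C with ((f w - f z - l * (w - z)) / (w - z))%C
        by (field; auto).
      rewrite Cmod_div by auto. apply Rle_lt_trans with (e / 2); [|lra].
      apply Rle_div_l; auto. now apply Cmod_gt_0.
    + intros w. destruct (Ceq_dec w z) as [->|n]; [ring|].
      field. now apply Cminus_eq_contra.
  - intros [phi [Hc [Hl E]]] e He.
    destruct (proj1 (continuous_C_eps _ _) Hc e He) as [d [Hd K]].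
    exists d. split; auto. intros w Hw. rewrite E, <- Hl.
    replace (phi w * (w - z) - phi z * (w - z))%C with ((phi w - phi z) * (w - z))%C by ring.
    rewrite Cmod_mult. apply Rmult_le_compat_r; [apply Cmod_ge_0|]. left. auto.
Qed.

Lemma is_C_derive_continuous (f : C -> C) (z l : C) : is_C_derive f z l -> continuous f z.
Proof.
  rewrite is_C_derive_caratheodory. intros [phi [Hc [_ E]]].
  apply continuous_ext with (fun w => (f z + phi w * (w - z))%C).
  { intros w. rewrite <- E. change (f z + (f w - f z) = f w)%C. ring. }
  auto with cont.
Qed.

Lemma ex_C_derive_continuous (f : C -> C) :
  (forall z, exists l, is_C_derive f z l) -> forall z, continuous f z.
Proof. intros H z. destruct (H z) as [l Hl]. now apply is_C_derive_continuous in Hl. Qed.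

Lemma is_C_derive_eq (f : C -> C) (z l l' : C) : is_C_derive f z l -> l = l' -> is_C_derive f z l'.
Proof. now intros H <-. Qed.

Lemma is_C_derive_const (c z : C) : is_C_derive (fun _ => c) z (RtoC 0).
Proof. apply (is_derive_const (V := C_NormedModule)). Qed.

Lemma is_C_derive_id (z : C) : is_C_derive (fun w => w) z (RtoC 1).
Proof.
  apply is_C_derive_caratheodory. exists (fun _ => RtoC 1).
  split; [auto with cont|]. split; [reflexivity|]. intros w. ring.
Qed.

Lemma is_C_derive_plus (f g : C -> C) (z l m : C) :
  is_C_derive f z l -> is_C_derive g z m -> is_C_derive (fun w => (f w + g w)%C) z (l + m)%C.
Proof. apply (is_derive_plus (V := C_NormedModule)). Qed.

Lemma is_C_derive_minus (f g : C -> C) (z l m : C) :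
  is_C_derive f z l -> is_C_derive g z m -> is_C_derive (fun w => (f w - g w)%C) z (l - m)%C.
Proof. apply (is_derive_minus (V := C_NormedModule)). Qed.

Lemma is_C_derive_comp (f g : C -> C) (z l m : C) :
  is_C_derive f (g z) l -> is_C_derive g z m -> is_C_derive (fun w => f (g w)) z (l * m)%C.
Proof.
  intros Hf Hg. assert (Hcg := is_C_derive_continuous _ _ _ Hg). revert Hf Hg.
  rewrite !is_C_derive_caratheodory. intros [p [Hp [El Ef]]] [q [Hq [Em Eg]]].
  exists (fun w => (p (g w) * q w)%C). split; [|split].
  - apply continuous_Cmult; auto. now apply (continuous_comp g p).
  - now subst.
  - intros w. rewrite Ef, Eg. ring.
Qed.

Lemma is_C_derive_mult (f g : C -> C) (z l m : C) :
  is_C_derive f z l -> is_C_derive g z m ->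
  is_C_derive (fun w => (f w * g w)%C) z (l * g z + f z * m)%C.
Proof.
  intros Hf Hg. assert (Hcg := is_C_derive_continuous _ _ _ Hg). revert Hf Hg.
  rewrite !is_C_derive_caratheodory. intros [p [Hp [El Ef]]] [q [Hq [Em Eg]]].
  exists (fun w => (p w * g w + f z * q w)%C). split; [|split].
  - auto with cont.
  - now subst.
  - intros w.
    replace (f w * g w - f z * g z)%C with ((f w - f z) * g w + f z * (g w - g z))%C by ring.
    rewrite Ef, Eg. ring.
Qed.

Lemma is_C_derive_scal (c : C) (f : C -> C) (z l : C) :
  is_C_derive f z l -> is_C_derive (fun w => (c * f w)%C) z (c * l)%C.
Proof.
  intros H.
  eapply is_C_derive_eq.
  - apply (is_C_derive_mult (fun _ => c)); [apply is_C_derive_const|exact H].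
  - ring.
Qed.

Lemma is_C_derive_minus_const (f : C -> C) (c z l : C) :
  is_C_derive f z l -> is_C_derive (fun w => (f w - c)%C) z l.
Proof.
  intros H.
  eapply is_C_derive_eq; [apply is_C_derive_minus; [exact H|apply is_C_derive_const]|]. ring.
Qed.

Lemma is_C_derive_Cinv (z : C) : z <> RtoC 0 -> is_C_derive (fun w => (/ w)%C) z (- / (z * z))%C.
Proof.
  intros Hz. assert (Hm := proj1 (Cmod_gt_0 _) Hz).
  assert (Hn : forall w, Cdisc z (Cmod z) w -> w <> RtoC 0).
  { intros w Hw ->. unfold Cdisc in Hw. rewrite Cmod_minus_sym in Hw.
    replace (z - RtoC 0)%C with z in Hw by ring. lra. }
  apply is_C_derive_eps. intros e He.
  assert (Hc : continuous (fun w => (- / (w * z))%C) z).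
  { apply continuous_Copp, continuous_Cinv; [auto with cont|now apply Cmult_neq_0]. }
  destruct (proj1 (continuous_C_eps _ _) Hc e He) as [d [Hd K]].
  exists (Rmin d (Cmod z)). split; [now apply Rmin_pos|]. intros w Hw.
  destruct (Rmin_Rgt_l _ _ _ Hw) as [W1 W2]. specialize (Hn w W2).
  replace (/ w - / z - - / (z * z) * (w - z))%C with ((- / (w * z) - - / (z * z)) * (w - z))%C
    by (field; auto).
  rewrite Cmod_mult. apply Rmult_le_compat_r; [apply Cmod_ge_0|]. left. now apply K.
Qed.

Lemma is_C_derive_inv (f : C -> C) (z l : C) :
  is_C_derive f z l -> f z <> RtoC 0 -> is_C_derive (fun w => (/ f w)%C) z (- l / (f z * f z))%C.
Proof.
  intros H Hn. eapply is_C_derive_eq.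
  - apply (is_C_derive_comp (fun w => (/ w)%C) f); [now apply is_C_derive_Cinv|exact H].
  - field. auto.
Qed.

Lemma is_C_derive_lift (P E psi : C -> C) (z l m : C) (r : R) :
  0 < r -> (forall w, Cdisc z r w -> P (psi w) = E w) -> continuous psi z ->
  is_C_derive P (psi z) l -> l <> RtoC 0 -> is_C_derive E z m -> is_C_derive psi z (m / l)%C.
Proof.
  intros Hr HE Hc HP Hl HEd. apply is_C_derive_caratheodory in HP, HEd.
  destruct HP as [p [Hp [El EP]]], HEd as [q [Hq [Em EE]]].
  apply is_C_derive_eps. intros e He.
  assert (Hpc : continuous (fun w => p (psi w)) z) by now apply (continuous_comp psi p).
  assert (Hl0 := proj1 (Cmod_gt_0 _) Hl).
  destruct (proj1 (continuous_C_eps _ _) Hpc (Cmod l)) as [d [Hd Kp]]; auto.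
  assert (Hcq : continuous (fun w => (q w / p (psi w))%C) z).
  { apply continuous_Cdiv; auto. now rewrite El. }
  destruct (proj1 (continuous_C_eps _ _) Hcq e He) as [d' [Hd' Kq]].
  exists (Rmin d' (Rmin d r)). split; [now repeat apply Rmin_pos|]. intros w Hw.
  destruct (Rmin_Rgt_l _ _ _ Hw) as [W1 W2]. destruct (Rmin_Rgt_l _ _ _ W2) as [W3 W4].
  assert (Hnz : p (psi w) <> RtoC 0).
  { intros E0. specialize (Kp w W3). rewrite E0, El, Cmod_minus_sym in Kp.
    replace (l - RtoC 0)%C with l in Kp by ring. lra. }
  assert (K := EP (psi w)). rewrite (HE w W4), (HE z (Cdisc_center z r Hr)), EE in K.
  assert (Epsi : (psi w - psi z)%C = (q w / p (psi w) * (w - z))%C).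
  { transitivity ((p (psi w) * (psi w - psi z)) / p (psi w))%C; [field; auto|].
    rewrite <- K. field. auto. }
  rewrite Epsi. specialize (Kq w W1). rewrite Em, El in Kq.
  replace (q w / p (psi w) * (w - z) - m / l * (w - z))%C
    with ((q w / p (psi w) - m / l) * (w - z))%C by ring.
  rewrite Cmod_mult. apply Rmult_le_compat_r; [apply Cmod_ge_0|]. now left.
Qed.

Definition C1_on (D : C -> Prop) (f f' : C -> C) : Prop :=
  forall z, D z -> is_C_derive f z (f' z) /\ continuous f' z.

Lemma C1_on_continuous (D : C -> Prop) (f f' : C -> C) (z : C) :
  C1_on D f f' -> D z -> continuous f z.
Proof. intros H Hz. eapply is_C_derive_continuous, H, Hz. Qed.

Lemma C1_on_incl (D D' : C -> Prop) (f f' : C -> C) :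
  (forall z, D' z -> D z) -> C1_on D f f' -> C1_on D' f f'.
Proof. intros Hi H z Hz. apply H, Hi, Hz. Qed.

(** * Curves in the complex plane *)

Notation is_curve_derive := (is_derive (K := R_AbsRing) (V := C_R_NormedModule)).

Lemma is_linear_C (L : C -> C) (M : R) :
  0 < M -> (forall z w, L (z + w)%C = (L z + L w)%C) ->
  (forall (k : R) z, L (RtoC k * z)%C = (RtoC k * L z)%C) -> (forall z, Cmod (L z) <= M * Cmod z) ->
  is_linear (U := C_R_NormedModule) (V := C_R_NormedModule) L.
Proof.
  intros HM Hp Hs Hn. split.
  - exact Hp.
  - intros k z. rewrite !scal_R_Cmult. apply Hs.
  - exists M. split; [exact HM|]. intros z. rewrite <- !Cmod_norm. apply Hn.
Qed.

Lemma is_linear_Cmult (c : C) :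
  is_linear (U := C_R_NormedModule) (V := C_R_NormedModule) (Cmult c).
Proof.
  apply is_linear_C with (Cmod c + 1).
  - assert (H := Cmod_ge_0 c). lra.
  - intros z w. ring.
  - intros k z. ring.
  - intros z. rewrite Cmod_mult. assert (H := Cmod_ge_0 z). lra.
Qed.

Lemma is_linear_Cconj : is_linear (U := C_R_NormedModule) (V := C_R_NormedModule) Cconj.
Proof.
  apply is_linear_C with 1.
  - lra.
  - apply Cplus_conj.
  - intros k z. apply injective_projections; simpl; ring.
  - intros z. rewrite Cmod_conj. lra.
Qed.

Lemma is_linear_Re : is_linear (U := C_R_NormedModule) (V := R_NormedModule) Re.
Proof. apply (is_linear_fst (U := R_NormedModule) (V := R_NormedModule)). Qed.

Lemma is_linear_Im : is_linear (U := C_R_NormedModule) (V := R_NormedModule) Im.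
Proof. apply (is_linear_snd (U := R_NormedModule) (V := R_NormedModule)). Qed.

Lemma is_linear_RtoC : is_linear (U := R_NormedModule) (V := C_R_NormedModule) RtoC.
Proof.
  split.
  - apply RtoC_plus.
  - intros k x. rewrite scal_R_Cmult. apply RtoC_mult.
  - exists 1. split; [lra|]. intros x. rewrite <- Cmod_norm, Cmod_R, Rmult_1_l.
    apply Rle_refl.
Qed.

Lemma is_derive_linear {V W : NormedModule R_AbsRing} (L : V -> W) (g : R -> V) (t : R) (v : V) :
  is_linear L -> is_derive g t v -> is_derive (fun s => L (g s)) t (L v).
Proof.
  intros HL Hg. apply filterdiff_ext_lin with (fun y => L (scal y v)).
  - apply (filterdiff_comp' g L); [exact Hg|now apply filterdiff_linear].
  - intros y. apply (linear_scal L HL).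
Qed.

Lemma is_curve_derive_eq (g : R -> C) (t : R) (v v' : C) :
  is_curve_derive g t v -> v = v' -> is_curve_derive g t v'.
Proof. now intros H <-. Qed.

Lemma is_curve_derive_continuous (g : R -> C) (t : R) (v : C) :
  is_curve_derive g t v -> continuous g t.
Proof. intros H. apply (ex_derive_continuous (V := C_R_NormedModule)). now exists v. Qed.

Lemma is_curve_derive_scal (c : C) (g : R -> C) (t : R) (v : C) :
  is_curve_derive g t v -> is_curve_derive (fun s => (c * g s)%C) t (c * v)%C.
Proof. apply (is_derive_linear (Cmult c)), is_linear_Cmult. Qed.

Lemma is_curve_derive_plus_const (a : C) (g : R -> C) (t : R) (v : C) :
  is_curve_derive g t v -> is_curve_derive (fun s => (a + g s)%C) t v.
Proof.
  intros H. eapply is_curve_derive_eq.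
  - apply (is_derive_plus (V := C_R_NormedModule) (fun _ => a) g);
      [apply (is_derive_const (V := C_R_NormedModule))|exact H].
  - apply (plus_zero_l (G := C_AbelianGroup)).
Qed.

Lemma is_curve_derive_Re_Im (g : R -> C) (t : R) (v : C) :
  is_derive (fun s => Re (g s)) t (Re v) -> is_derive (fun s => Im (g s)) t (Im v) ->
  is_curve_derive g t v.
Proof.
  intros H1 H2. apply (is_derive_linear RtoC) in H1, H2; try apply is_linear_RtoC.
  apply (is_derive_ext (fun s => (RtoC (Re (g s)) + Ci * RtoC (Im (g s)))%C)).
  { intros s. symmetry. apply Re_Im_decomp. }
  rewrite (Re_Im_decomp v).
  apply (is_derive_plus (V := C_R_NormedModule)); [exact H1|]. now apply is_curve_derive_scal.
Qed.

Lemma is_C_derive_filterdiff (f : C -> C) (z l : C) :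
  is_C_derive f z l ->
  filterdiff (U := C_R_NormedModule) (V := C_R_NormedModule) f (locally z) (Cmult l).
Proof.
  rewrite is_C_derive_eps. intros H. split; [apply is_linear_Cmult|].
  intros x Hx. apply (is_filter_lim_locally_unique (V := C_R_NormedModule)) in Hx. rewrite <- Hx.
  intros e. generalize (proj2 (locally_Cdisc _ _) (H e (cond_pos e))). apply filter_imp.
  intros w. now rewrite <- !Cmod_norm.
Qed.

Lemma is_curve_derive_comp (f : C -> C) (g : R -> C) (t : R) (l v : C) :
  is_C_derive f (g t) l -> is_curve_derive g t v -> is_curve_derive (fun s => f (g s)) t (l * v)%C.
Proof.
  intros Hf Hg. apply filterdiff_ext_lin with (fun y : R => (l * scal y v)%C).
  - apply (filterdiff_comp' (V := C_R_NormedModule) g f); [exact Hg|].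
    now apply is_C_derive_filterdiff.
  - intros y. change ((l * scal y v)%C = scal y (l * v)%C). rewrite !scal_R_Cmult. ring.
Qed.

Definition seg (a b : C) (t : R) : C := (a + RtoC t * (b - a))%C.

Lemma seg_0 (a b : C) : seg a b 0 = a.
Proof. unfold seg. ring. Qed.

Lemma seg_1 (a b : C) : seg a b 1 = b.
Proof. unfold seg. ring. Qed.

Lemma Re_seg (a b : C) (t : R) : Re (seg a b t) = Re a + t * (Re b - Re a).
Proof. unfold seg. now rewrite re_plus, re_scal_l. Qed.

Lemma is_curve_derive_seg (a b : C) (t : R) : is_curve_derive (seg a b) t (b - a)%C.
Proof.
  apply is_curve_derive_plus_const.
  apply (is_derive_ext (fun s : R => scal s (b - a)%C)); [intros s; apply scal_R_Cmult|].
  eapply is_curve_derive_eq; [apply (is_derive_scal_l (V := C_R_NormedModule)), (is_derive_id t)|].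
  apply (scal_one (V := C_R_NormedModule)).
Qed.

Lemma continuous_seg (a b : C) (t : R) : continuous (seg a b) t.
Proof. eapply is_curve_derive_continuous, is_curve_derive_seg. Qed.

Lemma seg_dist (a b c d : C) (t : R) :
  0 <= t <= 1 -> Cmod (seg a b t - seg c d t) <= (1 - t) * Cmod (a - c) + t * Cmod (b - d).
Proof.
  intros Ht.
  replace (seg a b t - seg c d t)%C with (RtoC (1 - t) * (a - c) + RtoC t * (b - d))%C
    by (unfold seg; rewrite RtoC_minus; ring).
  eapply Rle_trans; [apply Cmod_triangle|]. rewrite !Cmod_scal, !Rabs_pos_eq by lra. lra.
Qed.

Lemma seg_dist_param (a b : C) (s t : R) :
  Cmod (seg a b s - seg a b t) = Rabs (s - t) * Cmod (b - a).
Proof. rewrite <- Cmod_scal. f_equal. unfold seg. rewrite RtoC_minus. ring. Qed.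

Lemma seg_diag (a : C) (t : R) : seg a a t = a.
Proof. unfold seg. ring. Qed.

Lemma seg_dist_point (a b c : C) (t : R) :
  0 <= t <= 1 -> Cmod (seg a b t - c) <= (1 - t) * Cmod (a - c) + t * Cmod (b - c).
Proof. rewrite <- (seg_diag c t) at 1. apply seg_dist. Qed.

Definition convex (D : C -> Prop) : Prop :=
  forall a b t, D a -> D b -> 0 <= t <= 1 -> D (seg a b t).

Lemma convex_Cdisc (c : C) (r : R) : convex (Cdisc c r).
Proof.
  unfold Cdisc. intros a b t Ha Hb Ht. eapply Rle_lt_trans; [now apply seg_dist_point|].
  destruct (Rle_dec (1 / 2) t); nra.
Qed.

Lemma convex_closed_Cdisc (c : C) (r : R) : convex (fun z => Cmod (z - c) <= r).
Proof.
  intros a b t Ha Hb Ht. eapply Rle_trans; [now apply seg_dist_point|]. nra.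
Qed.

Lemma curve_mean_value (g v : R -> C) (a b M : R) : a <= b ->
  (forall t, a <= t <= b -> is_curve_derive g t (v t)) ->
  (forall t, a <= t <= b -> Cmod (v t) <= M) ->
  Cmod (g b - g a) <= M * (b - a).
Proof.
  intros Hab Hg HM. set (D := (g b - g a)%C).
  assert (HD := Cmod_ge_0 D). assert (Hva := Cmod_ge_0 (v a)). assert (HMa := HM a ltac:(lra)).
  (* The scalar function [Re (conj D * g)] increases by [|D|^2] along the curve. *)
  assert (Hd : forall t, a <= t <= b ->
    is_derive (fun t => Re (Cconj D * g t)%C) t (Re (Cconj D * v t))).
  { intros t Ht. apply (is_derive_linear Re (fun t => (Cconj D * g t)%C)); [apply is_linear_Re|].
    now apply is_curve_derive_scal, Hg. }
  destruct (MVT_gen (fun t => Re (Cconj D * g t)%C) a b (fun t => Re (Cconj D * v t)%C))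
    as [c [Hc Ec]].
  - intros t Ht. rewrite Rmin_left, Rmax_right in Ht by lra. apply Hd. lra.
  - intros t Ht. rewrite Rmin_left, Rmax_right in Ht by lra.
    apply continuity_pt_filterlim, (ex_derive_continuous (V := R_NormedModule)).
    eexists. now apply Hd.
  - rewrite Rmin_left, Rmax_right in Hc by lra.
    replace (Re (Cconj D * g b) - Re (Cconj D * g a)) with (Cmod D * Cmod D) in Ec.
    2: { rewrite Cmod_sqr. unfold D, Re, Im; simpl. ring. }
    assert (K : Re (Cconj D * v c) <= Cmod D * M).
    { eapply Rle_trans; [apply Rle_abs|]. eapply Rle_trans; [apply re_le_Cmod|].
      rewrite Cmod_mult, Cmod_conj. now apply Rmult_le_compat_l, HM. }
    destruct (Req_dec (Cmod D) 0) as [->|HD0]; [apply Rmult_le_pos; lra|].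
    apply Rmult_le_reg_l with (Cmod D); [lra|]. rewrite Ec, <- Rmult_assoc.
    apply Rmult_le_compat_r; lra.
Qed.

Lemma mean_value_convex (D : C -> Prop) (f f' : C -> C) (M : R) (a b : C) :
  convex D -> (forall z, D z -> is_C_derive f z (f' z)) -> (forall z, D z -> Cmod (f' z) <= M) ->
  D a -> D b -> Cmod (f b - f a) <= M * Cmod (b - a).
Proof.
  intros HD Hf HM Ha Hb.
  assert (K := curve_mean_value (fun t => f (seg a b t)) (fun t => (f' (seg a b t) * (b - a))%C)
    0 1 (M * Cmod (b - a)) Rle_0_1).
  cbv beta in K. rewrite seg_0, seg_1, Rminus_0_r, Rmult_1_r in K. apply K.
  - intros t Ht. apply is_curve_derive_comp; [now apply Hf, HD|apply is_curve_derive_seg].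
  - intros t Ht. rewrite Cmod_mult. apply Rmult_le_compat_r; [apply Cmod_ge_0|]. now apply HM, HD.
Qed.

Lemma mean_value_convex_affine (D : C -> Prop) (f f' : C -> C) (l : C) (M : R) (a b : C) :
  convex D -> (forall z, D z -> is_C_derive f z (f' z)) ->
  (forall z, D z -> Cmod (f' z - l) <= M) ->
  D a -> D b -> Cmod (f b - f a - l * (b - a)) <= M * Cmod (b - a).
Proof.
  intros HD Hf HM Ha Hb.
  replace (f b - f a - l * (b - a))%C with ((f b - l * b) - (f a - l * a))%C by ring.
  apply (mean_value_convex D (fun z => (f z - l * z)%C) (fun z => (f' z - l)%C)); auto.
  intros z Hz. apply is_C_derive_minus; auto.
  eapply is_C_derive_eq; [apply is_C_derive_scal, is_C_derive_id|]. ring.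
Qed.

(** * Integrals of complex-valued functions of a real variable *)

Notation CRInt := (RInt (V := C_R_CompleteNormedModule)).

Lemma ex_RInt_continuous_all {V : CompleteNormedModule R_AbsRing} (f : R -> V) (a b : R) :
  (forall t, continuous f t) -> ex_RInt f a b.
Proof. intros H. apply (ex_RInt_continuous f). auto. Qed.

#[local] Hint Extern 1 (ex_RInt _ _ _) => apply ex_RInt_continuous_all : cont.

Lemma RInt_linear {V W : CompleteNormedModule R_AbsRing} (L : V -> W) (f : R -> V) (a b : R) :
  is_linear L -> (forall t, continuous f t) -> RInt (fun t => L (f t)) a b = L (RInt f a b).
Proof.
  intros HL Hf. apply is_RInt_unique.
  replace (L (RInt f a b)) with (minus (L (RInt f a b)) (L (RInt f a a))).
  - apply (is_RInt_derive (fun t => L (RInt f a t))).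
    + intros t _. apply is_derive_linear; [exact HL|].
      apply is_derive_RInt with a; [|apply Hf]. apply filter_forall. intros s.
      now apply (RInt_correct f), ex_RInt_continuous_all.
    + intros t _. apply (continuous_comp f L); [apply Hf|].
      apply (filterdiff_continuous (U := V) (V := W)). exists L. now apply filterdiff_linear.
  - replace (L (RInt f a a)) with (zero : W); [apply (minus_zero_r (G := W))|].
    rewrite (RInt_point a f). symmetry. exact (linear_zero (U := V) (V := W) L HL).
Qed.

Lemma Re_CRInt (f : R -> C) (a b : R) :
  (forall t, continuous f t) -> Re (CRInt f a b) = RInt (fun t => Re (f t)) a b.
Proof.
  intros Hf. symmetry.
  exact (RInt_linear (V := C_R_CompleteNormedModule) (W := R_CompleteNormedModule)
    Re f a b is_linear_Re Hf).
Qed.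

Lemma CRInt_Cconj (f : R -> C) (a b : R) :
  (forall t, continuous f t) -> CRInt (fun t => Cconj (f t)) a b = Cconj (CRInt f a b).
Proof. apply (RInt_linear (V := C_R_CompleteNormedModule)), is_linear_Cconj. Qed.

Lemma CRInt_scal (c : C) (f : R -> C) (a b : R) :
  (forall t, continuous f t) -> CRInt (fun t => (c * f t)%C) a b = (c * CRInt f a b)%C.
Proof. apply (RInt_linear (V := C_R_CompleteNormedModule)), is_linear_Cmult. Qed.

Lemma CRInt_ext (f g : R -> C) (a b : R) :
  (forall t, f t = g t) -> CRInt f a b = CRInt g a b.
Proof. intros H. apply (RInt_ext (V := C_R_CompleteNormedModule)). auto. Qed.

Lemma CRInt_plus (f g : R -> C) (a b : R) :
  (forall t, continuous f t) -> (forall t, continuous g t) ->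
  CRInt (fun t => (f t + g t)%C) a b = (CRInt f a b + CRInt g a b)%C.
Proof. intros Hf Hg. apply (RInt_plus (V := C_R_CompleteNormedModule)); auto with cont. Qed.

Lemma CRInt_minus (f g : R -> C) (a b : R) :
  (forall t, continuous f t) -> (forall t, continuous g t) ->
  CRInt (fun t => (f t - g t)%C) a b = (CRInt f a b - CRInt g a b)%C.
Proof. intros Hf Hg. apply (RInt_minus (V := C_R_CompleteNormedModule)); auto with cont. Qed.

Lemma CRInt_const (c : C) (a b : R) : CRInt (fun _ => c) a b = (RtoC (b - a) * c)%C.
Proof. rewrite <- scal_R_Cmult. apply (RInt_const (V := C_R_CompleteNormedModule)). Qed.

Lemma CRInt_derive (F f : R -> C) (a b : R) :
  (forall t, is_curve_derive F t (f t)) -> (forall t, continuous f t) ->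
  CRInt f a b = (F b - F a)%C.
Proof.
  intros HF Hf. apply (is_RInt_unique (V := C_R_CompleteNormedModule)).
  now apply (is_RInt_derive (V := C_R_CompleteNormedModule) F f).
Qed.

Lemma Cmod_CRInt_le_RInt (f : R -> C) (g : R -> R) (a b : R) :
  a <= b -> (forall t, continuous f t) -> (forall t, continuous g t) ->
  (forall t, a <= t <= b -> Cmod (f t) <= g t) -> Cmod (CRInt f a b) <= RInt g a b.
Proof.
  intros Hab Hf Hg HM. rewrite Cmod_norm.
  apply (norm_RInt_le (V := C_R_NormedModule) f g a b); auto.
  - intros t Ht. rewrite <- Cmod_norm. now apply HM.
  - apply (RInt_correct (V := C_R_CompleteNormedModule)). auto with cont.
  - apply (RInt_correct (V := R_CompleteNormedModule)). auto with cont.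
Qed.

Lemma Cmod_CRInt_le (f : R -> C) (a b M : R) :
  a <= b -> (forall t, continuous f t) -> (forall t, a <= t <= b -> Cmod (f t) <= M) ->
  Cmod (CRInt f a b) <= (b - a) * M.
Proof.
  intros Hab Hf HM. rewrite <- (RInt_const a b M : RInt (fun _ => M) a b = (b - a) * M).
  apply Cmod_CRInt_le_RInt; auto with cont.
Qed.

(** * The complex exponential *)

Definition cis (t : R) : C := (cos t, sin t).

Definition cexp (z : C) : C := (RtoC (exp (Re z)) * cis (Im z))%C.

Lemma cis_0 : cis 0 = RtoC 1.
Proof. unfold cis, RtoC. now rewrite cos_0, sin_0. Qed.

Lemma cis_plus (s t : R) : cis (s + t) = (cis s * cis t)%C.
Proof. unfold cis, Cmult; simpl. rewrite cos_plus, sin_plus. f_equal; ring. Qed.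

Lemma Cmod_cis (t : R) : Cmod (cis t) = 1.
Proof.
  unfold Cmod, cis; simpl. replace (_ + _) with 1; [apply sqrt_1|].
  assert (K := sin2_cos2 t). unfold Rsqr in K. lra.
Qed.

Lemma cis_neq_0 (t : R) : cis t <> RtoC 0.
Proof. apply Cmod_gt_0. rewrite Cmod_cis. lra. Qed.

Lemma Cconj_cis (t : R) : Cconj (cis t) = (/ cis t)%C.
Proof.
  assert (E : (Cconj (cis t) * cis t)%C = RtoC 1).
  { apply injective_projections; simpl; [|ring].
    assert (K := sin2_cos2 t). unfold Rsqr in K. lra. }
  assert (Hn := cis_neq_0 t).
  transitivity (Cconj (cis t) * cis t * / cis t)%C; [field; auto|]. rewrite E. ring.
Qed.

Lemma is_curve_derive_cis (t : R) : is_curve_derive cis t (Ci * cis t)%C.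
Proof.
  apply is_curve_derive_Re_Im; unfold Re, Im; simpl.
  - replace (0 * cos t - 1 * sin t) with (- sin t) by ring. apply is_derive_cos.
  - replace (0 * sin t + 1 * cos t) with (cos t) by ring. apply is_derive_sin.
Qed.

Lemma continuous_cis (t : R) : continuous cis t.
Proof. eapply is_curve_derive_continuous, is_curve_derive_cis. Qed.

Lemma cis_period (t : R) (k : Z) : cis (t + 2 * PI * IZR k) = cis t.
Proof.
  rewrite cis_plus. replace (cis (2 * PI * IZR k)) with (RtoC 1); [ring|].
  assert (Hs : sin (PI * IZR k) = 0) by (apply sin_eq_0_1; exists k; ring).
  unfold cis, RtoC. replace (2 * PI * IZR k) with (2 * (PI * IZR k)) by ring.
  rewrite cos_2a_sin, sin_2a, Hs. f_equal; ring.
Qed.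

Lemma cis_2PI : cis (2 * PI) = cis 0.
Proof. rewrite <- (cis_period 0 1). f_equal. ring. Qed.

Lemma cos_eq_1_period (x : R) : cos x = 1 -> exists k : Z, x = 2 * PI * IZR k.
Proof.
  intros H. replace x with (2 * (x / 2)) in H by field. rewrite cos_2a_sin in H.
  assert (Hs : sin (x / 2) = 0) by nra.
  destruct (sin_eq_0_0 _ Hs) as [k Hk]. exists k. lra.
Qed.

Lemma polar_form (z : C) : exists t, z = (RtoC (Cmod z) * cis t)%C.
Proof.
  assert (Hre := re_le_Cmod z). assert (Hsq := Cmod_sqr z). assert (Hm := Cmod_ge_0 z).
  destruct (Req_dec (Cmod z) 0) as [E|E].
  { exists 0. rewrite E, Cmult_0_l. now apply Cmod_eq_0. }
  set (m := Cmod z) in *. apply Rabs_le_between in Hre.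
  assert (Hc : cos (acos (Re z / m)) = Re z / m).
  { apply cos_acos. split; [apply Rle_div_r|apply Rle_div_l]; lra. }
  set (t := acos (Re z / m)) in *.
  assert (Hs : sin t = Im z / m \/ sin t = - (Im z / m)).
  { apply Rsqr_eq. assert (K := sin2_cos2 t). rewrite Hc in K. unfold Rsqr in *.
    assert (Re z / m * (Re z / m) + Im z / m * (Im z / m) = 1); [|lra].
    replace (Re z / m * (Re z / m) + Im z / m * (Im z / m))
      with ((Re z * Re z + Im z * Im z) / (m * m)) by (field; auto).
    rewrite <- Hsq. field. auto. }
  destruct Hs as [Hs|Hs]; [exists t|exists (- t)]; apply injective_projections; simpl;
    rewrite ?cos_neg, ?sin_neg, Hc, Hs; unfold Re, Im; field; auto.
Qed.

Lemma Cmod_rcis (r t : R) : 0 <= r -> Cmod (RtoC r * cis t) = r.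
Proof. intros H. rewrite Cmod_scal, Cmod_cis, Rabs_pos_eq; lra. Qed.

Definition circle (a : C) (r t : R) : C := (a + RtoC r * cis t)%C.

Lemma Cmod_circle_minus (a : C) (r t : R) : 0 <= r -> Cmod (circle a r t - a) = r.
Proof. intros H. unfold circle. now rewrite Cmod_plus_minus_l, Cmod_rcis. Qed.

Lemma circle_2PI (a : C) (r : R) : circle a r (2 * PI) = circle a r 0.
Proof. unfold circle. now rewrite cis_2PI. Qed.

Lemma is_curve_derive_circle (a : C) (r t : R) :
  is_curve_derive (circle a r) t (RtoC r * (Ci * cis t))%C.
Proof. apply is_curve_derive_plus_const, is_curve_derive_scal, is_curve_derive_cis. Qed.

Lemma continuous_circle (a : C) (r t : R) : continuous (circle a r) t.
Proof. eapply is_curve_derive_continuous, is_curve_derive_circle. Qed.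

Lemma circle_minus_circle (a b : C) (r t : R) : (circle b r t - circle a r t)%C = (b - a)%C.
Proof. unfold circle. ring. Qed.

Lemma circle_period (a : C) (r t : R) (k : Z) : circle a r (t + 2 * PI * IZR k) = circle a r t.
Proof. unfold circle. now rewrite cis_period. Qed.

Lemma circle_param (a z : C) (r : R) : Cmod (z - a) = r -> exists t, z = circle a r t.
Proof.
  intros <-. destruct (polar_form (z - a)) as [t Et]. exists t. unfold circle. rewrite <- Et. ring.
Qed.

Lemma reduce_mod_2PI (t c : R) : exists k : Z, Rabs (t + 2 * PI * IZR k - c) <= PI.
Proof.
  assert (HP := PI_RGT_0). set (q := (c - t) / (2 * PI)).
  destruct (archimed (q - 1 / 2)) as [A B]. exists (up (q - 1 / 2)).
  assert (E : c - t = 2 * PI * q) by (unfold q; field; lra).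
  apply Rabs_le. nra.
Qed.

Lemma circle_bounded (f : C -> C) (a : C) (r : R) :
  0 <= r -> (forall z, Cmod (z - a) = r -> continuous f z) ->
  exists z0, Cmod (z0 - a) = r /\ forall z, Cmod (z - a) = r -> Cmod (f z) <= Cmod (f z0).
Proof.
  intros Hr Hf. assert (HP := PI_RGT_0).
  destruct (continuity_ab_maj (fun t => Cmod (f (circle a r t))) (- PI) PI) as [t0 [H0 _]];
    [lra| |].
  - intros t _. apply continuity_pt_filterlim.
    apply (continuous_Cmod (fun t => f (circle a r t))).
    apply (continuous_comp (circle a r) f); [apply continuous_circle|].
    now apply Hf, Cmod_circle_minus.
  - exists (circle a r t0). split; [now apply Cmod_circle_minus|]. intros z Hz.
    destruct (circle_param a z r Hz) as [t ->].
    destruct (reduce_mod_2PI t 0) as [k Hk]. rewrite Rminus_0_r in Hk.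
    rewrite <- (circle_period a r t k). apply H0. now apply Rabs_le_between.
Qed.

Lemma exp_le (x y : R) : x <= y -> exp x <= exp y.
Proof. intros [H| ->]; [left; now apply exp_increasing|apply Rle_refl]. Qed.

Lemma exp_le_inv (x y : R) : exp x <= exp y -> x <= y.
Proof. intros H. apply Rnot_lt_le. intros Hlt. apply exp_increasing in Hlt. lra. Qed.

Lemma Cmod_cexp (z : C) : Cmod (cexp z) = exp (Re z).
Proof.
  unfold cexp. rewrite Cmod_scal, Cmod_cis, Rabs_pos_eq; [ring|]. left. apply exp_pos.
Qed.

Lemma cexp_neq_0 (z : C) : cexp z <> RtoC 0.
Proof. apply Cmod_gt_0. rewrite Cmod_cexp. apply exp_pos. Qed.

Lemma cexp_0 : cexp 0 = RtoC 1.
Proof. unfold cexp, Re, Im; simpl. rewrite exp_0, cis_0. ring. Qed.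

Lemma cexp_plus (z w : C) : cexp (z + w) = (cexp z * cexp w)%C.
Proof.
  unfold cexp. rewrite re_plus, im_plus, exp_plus, cis_plus, RtoC_mult. ring.
Qed.

Lemma cexp_INR_mult (n : nat) (z : C) : cexp (RtoC (INR n) * z) = (cexp z ^ n)%C.
Proof.
  induction n.
  - simpl. rewrite Cmult_0_l. apply cexp_0.
  - rewrite S_INR, RtoC_plus, Cmult_plus_distr_r, Cmult_1_l, cexp_plus, IHn. simpl. ring.
Qed.

Lemma cexp_minus (z w : C) : cexp (z - w) = (cexp z / cexp w)%C.
Proof.
  assert (Hw := cexp_neq_0 w). replace (cexp z) with (cexp (z - w) * cexp w)%C.
  - field. exact Hw.
  - rewrite <- cexp_plus. f_equal. ring.
Qed.

Definition period (k : Z) : C := (0, 2 * PI * IZR k).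

Lemma Re_plus_period (z : C) (k : Z) : Re (z + period k) = Re z.
Proof. rewrite re_plus. apply Rplus_0_r. Qed.

Lemma Cmod_period (k : Z) : Cmod (period k) = 2 * PI * Rabs (IZR k).
Proof.
  assert (H := PI_RGT_0). replace (period k) with (Ci * RtoC (2 * PI * IZR k))%C.
  - rewrite Cmod_mult, Cmod_Ci, Cmod_R, Rabs_mult, (Rabs_pos_eq (2 * PI)); lra.
  - apply injective_projections; simpl; ring.
Qed.

Lemma Cmod_period_1 : Cmod (period 1) = 2 * PI.
Proof. rewrite Cmod_period, Rabs_R1. ring. Qed.

Lemma cexp_plus_period (z : C) (k : Z) : cexp (z + period k) = cexp z.
Proof. unfold cexp. rewrite Re_plus_period, im_plus. simpl. now rewrite cis_period. Qed.

Lemma cexp_eq (z w : C) : cexp z = cexp w -> exists k, z = (w + period k)%C.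
Proof.
  intros H.
  assert (E : cexp (z - w) = RtoC 1) by (rewrite cexp_minus, H; field; apply cexp_neq_0).
  assert (Er : Re (z - w) = 0).
  { apply exp_inv. now rewrite <- Cmod_cexp, E, Cmod_1, exp_0. }
  unfold cexp in E. rewrite Er, exp_0, Cmult_1_l in E.
  destruct (cos_eq_1_period (Im (z - w)) (f_equal fst E)) as [k Hk]. exists k.
  replace z with (w + (z - w))%C at 1 by ring. f_equal. now apply injective_projections.
Qed.

Lemma clog_near (z : C) (c : R) : z <> RtoC 0 -> exists s, cexp s = z /\ Rabs (Im s - c) <= PI.
Proof.
  intros Hz. apply Cmod_gt_0 in Hz. destruct (polar_form z) as [t Et].
  destruct (reduce_mod_2PI t c) as [k Hk]. exists (ln (Cmod z), t + 2 * PI * IZR k).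
  split; [|exact Hk]. unfold cexp, Re, Im; simpl. now rewrite exp_ln, cis_period.
Qed.

Lemma clog_exists (z : C) : z <> RtoC 0 -> exists s, cexp s = z.
Proof. intros Hz. destruct (clog_near z 0 Hz) as [s [Es _]]. now exists s. Qed.

Lemma is_derive_norm_remainder {V : NormedModule R_AbsRing} (f : R -> V) (x : R) (l : V) (e : R) :
  is_derive f x l -> 0 < e -> exists d, 0 < d /\ forall y, Rabs (y - x) < d ->
    norm (minus (minus (f y) (f x)) (scal (y - x) l)) <= e * Rabs (y - x).
Proof.
  intros [_ H] He. destruct (H x (fun P HP => HP) (mkposreal e He)) as [d K].
  exists d. split; [apply cond_pos|exact K].
Qed.

Lemma is_C_derive_cexp_0 : is_C_derive cexp (RtoC 0) (RtoC 1).
Proof.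
  apply is_C_derive_eps. intros e He.
  destruct (is_derive_norm_remainder exp 0 _ (e / 3) (is_derive_exp 0)) as [d1 [Hd1 Kexp]]; [lra|].
  destruct (is_derive_norm_remainder (V := C_R_NormedModule) cis 0 _ (e / 6)
    (is_curve_derive_cis 0))
    as [d2 [Hd2 Kcis]]; [lra|].
  exists (Rmin (Rmin d1 d2) (Rmin 1 (e / 3))). split; [repeat apply Rmin_pos; lra|].
  intros w Hw. unfold Cdisc in Hw. replace (w - RtoC 0)%C with w in * by ring. rewrite cexp_0.
  destruct (Rmin_Rgt_l _ _ _ Hw) as [W12 W34]. destruct (Rmin_Rgt_l _ _ _ W12) as [W1 W2].
  destruct (Rmin_Rgt_l _ _ _ W34) as [W3 W4].
  assert (Hx := re_le_Cmod w). assert (Hy := Im_le_Cmod w).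
  assert (Ew := Re_Im_decomp w). set (x := Re w) in *. set (y := Im w) in *. set (m := Cmod w) in *.
  assert (Py := Rabs_pos y).
  (* [exp x cis y - 1 - x - i y = (exp x - 1 - x) cis y + (1 + x) (cis y - 1 - i y) + i x y] *)
  assert (Rexp : Rabs (exp x - 1 - x) <= e / 3 * Rabs x).
  { specialize (Kexp x). rewrite Rminus_0_r, exp_0 in Kexp.
    replace (exp x - 1 - x) with (minus (minus (exp x) 1) (scal x 1)); [apply Kexp; lra|].
    change (exp x - 1 - x * 1 = exp x - 1 - x). ring. }
  assert (Rcis : Cmod (cis y - 1 - Ci * RtoC y) <= e / 6 * Rabs y).
  { specialize (Kcis y). rewrite Rminus_0_r, cis_0, <- Cmod_norm, scal_R_Cmult in Kcis.
    replace (cis y - 1 - Ci * RtoC y)%C with (cis y - 1 - RtoC y * (Ci * 1))%C by ring.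
    apply Kcis. lra. }
  replace (cexp w - 1 - 1 * w)%C with (RtoC (exp x - 1 - x) * cis y
    + RtoC (1 + x) * (cis y - 1 - Ci * RtoC y) + RtoC (x * y) * Ci)%C.
  2: { rewrite Ew at 2. unfold cexp. fold x y. rewrite !RtoC_minus, RtoC_plus, RtoC_mult. ring. }
  eapply Rle_trans; [apply Cmod_triangle|].
  eapply Rle_trans; [apply Rplus_le_compat_r, Cmod_triangle|].
  rewrite !Cmod_scal, Cmod_cis, Cmod_Ci, Rabs_mult.
  assert (R1x : Rabs (1 + x) <= 2).
  { eapply Rle_trans; [apply Rabs_triang|]. rewrite Rabs_R1. lra. }
  assert (Rabs (1 + x) * Cmod (cis y - 1 - Ci * RtoC y) <= 2 * (e / 6 * Rabs y)).
  { apply Rmult_le_compat; auto using Rabs_pos, Cmod_ge_0. }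
  nra.
Qed.

Lemma is_C_derive_cexp (z : C) : is_C_derive cexp z (cexp z).
Proof.
  assert (E : forall w, (cexp z * cexp (w - z))%C = cexp w).
  { intros w. rewrite <- cexp_plus. f_equal. ring. }
  apply (is_derive_ext (fun w : C => (cexp z * cexp (w - z))%C)); [exact E|].
  eapply is_C_derive_eq; [apply is_C_derive_scal, (is_C_derive_comp cexp (fun w => (w - z)%C))|].
  - replace (z - z)%C with (RtoC 0) by ring. apply is_C_derive_cexp_0.
  - apply is_C_derive_minus_const, is_C_derive_id.
  - ring.
Qed.

Lemma continuous_cexp {U : UniformSpace} (f : U -> C) (x : U) :
  continuous f x -> continuous (fun u => cexp (f u)) x.
Proof.
  intros H. apply (continuous_comp f cexp); [exact H|].
  eapply is_C_derive_continuous, is_C_derive_cexp.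
Qed.

Lemma C1_on_cexp (D : C -> Prop) : C1_on D cexp cexp.
Proof. intros z _. split; [apply is_C_derive_cexp|]. apply continuous_cexp, continuous_id. Qed.

#[local] Hint Resolve continuous_cis continuous_cexp : cont.

(** * Geometric convergence and backward shadowing *)

Lemma pow_small (K q e : R) :
  0 <= q < 1 -> 0 < e -> exists N, forall n, (N <= n)%nat -> K * q ^ n < e.
Proof.
  intros Hq He. assert (HK := Rabs_pos K).
  destruct (pow_lt_1_zero q ltac:(rewrite Rabs_pos_eq; lra) (e / (1 + Rabs K))) as [N HN].
  { apply Rdiv_lt_0_compat; lra. }
  exists N. intros n Hn. specialize (HN n ltac:(lia)).
  assert (Hp : 0 <= q ^ n) by now apply pow_le.
  rewrite Rabs_pos_eq in HN by exact Hp. apply Rlt_div_r in HN; [|lra].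
  assert (H := Rle_abs K). nra.
Qed.

Lemma Rle_0_of_le_geometric (K q x : R) : 0 <= q < 1 -> (forall n, x <= K * q ^ n) -> x <= 0.
Proof.
  intros Hq Hx. apply Rnot_lt_le. intros Hlt. destruct (pow_small K q x Hq Hlt) as [n Hn].
  specialize (Hx n). specialize (Hn n (le_n n)). lra.
Qed.

Lemma geometric_step_dist (a : nat -> C) (K q : R) (n k : nat) : 0 <= q < 1 ->
  (forall m, Cmod (a (S m) - a m) <= K * q ^ m) ->
  (1 - q) * Cmod (a (n + k)%nat - a n) <= K * q ^ n - K * q ^ (n + k).
Proof.
  intros Hq H. induction k.
  - rewrite Nat.add_0_r, Cmod_minus_diag. lra.
  - rewrite Nat.add_succ_r. assert (T := Cmod_dist_triangle (a (S (n + k))) (a (n + k)%nat) (a n)).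
    assert (Hn := H (n + k)%nat). simpl pow. nra.
Qed.

Lemma sum_n_telescope (a : nat -> C) (n : nat) :
  sum_n (G := C_AbelianGroup) (fun m => (a (S m) - a m)%C) n = (a (S n) - a 0%nat)%C.
Proof.
  induction n; [now rewrite sum_O|]. rewrite sum_Sn, IHn.
  change (a (S n) - a 0%nat + (a (S (S n)) - a (S n)) = a (S (S n)) - a 0%nat)%C. ring.
Qed.

Lemma geometric_step_converges (a : nat -> C) (K q : R) : 0 <= q < 1 ->
  (forall n, Cmod (a (S n) - a n) <= K * q ^ n) ->
  exists p, forall e, 0 < e -> exists N, forall n, (N <= n)%nat -> Cmod (a (S n) - p) < e.
Proof.
  intros Hq H.
  destruct (ex_series_le (V := C_R_CompleteNormedModule) (fun n => (a (S n) - a n)%C)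
    (fun n => K * q ^ n)) as [l Hl].
  - intros n. rewrite <- Cmod_norm. apply H.
  - apply (ex_series_scal (V := R_NormedModule) K (fun n => q ^ n)), ex_series_geom.
    rewrite Rabs_pos_eq; lra.
  - exists (a 0%nat + l)%C. intros e He.
    destruct (proj1 (filterlim_locally_ball_norm (U := C_R_NormedModule) _ _) Hl (mkposreal e He))
      as [N HN].
    exists N. intros n Hn. specialize (HN n Hn). unfold ball_norm in HN. rewrite <- Cmod_norm in HN.
    change (Cmod (sum_n (G := C_AbelianGroup) (fun m => (a (S m) - a m)%C) n - l) < e) in HN.
    rewrite sum_n_telescope in HN.
    now replace (a (S n) - (a 0%nat + l))%C with (a (S n) - a 0%nat - l)%C by ring.
Qed.

(* The product form avoids a division by [1 - q]. *)
Lemma geometric_limit (a : nat -> C) (K q : R) : 0 <= q < 1 ->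
  (forall n, Cmod (a (S n) - a n) <= K * q ^ n) ->
  exists p, forall n, (1 - q) * Cmod (a n - p) <= K * q ^ n.
Proof.
  intros Hq H. destruct (geometric_step_converges a K q Hq H) as [p Hp]. exists p. intros n.
  apply Rle_plus_epsilon. intros e He. destruct (Hp e He) as [N HN].
  specialize (HN (n + N)%nat ltac:(lia)).
  assert (T := Cmod_dist_triangle (a n) (a (S (n + N))) p).
  assert (D := geometric_step_dist a K q n (S N) Hq H).
  rewrite Nat.add_succ_r, Cmod_minus_sym in D.
  assert (HK : 0 <= K * q ^ S (n + N)) by (eapply Rle_trans; [apply Cmod_ge_0|apply H]).
  nra.
Qed.

Lemma geometric_limit_in_disc (a : nat -> C) (p c : C) (K q r : R) : 0 <= q < 1 ->
  (forall n, (1 - q) * Cmod (a n - p) <= K * q ^ n) -> (forall n, Cmod (a n - c) <= r) ->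
  Cmod (p - c) <= r.
Proof.
  intros Hq Hp Hr. apply Rminus_le, (Rmult_le_reg_l (1 - q)); [lra|]. rewrite Rmult_0_r.
  apply Rle_0_of_le_geometric with K q; [exact Hq|]. intros n. specialize (Hp n). specialize (Hr n).
  rewrite Cmod_minus_sym in Hp. assert (T := Cmod_dist_triangle p (a n) c). nra.
Qed.

Section BackwardShadowing.
Variables (Phi : nat -> C -> C) (om : nat -> C) (a q : R).
Hypothesis Hq : 0 <= q < 1.
Hypothesis Hpseudo : forall n, Cmod (Phi n (om (S n)) - om n) <= (1 - q) * a.
Hypothesis Hlip : forall n u v, Cmod (u - om (S n)) <= a -> Cmod (v - om (S n)) <= a ->
  Cmod (Phi n v - Phi n u) <= q * Cmod (v - u).

Fixpoint pullback (j n : nat) : C :=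
  match j with O => om n | S i => Phi n (pullback i (S n)) end.

Lemma pullback_near (j n : nat) : Cmod (pullback j n - om n) <= a.
Proof.
  assert (Ha : 0 <= a).
  { apply Rmult_le_reg_l with (1 - q); [lra|]. rewrite Rmult_0_r.
    eapply Rle_trans; [apply Cmod_ge_0|apply (Hpseudo 0%nat)]. }
  revert n. induction j; intros n; simpl; [now rewrite Cmod_minus_diag|]. specialize (IHj (S n)).
  assert (D := Hlip n (om (S n)) (pullback j (S n)) ltac:(now rewrite Cmod_minus_diag) IHj).
  assert (T := Cmod_dist_triangle (Phi n (pullback j (S n))) (Phi n (om (S n))) (om n)).
  specialize (Hpseudo n). nra.
Qed.

Lemma pullback_step_dist (j n : nat) : Cmod (pullback (S j) n - pullback j n) <= a * q ^ j.
Proof.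
  revert n. induction j; intros n; [rewrite Rmult_1_r; apply (pullback_near 1)|].
  specialize (IHj (S n)).
  assert (D := Hlip n (pullback j (S n)) (pullback (S j) (S n)) (pullback_near j (S n))
    (pullback_near (S j) (S n))).
  change (Cmod (pullback (S (S j)) n - pullback (S j) n)
    <= q * Cmod (pullback (S j) (S n) - pullback j (S n))) in D.
  simpl pow. nra.
Qed.

Lemma backward_shadowing :
  exists p, forall n, Cmod (p n - om n) <= a /\ p n = Phi n (p (S n)).
Proof.
  set (p := fun n => epsilon (inhabits (RtoC 0))
    (fun p => forall j, (1 - q) * Cmod (pullback j n - p) <= a * q ^ j)).
  assert (Hp : forall n j, (1 - q) * Cmod (pullback j n - p n) <= a * q ^ j).
  { intros n. apply (epsilon_spec (inhabits (RtoC 0))).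
    apply (geometric_limit (fun j => pullback j n) a q Hq). intros j. apply pullback_step_dist. }
  assert (Hpom : forall n, Cmod (p n - om n) <= a).
  { intros n. apply (geometric_limit_in_disc (fun j => pullback j n) (p n) (om n) a q a Hq (Hp n)).
    intros j. apply pullback_near. }
  exists p. intros n. split; [apply Hpom|].
  apply Ceq_of_dist_le_0.
  apply (Rmult_le_reg_l (1 - q)); [lra|]. rewrite Rmult_0_r.
  apply Rle_0_of_le_geometric with (2 * (a * q)) q; [exact Hq|]. intros j.
  assert (Dn := Hp n (S j)). assert (DS := Hp (S n) j). simpl pow in Dn.
  assert (Dlip := Hlip n (p (S n)) (pullback j (S n)) (Hpom (S n)) (pullback_near j (S n))).
  change (pullback (S j) n) with (Phi n (pullback j (S n))) in Dn.
  assert (T := Cmod_dist_triangle (p n) (Phi n (pullback j (S n))) (Phi n (p (S n)))).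
  rewrite (Cmod_minus_sym (p n) (Phi n (pullback j (S n)))) in T.
  apply (Rmult_le_compat_l (1 - q)) in T, Dlip; [|lra|lra].
  apply (Rmult_le_compat_l q) in DS; lra.
Qed.
End BackwardShadowing.

Lemma contraction_fixed_point (T : C -> C) (p : C) (r q : R) : 0 <= q < 1 ->
  (forall x y, Cdisc p r x -> Cdisc p r y -> Cmod (T y - T x) <= q * Cmod (y - x)) ->
  Cmod (T p - p) < (1 - q) * r -> exists z, Cdisc p r z /\ T z = z.
Proof.
  intros Hq HT Hp. set (a := Cmod (T p - p) / (1 - q)).
  assert (Ea : Cmod (T p - p) = (1 - q) * a) by (unfold a; field; lra).
  assert (Har : a < r) by (apply Rlt_div_l; lra).
  destruct (backward_shadowing (fun _ => T) (fun _ => p) a q Hq) as [z Hz].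
  - intros _. lra.
  - intros _ x y Hx Hy. apply HT; unfold Cdisc; lra.
  - assert (Hin : forall n, Cdisc p r (z n)).
    { intros n. unfold Cdisc. destruct (Hz n). lra. }
    assert (Hcontract : forall k n, Cmod (z (S n) - z n) <= 2 * a * q ^ k).
    { induction k; intros n.
      - assert (D := Cmod_dist_triangle (z (S n)) p (z n)). rewrite (Cmod_minus_sym p) in D.
        destruct (Hz n) as [Kn _], (Hz (S n)) as [KS _]. simpl. lra.
      - destruct (Hz n) as [_ ->], (Hz (S n)) as [_ ES]. rewrite ES at 1. specialize (IHk (S n)).
        assert (D := HT _ _ (Hin (S n)) (Hin (S (S n)))). simpl pow. nra. }
    exists (z 1%nat). split; [apply Hin|]. destruct (Hz 0%nat) as [_ <-]. symmetry.
    apply Ceq_of_dist_le_0.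
    apply Rle_0_of_le_geometric with (2 * a) q; [exact Hq|]. intros k. apply Hcontract.
Qed.

(** * Goursat's theorem *)

Definition segint (f : C -> C) (a b : C) : C :=
  CRInt (fun t => (f (seg a b t) * (b - a))%C) 0 1.

Section SegmentIntegrals.
Variable f : C -> C.
Hypothesis Hf : forall z, continuous f z.

Lemma continuous_comp_seg (a b : C) (t : R) : continuous (fun t => f (seg a b t)) t.
Proof. apply (continuous_comp (seg a b) f); [apply continuous_seg|apply Hf]. Qed.

Lemma segint_seg (a b : C) (s t : R) :
  segint f (seg a b s) (seg a b t) = CRInt (fun u => (f (seg a b u) * (b - a))%C) s t.
Proof.
  assert (K := RInt_comp_lin (V := C_R_CompleteNormedModule)
    (fun u => (f (seg a b u) * (b - a))%C) (t - s) s 0 1).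
  replace ((t - s) * 0 + s) with s in K by ring. replace ((t - s) * 1 + s) with t in K by ring.
  rewrite <- K.
  - apply CRInt_ext. intros u. rewrite scal_R_Cmult.
    replace (seg (seg a b s) (seg a b t) u) with (seg a b ((t - s) * u + s)).
    + unfold seg at 2 3. rewrite RtoC_minus. ring.
    + unfold seg. rewrite RtoC_plus, RtoC_mult, RtoC_minus. ring.
  - apply ex_RInt_continuous_all. intros u. auto using continuous_comp_seg with cont.
Qed.

Lemma segint_split (a b : C) (s : R) :
  segint f a b = (segint f a (seg a b s) + segint f (seg a b s) b)%C.
Proof.
  assert (Kl := segint_seg a b 0 s). assert (Kr := segint_seg a b s 1).
  rewrite seg_0 in Kl. rewrite seg_1 in Kr. rewrite Kl, Kr. symmetry.
  apply (RInt_Chasles (V := C_R_CompleteNormedModule)); apply ex_RInt_continuous_all;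
    intros u; auto using continuous_comp_seg with cont.
Qed.

Lemma segint_swap (a b : C) : segint f b a = (- segint f a b)%C.
Proof.
  assert (K := segint_seg a b 1 0). rewrite seg_0, seg_1 in K. rewrite K. symmetry.
  apply (opp_RInt_swap (V := C_R_CompleteNormedModule)).
  apply ex_RInt_continuous_all. intros u. auto using continuous_comp_seg with cont.
Qed.

Lemma segint_bound (a b : C) (M : R) :
  (forall t, 0 <= t <= 1 -> Cmod (f (seg a b t)) <= M) ->
  Cmod (segint f a b) <= M * Cmod (b - a).
Proof.
  intros HM. replace (M * Cmod (b - a)) with ((1 - 0) * (M * Cmod (b - a))) by ring.
  apply Cmod_CRInt_le; [lra|auto using continuous_comp_seg with cont|].
  intros t Ht. rewrite Cmod_mult. apply Rmult_le_compat_r; [apply Cmod_ge_0|auto].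
Qed.

Lemma segint_primitive (F : C -> C) (a b : C) :
  (forall z, is_C_derive F z (f z)) -> segint f a b = (F b - F a)%C.
Proof.
  intros HF. unfold segint. rewrite (CRInt_derive (fun t => F (seg a b t))).
  - now rewrite seg_0, seg_1.
  - intros t. apply is_curve_derive_comp; [apply HF|apply is_curve_derive_seg].
  - auto using continuous_comp_seg with cont.
Qed.
End SegmentIntegrals.

Lemma segint_const (c a b : C) : segint (fun _ => c) a b = (c * (b - a))%C.
Proof. unfold segint. rewrite CRInt_const, Rminus_0_r. ring. Qed.

Lemma segint_minus (f g : C -> C) (a b : C) :
  (forall z, continuous f z) -> (forall z, continuous g z) ->
  segint (fun z => (f z - g z)%C) a b = (segint f a b - segint g a b)%C.
Proof.
  intros Hf Hg. unfold segint. rewrite <- CRInt_minus by auto using continuous_comp_seg with cont.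
  apply CRInt_ext. intros t. ring.
Qed.

Definition triangle : Type := (C * C * C)%type.

Definition vertex (T : triangle) : C := fst (fst T).

Definition triint (f : C -> C) (T : triangle) : C :=
  let '(a, b, c) := T in (segint f a b + segint f b c + segint f c a)%C.

Definition perimeter (T : triangle) : R :=
  let '(a, b, c) := T in Cmod (b - a) + Cmod (c - b) + Cmod (a - c).

Lemma triint_bound (f : C -> C) (T : triangle) (M : R) :
  (forall z, continuous f z) ->
  (forall z, Cmod (z - vertex T) <= perimeter T -> Cmod (f z) <= M) ->
  Cmod (triint f T) <= M * perimeter T.
Proof.
  destruct T as [[a b] c]. unfold vertex. simpl. intros Hf HM.
  assert (K1 := Cmod_ge_0 (b - a)). assert (K2 := Cmod_ge_0 (c - b)).
  assert (K3 := Cmod_ge_0 (a - c)).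
  set (L := Cmod (b - a) + Cmod (c - b) + Cmod (a - c)) in *.
  assert (Ha : Cmod (a - a) <= L) by (rewrite Cmod_minus_diag; unfold L; lra).
  assert (Hb : Cmod (b - a) <= L) by (unfold L; lra).
  assert (Hc : Cmod (c - a) <= L) by (rewrite Cmod_minus_sym; unfold L; lra).
  assert (edge : forall u v, Cmod (u - a) <= L -> Cmod (v - a) <= L ->
    Cmod (segint f u v) <= M * Cmod (v - u)).
  { intros u v Hu Hv. apply segint_bound; [exact Hf|]. intros t Ht.
    apply HM, (convex_closed_Cdisc a L u v t); auto. }
  eapply Rle_trans; [apply Cmod_triangle|].
  eapply Rle_trans; [apply Rplus_le_compat_r, Cmod_triangle|].
  assert (E1 := edge a b Ha Hb). assert (E2 := edge b c Hb Hc). assert (E3 := edge c a Hc Ha).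
  unfold L. lra.
Qed.

Lemma triint_primitive (f F : C -> C) (T : triangle) :
  (forall z, continuous f z) -> (forall z, is_C_derive F z (f z)) -> triint f T = RtoC 0.
Proof.
  destruct T as [[a b] c]. simpl. intros Hf HF.
  rewrite !(segint_primitive f Hf F) by exact HF. ring.
Qed.

Lemma triint_affine (u v : C) (T : triangle) : triint (fun z => (u + v * z)%C) T = RtoC 0.
Proof.
  apply triint_primitive with (fun z => (u * z + v / RtoC 2 * (z * z))%C).
  - auto with cont.
  - intros z. eapply is_C_derive_eq.
    + apply is_C_derive_plus; apply is_C_derive_scal;
        [|apply is_C_derive_mult]; apply is_C_derive_id.
    + cbv beta. field.
Qed.

Lemma triint_minus (f g : C -> C) (T : triangle) :
  (forall z, continuous f z) -> (forall z, continuous g z) ->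
  triint (fun z => (f z - g z)%C) T = (triint f T - triint g T)%C.
Proof.
  destruct T as [[a b] c]. simpl. intros Hf Hg. rewrite !segint_minus by auto. ring.
Qed.

Definition midpoint (a b : C) : C := seg a b (1 / 2).

Lemma half_plus_half (a : C) : (RtoC (1 / 2) * a + RtoC (1 / 2) * a)%C = a.
Proof.
  rewrite <- Cmult_plus_distr_r, <- RtoC_plus.
  replace (1 / 2 + 1 / 2) with 1 by field. apply Cmult_1_l.
Qed.

Lemma midpoint_sum (a b : C) : midpoint a b = (RtoC (1 / 2) * (a + b))%C.
Proof. unfold midpoint, seg. rewrite <- (half_plus_half a) at 1. ring. Qed.

Lemma Cmod_half (z : C) : Cmod (RtoC (1 / 2) * z) = Cmod z / 2.
Proof. rewrite Cmod_scal, Rabs_pos_eq; lra. Qed.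

Lemma Cmod_midpoint_l (a b : C) : Cmod (midpoint a b - a) = Cmod (b - a) / 2.
Proof. rewrite <- Cmod_half. f_equal. unfold midpoint, seg. ring. Qed.

Lemma midpoint_sym (a b : C) : midpoint a b = midpoint b a.
Proof. rewrite !midpoint_sum. f_equal. ring. Qed.

Lemma Cmod_midpoint_r (a b : C) : Cmod (b - midpoint a b) = Cmod (b - a) / 2.
Proof. now rewrite midpoint_sym, Cmod_minus_sym, Cmod_midpoint_l, Cmod_minus_sym. Qed.

Lemma Cmod_midline (a b c : C) : Cmod (midpoint a c - midpoint b c) = Cmod (a - b) / 2.
Proof. rewrite <- Cmod_half. f_equal. rewrite !midpoint_sum. ring. Qed.

Lemma triint_bisect (f : C -> C) (a b c : C) : (forall z, continuous f z) ->
  triint f (a, b, c) =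
  (triint f (a, midpoint a b, midpoint c a) + triint f (midpoint a b, b, midpoint b c)
   + triint f (midpoint c a, midpoint b c, c)
   + triint f (midpoint a b, midpoint b c, midpoint c a))%C.
Proof.
  intros Hf. simpl.
  rewrite (segint_split f Hf a b (1 / 2)), (segint_split f Hf b c (1 / 2)),
    (segint_split f Hf c a (1 / 2)). fold (midpoint a b) (midpoint b c) (midpoint c a).
  rewrite (segint_swap f Hf (midpoint c a) (midpoint a b)),
    (segint_swap f Hf (midpoint a b) (midpoint b c)),
    (segint_swap f Hf (midpoint b c) (midpoint c a)).
  ring.
Qed.

Lemma triangle_descent (f : C -> C) (T : triangle) : (forall z, continuous f z) ->
  exists T', Cmod (triint f T) <= 4 * Cmod (triint f T') /\
    perimeter T' = perimeter T / 2 /\ Cmod (vertex T' - vertex T) <= perimeter T.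
Proof.
  intros Hf. destruct T as [[a b] c].
  assert (Hsum := triint_bisect f a b c Hf).
  set (T1 := (a, midpoint a b, midpoint c a)) in *.
  set (T2 := (midpoint a b, b, midpoint b c)) in *.
  set (T3 := (midpoint c a, midpoint b c, c)) in *.
  set (T4 := (midpoint a b, midpoint b c, midpoint c a)) in *.
  set (good := fun T' => perimeter T' = perimeter (a, b, c) / 2 /\
    Cmod (vertex T' - vertex (a, b, c)) <= perimeter (a, b, c)).
  assert (P1 := Cmod_ge_0 (b - a)). assert (P2 := Cmod_ge_0 (c - b)).
  assert (P3 := Cmod_ge_0 (a - c)).
  assert (L1 := Cmod_midpoint_l a b). assert (R1 := Cmod_midpoint_r a b).
  assert (L2 := Cmod_midpoint_l b c). assert (R2 := Cmod_midpoint_r b c).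
  assert (L3 := Cmod_midpoint_l c a). assert (R3 := Cmod_midpoint_r c a).
  assert (M1 := Cmod_midline c b a). rewrite (midpoint_sym b a) in M1.
  assert (M2 := Cmod_midline a c b). rewrite (midpoint_sym c b) in M2.
  assert (M3 := Cmod_midline b a c). rewrite (midpoint_sym a c) in M3.
  assert (S1 := Cmod_minus_sym (midpoint a b) (midpoint c a)).
  assert (S2 := Cmod_minus_sym (midpoint b c) (midpoint a b)).
  assert (S3 := Cmod_minus_sym (midpoint c a) (midpoint b c)).
  assert (S4 := Cmod_minus_sym a (midpoint c a)). assert (Sa := Cmod_minus_diag a).
  assert (G : good T1 /\ good T2 /\ good T3 /\ good T4).
  { unfold good, vertex; simpl. repeat split; lra. }
  destruct G as [G1 [G2 [G3 G4]]].
  assert (Hs : Cmod (triint f (a, b, c)) <=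
    Cmod (triint f T1) + Cmod (triint f T2) + Cmod (triint f T3) + Cmod (triint f T4)).
  { rewrite Hsum. eapply Rle_trans; [apply Cmod_triangle|]. apply Rplus_le_compat_r.
    eapply Rle_trans; [apply Cmod_triangle|]. apply Rplus_le_compat_r. apply Cmod_triangle. }
  apply NNPP. intros Hno.
  assert (Hlt : forall T', good T' -> 4 * Cmod (triint f T') < Cmod (triint f (a, b, c))).
  { intros T' HT. apply Rnot_le_lt. intros Hle. apply Hno. now exists T'. }
  apply Hlt in G1, G2, G3, G4. lra.
Qed.

Lemma dependent_choice {A : Type} (P : nat -> A -> Prop) (step : nat -> A -> A -> Prop) (x : A) :
  P 0%nat x -> (forall n y, P n y -> exists y', P (S n) y' /\ step n y y') ->
  exists s : nat -> A, s 0%nat = x /\ forall n, P n (s n) /\ step n (s n) (s (S n)).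
Proof.
  intros H0 Hstep.
  set (next := fun n y => epsilon (inhabits x) (fun y' => P (S n) y' /\ step n y y')).
  assert (Hnext : forall n y, P n y -> P (S n) (next n y) /\ step n y (next n y)).
  { intros n y Hy. unfold next. apply epsilon_spec. now apply Hstep. }
  set (s := nat_rect (fun _ => A) x next). exists s. split; [reflexivity|].
  assert (Hs : forall n, P n (s n)).
  { induction n; [exact H0|]. exact (proj1 (Hnext n (s n) IHn)). }
  intros n. split; [apply Hs|]. exact (proj2 (Hnext n (s n) (Hs n))).
Qed.

Lemma shrinking_triangles (f : C -> C) (T : triangle) : (forall z, continuous f z) ->
  exists s : nat -> triangle, forall n,
    Cmod (triint f T) <= 4 ^ n * Cmod (triint f (s n)) /\
    perimeter (s n) = perimeter T * (1 / 2) ^ n /\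
    Cmod (vertex (s (S n)) - vertex (s n)) <= perimeter T * (1 / 2) ^ n.
Proof.
  intros Hf.
  destruct (dependent_choice
    (fun n T' => Cmod (triint f T) <= 4 ^ n * Cmod (triint f T') /\
      perimeter T' = perimeter T * (1 / 2) ^ n)
    (fun n T' T'' => Cmod (vertex T'' - vertex T') <= perimeter T * (1 / 2) ^ n) T)
    as [s [_ Hs]].
  - simpl. split; lra.
  - intros n T' [H1 H2]. destruct (triangle_descent f T' Hf) as [T'' [D1 [D2 D3]]].
    exists T''. rewrite <- H2. split; [split|exact D3].
    + assert (0 < 4 ^ n) by (apply pow_lt; lra). simpl. nra.
    + rewrite D2, H2. simpl. field.
  - exists s. intros n. destruct (Hs n) as [[H1 H2] H3]. auto.
Qed.

Lemma Rle_0_of_le_eps (x K : R) : (forall e, 0 < e -> x <= e * K) -> x <= 0.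
Proof.
  intros H. apply Rnot_lt_le. intros Hx. assert (HK := Rabs_pos K). assert (HK' := Rle_abs K).
  assert (He : 0 < x / (2 * (Rabs K + 1))) by (apply Rdiv_lt_0_compat; lra).
  specialize (H _ He).
  assert (x / (2 * (Rabs K + 1)) * (2 * (Rabs K + 1)) = x) by (field; lra). nra.
Qed.

Lemma goursat (f : C -> C) (T : triangle) :
  (forall z, exists l, is_C_derive f z l) -> triint f T = RtoC 0.
Proof.
  intros Hd.
  assert (Hf := ex_C_derive_continuous f Hd).
  destruct (shrinking_triangles f T Hf) as [s Hs]. set (L := perimeter T) in *.
  destruct (geometric_limit (fun n => vertex (s n)) L (1 / 2)) as [p Hp]; [lra|intros n; apply Hs|].
  destruct (Hd p) as [l Hl]. rewrite is_C_derive_eps in Hl.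
  apply Cmod_le_0.
  apply Rle_0_of_le_eps with (3 * (L * L)). intros e He.
  destruct (Hl e He) as [d [Hd1 Hd2]].
  destruct (pow_small (3 * L) (1 / 2) d) as [n Hn]; [lra|exact Hd1|]. specialize (Hn n (le_n n)).
  destruct (Hs n) as [H1 [H2 _]]. specialize (Hp n). set (q := (1 / 2) ^ n) in *.
  set (aff := fun z => ((f p - l * p) + l * z)%C).
  assert (Haff : forall z, continuous aff z) by (intros z; unfold aff; auto with cont).
  assert (Erem : triint (fun z => (f z - aff z)%C) (s n) = triint f (s n)).
  { rewrite triint_minus by auto. unfold aff. rewrite triint_affine. ring. }
  assert (Hrem : Cmod (triint f (s n)) <= e * (3 * (L * q)) * (L * q)).
  { rewrite <- Erem, <- H2. apply triint_bound; [auto with cont|]. rewrite H2. intros z Hz.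
    assert (K := Cmod_dist_triangle z (vertex (s n)) p).
    replace (f z - aff z)%C with (f z - f p - l * (z - p))%C by (unfold aff; ring).
    eapply Rle_trans; [apply Hd2; unfold Cdisc; lra|]. apply Rmult_le_compat_l; lra. }
  assert (Hq4 : 4 ^ n * (q * q) = 1).
  { unfold q. rewrite <- !Rpow_mult_distr. replace (4 * (1 / 2 * (1 / 2))) with 1 by field.
    apply pow1. }
  replace (e * (3 * (L * L))) with (4 ^ n * (e * (3 * (L * q)) * (L * q))).
  - eapply Rle_trans; [exact H1|]. apply Rmult_le_compat_l; [apply pow_le; lra|exact Hrem].
  - transitivity (4 ^ n * (q * q) * (e * (3 * (L * L)))); [ring|]. rewrite Hq4. ring.
Qed.

Lemma primitive_exists (f : C -> C) :
  (forall z, exists l, is_C_derive f z l) -> exists F, forall z, is_C_derive F z (f z).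
Proof.
  intros Hd.
  assert (Hf := ex_C_derive_continuous f Hd).
  exists (segint f 0). intros z. apply is_C_derive_eps. intros e He.
  destruct (proj1 (continuous_C_eps _ _) (Hf z) e He) as [d [Hd1 Hd2]].
  exists d. split; auto. intros w Hw.
  assert (Ezw : (segint f 0 w - segint f 0 z)%C = segint f z w).
  { assert (K := goursat f (RtoC 0, z, w) Hd). simpl in K. rewrite (segint_swap f Hf 0 w) in K.
    transitivity (segint f z w - (segint f 0 z + segint f z w + - segint f 0 w))%C; [ring|].
    rewrite K. ring. }
  rewrite Ezw, <- segint_const, <- segint_minus by auto with cont.
  apply segint_bound; [auto with cont|]. intros t Ht. left. apply Hd2.
  apply convex_Cdisc; auto. now apply Cdisc_center.
Qed.

(** * Means over a circle *)

Definition circle_mean (u : R -> C) : C := (/ RtoC (2 * PI) * CRInt u 0 (2 * PI))%C.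

Lemma two_PI_neq_0 : RtoC (2 * PI) <> RtoC 0.
Proof. apply RtoC_neq_0. assert (H := PI_RGT_0). lra. Qed.

Lemma circle_mean_ext (u v : R -> C) : (forall t, u t = v t) -> circle_mean u = circle_mean v.
Proof. intros H. unfold circle_mean. f_equal. now apply CRInt_ext. Qed.

Lemma circle_mean_const (c : C) : circle_mean (fun _ => c) = c.
Proof. unfold circle_mean. rewrite CRInt_const, Rminus_0_r. field. apply two_PI_neq_0. Qed.

Lemma circle_mean_plus (u v : R -> C) :
  (forall t, continuous u t) -> (forall t, continuous v t) ->
  circle_mean (fun t => (u t + v t)%C) = (circle_mean u + circle_mean v)%C.
Proof. intros Hu Hv. unfold circle_mean. rewrite CRInt_plus by auto. ring. Qed.

Lemma circle_mean_minus (u v : R -> C) :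
  (forall t, continuous u t) -> (forall t, continuous v t) ->
  circle_mean (fun t => (u t - v t)%C) = (circle_mean u - circle_mean v)%C.
Proof. intros Hu Hv. unfold circle_mean. rewrite CRInt_minus by auto. ring. Qed.

Lemma circle_mean_scal (c : C) (u : R -> C) : (forall t, continuous u t) ->
  circle_mean (fun t => (c * u t)%C) = (c * circle_mean u)%C.
Proof. intros Hu. unfold circle_mean. rewrite CRInt_scal by auto. ring. Qed.

Lemma circle_mean_Cconj (u : R -> C) : (forall t, continuous u t) ->
  circle_mean (fun t => Cconj (u t)) = Cconj (circle_mean u).
Proof.
  intros Hu. unfold circle_mean.
  rewrite CRInt_Cconj, Cmult_conj, Cinv_conj by (auto using two_PI_neq_0).
  do 2 f_equal. apply injective_projections; simpl; ring.
Qed.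

Lemma Cmod_circle_mean_le (u v : R -> C) :
  (forall t, continuous u t) -> (forall t, continuous v t) ->
  (forall t, Cmod (u t) <= Re (v t)) -> Cmod (circle_mean u) <= Re (circle_mean v).
Proof.
  intros Hu Hv H. assert (HP := PI_RGT_0). unfold circle_mean.
  rewrite <- RtoC_inv, Cmod_scal, re_scal_l, Re_CRInt by (auto; lra).
  assert (HI : 0 < / (2 * PI)) by (apply Rinv_0_lt_compat; lra).
  rewrite Rabs_pos_eq by lra. apply Rmult_le_compat_l; [lra|].
  apply Cmod_CRInt_le_RInt; auto with cont. lra.
Qed.

Lemma Cmod_circle_mean_le_const (u : R -> C) (M : R) :
  (forall t, continuous u t) -> (forall t, Cmod (u t) <= M) -> Cmod (circle_mean u) <= M.
Proof.
  intros Hu HM. rewrite <- (re_RtoC M), <- (circle_mean_const (RtoC M)).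
  apply Cmod_circle_mean_le; auto with cont.
Qed.

Lemma circle_mean_derive (F u : R -> C) :
  (forall t, is_curve_derive F t (u t)) -> (forall t, continuous u t) -> F (2 * PI) = F 0 ->
  circle_mean u = RtoC 0.
Proof.
  intros HF Hu E. unfold circle_mean. rewrite (CRInt_derive F u), E by auto. ring.
Qed.

Lemma cis_opp_INR_mult (n : nat) (t : R) : cis (- INR n * t) = ((/ cis t) ^ n)%C.
Proof.
  induction n.
  - simpl. rewrite Ropp_0, Rmult_0_l. apply cis_0.
  - rewrite S_INR. replace (- (INR n + 1) * t) with (- t + - INR n * t) by ring.
    rewrite cis_plus, IHn. simpl. f_equal. rewrite <- Cconj_cis. unfold cis, Cconj; simpl.
    now rewrite cos_neg, sin_neg.
Qed.

Lemma circle_mean_inv_cis_pow (n : nat) : (0 < n)%nat ->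
  circle_mean (fun t => ((/ cis t) ^ n)%C) = RtoC 0.
Proof.
  intros Hn. apply lt_0_INR in Hn.
  assert (Hn0 : RtoC (- INR n) <> RtoC 0) by (apply RtoC_neq_0; lra).
  apply circle_mean_derive with (fun t => (/ (RtoC (- INR n) * Ci) * cis (- INR n * t))%C).
  - intros t. eapply is_curve_derive_eq.
    + apply is_curve_derive_scal.
      apply (is_derive_comp (V := C_R_NormedModule) cis (fun t => - INR n * t)).
      * apply is_curve_derive_cis.
      * apply is_derive_scal, (is_derive_id (K := R_AbsRing)).
    + rewrite scal_R_Cmult, cis_opp_INR_mult. change (one : R) with 1. rewrite Rmult_1_r.
      field. auto using Ci_nz.
  - intros t. apply continuous_Cpow, continuous_Cinv; [apply continuous_cis|apply cis_neq_0].
  - rewrite !cis_opp_INR_mult, cis_2PI. reflexivity.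
Qed.

Lemma rcis_neq_0 (r t : R) : 0 < r -> (RtoC r * cis t)%C <> RtoC 0.
Proof. intros H. apply Cmult_neq_0; [apply RtoC_neq_0; lra|apply cis_neq_0]. Qed.

Lemma rcis_minus_neq_0 (r t : R) (h : C) : Cmod h < r -> (RtoC r * cis t - h)%C <> RtoC 0.
Proof.
  intros H. assert (Q := Cmod_ge_0 h). assert (K := Cmod_minus_ge (RtoC r * cis t) h).
  rewrite Cmod_rcis in K by lra. apply Cmod_gt_0. lra.
Qed.

Definition cauchy_kernel (r : R) (h : C) (t : R) : C :=
  (RtoC r * cis t / (RtoC r * cis t - h))%C.

Lemma continuous_cauchy_kernel (r : R) (h : C) (t : R) :
  Cmod h < r -> continuous (cauchy_kernel r h) t.
Proof.
  intros H. apply continuous_Cdiv; [auto with cont|auto with cont|now apply rcis_minus_neq_0].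
Qed.

Lemma Cmod_cauchy_kernel_le (r : R) (h : C) (t : R) :
  Cmod h < r -> Cmod (cauchy_kernel r h t) <= r / (r - Cmod h).
Proof.
  intros H. assert (Hh := Cmod_ge_0 h). unfold cauchy_kernel.
  rewrite Cmod_div, Cmod_rcis by (lra || now apply rcis_minus_neq_0).
  apply Rmult_le_compat_l; [lra|]. apply Rinv_le_contravar; [lra|].
  assert (K := Cmod_minus_ge (RtoC r * cis t) h). rewrite Cmod_rcis in K; lra.
Qed.

(* For [u t = f (a + r e^(it))] these are the [n]-th Taylor coefficient of [f] at [a] and the
   quotient by [h^n] of the [n]-th Taylor remainder at [a + h]. *)
Definition circle_coef (r : R) (u : R -> C) (n : nat) : C :=
  circle_mean (fun t => (u t * (/ (RtoC r * cis t)) ^ n)%C).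

Definition circle_rem (r : R) (u : R -> C) (h : C) (n : nat) : C :=
  circle_mean (fun t => (u t * (/ (RtoC r * cis t)) ^ n * cauchy_kernel r h t)%C).

Section CircleExpansion.
Variables (r : R) (u : R -> C).
Hypothesis Hr : 0 < r.
Hypothesis Hu : forall t, continuous u t.

Lemma continuous_circle_coef (n : nat) (t : R) :
  continuous (fun t => (u t * (/ (RtoC r * cis t)) ^ n)%C) t.
Proof.
  apply continuous_Cmult; [apply Hu|]. apply continuous_Cpow, continuous_Cinv; [auto with cont|].
  now apply rcis_neq_0.
Qed.

Lemma continuous_circle_rem (h : C) (n : nat) (t : R) : Cmod h < r ->
  continuous (fun t => (u t * (/ (RtoC r * cis t)) ^ n * cauchy_kernel r h t)%C) t.
Proof.
  intros Hh. apply continuous_Cmult;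
    [apply continuous_circle_coef|now apply continuous_cauchy_kernel].
Qed.

Lemma circle_rem_S (h : C) (n : nat) : Cmod h < r ->
  circle_rem r u h n = (circle_coef r u n + h * circle_rem r u h (S n))%C.
Proof.
  intros Hh. unfold circle_rem, circle_coef.
  rewrite <- circle_mean_scal, <- circle_mean_plus.
  - apply circle_mean_ext. intros t. unfold cauchy_kernel. rewrite Cpow_S. field.
    split; [now apply rcis_minus_neq_0|split; [apply cis_neq_0|apply RtoC_neq_0; lra]].
  - apply continuous_circle_coef.
  - intros t. apply continuous_Cmult; [apply continuous_const|now apply continuous_circle_rem].
  - intros t. now apply continuous_circle_rem.
Qed.

Lemma circle_rem_h0 (n : nat) : circle_rem r u (RtoC 0) n = circle_coef r u n.
Proof. rewrite circle_rem_S by now rewrite Cmod_0. ring. Qed.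

Lemma circle_rem_bound (h : C) (n : nat) (M : R) : Cmod h < r -> (forall t, Cmod (u t) <= M) ->
  Cmod (circle_rem r u h n) <= M * (/ r) ^ n * (r / (r - Cmod h)).
Proof.
  intros Hh HM. assert (Hi : 0 < / r) by now apply Rinv_0_lt_compat.
  apply Cmod_circle_mean_le_const; [intros; now apply continuous_circle_rem|]. intros t.
  rewrite !Cmod_mult, Cmod_pow, Cmod_inv, Cmod_rcis by (lra || now apply rcis_neq_0).
  apply Rmult_le_compat.
  - apply Rmult_le_pos; [apply Cmod_ge_0|apply pow_le; lra].
  - apply Cmod_ge_0.
  - apply Rmult_le_compat_r; [apply pow_le; lra|apply HM].
  - now apply Cmod_cauchy_kernel_le.
Qed.

Lemma circle_coef_bound (n : nat) (M : R) : (forall t, Cmod (u t) <= M) ->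
  Cmod (circle_coef r u n) <= M * (/ r) ^ n.
Proof.
  intros HM. assert (H0 : Cmod 0 < r) by now rewrite Cmod_0.
  assert (K := circle_rem_bound 0 n M H0 HM).
  rewrite circle_rem_h0, Cmod_0, Rminus_0_r, Rdiv_diag in K; lra.
Qed.

Lemma circle_rem_shift (h : C) (n k : nat) : Cmod h < r ->
  (forall m, (n <= m < n + k)%nat -> circle_coef r u m = RtoC 0) ->
  circle_rem r u h n = (h ^ k * circle_rem r u h (n + k))%C.
Proof.
  intros Hh. induction k; intros Hz.
  - rewrite Nat.add_0_r. simpl. ring.
  - rewrite IHk by (intros; apply Hz; lia).
    rewrite (circle_rem_S h (n + k)), Hz by (auto; lia). rewrite Nat.add_succ_r. simpl. ring.
Qed.

Lemma circle_rem_eq_0 (h : C) (n : nat) (M : R) : Cmod h < r -> (forall t, Cmod (u t) <= M) ->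
  (forall m, (n <= m)%nat -> circle_coef r u m = RtoC 0) -> circle_rem r u h n = RtoC 0.
Proof.
  intros Hh HM Hz. assert (Hh0 := Cmod_ge_0 h).
  apply Cmod_le_0.
  apply Rle_0_of_le_geometric with (M * (/ r) ^ n * (r / (r - Cmod h))) (Cmod h / r).
  { split; [apply Rdiv_le_0_compat|apply Rlt_div_l]; lra. }
  intros k. rewrite (circle_rem_shift h n k Hh), Cmod_mult, Cmod_pow by (intros; apply Hz; lia).
  assert (B := circle_rem_bound h (n + k) M Hh HM).
  apply (Rmult_le_compat_l (Cmod h ^ k)) in B; [|now apply pow_le].
  unfold Rdiv at 2. rewrite pow_add in B. rewrite Rpow_mult_distr. lra.
Qed.
End CircleExpansion.

Lemma circle_coef_minus (r : R) (u v : R -> C) (n : nat) : 0 < r ->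
  (forall t, continuous u t) -> (forall t, continuous v t) ->
  circle_coef r (fun t => (u t - v t)%C) n = (circle_coef r u n - circle_coef r v n)%C.
Proof.
  intros Hr Hu Hv. unfold circle_coef.
  rewrite <- circle_mean_minus by (intros; now apply continuous_circle_coef).
  apply circle_mean_ext. intros t. ring.
Qed.

Lemma circle_coef_scal (r : R) (c : C) (u : R -> C) (n : nat) : 0 < r ->
  (forall t, continuous u t) ->
  circle_coef r (fun t => (c * u t)%C) n = (c * circle_coef r u n)%C.
Proof.
  intros Hr Hu. unfold circle_coef.
  rewrite <- circle_mean_scal by (intros; now apply continuous_circle_coef).
  apply circle_mean_ext. intros t. ring.
Qed.

Lemma circle_mean_cauchy_kernel (r : R) (h : C) : Cmod h < r ->
  circle_mean (cauchy_kernel r h) = RtoC 1.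
Proof.
  intros Hh. assert (Hr : 0 < r) by (assert (Q := Cmod_ge_0 h); lra).
  assert (H1 : forall t : R, continuous (fun _ : R => RtoC 1) t) by auto with cont.
  assert (Hcoef : forall m, (1 <= m)%nat -> circle_coef r (fun _ => RtoC 1) m = RtoC 0).
  { intros m Hm. unfold circle_coef.
    rewrite (circle_mean_ext _ (fun t => ((/ RtoC r) ^ m * (/ cis t) ^ m)%C)).
    - rewrite circle_mean_scal, circle_mean_inv_cis_pow; [ring|lia|].
      intros t. apply continuous_Cpow, continuous_Cinv; [apply continuous_cis|apply cis_neq_0].
    - intros t. rewrite <- Cpow_mult_l, Cmult_1_l. f_equal. field.
      split; [apply cis_neq_0|apply RtoC_neq_0; lra]. }
  transitivity (circle_rem r (fun _ => RtoC 1) h 0).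
  { apply circle_mean_ext. intros t. simpl. ring. }
  rewrite circle_rem_S, (circle_rem_eq_0 r _ Hr H1 h 1 1) by
    (auto; intros; rewrite Cmod_1; lra).
  unfold circle_coef. rewrite (circle_mean_ext _ (fun _ => RtoC 1)), circle_mean_const.
  - ring.
  - intros t. simpl. ring.
Qed.

(** * Cauchy's integral formula *)

Section IntegralParameter.
Variables (G dG : R -> R -> C) (a b s0 e : R).
Hypothesis He : 0 < e.
Hypothesis Hd : forall s t, Rabs (s - s0) < e -> is_curve_derive (fun u => G u t) s (dG s t).
Hypothesis Hc : forall t, continuous (fun p : R * R => dG (fst p) (snd p)) (s0, t).
Hypothesis HG : forall s t, Rabs (s - s0) < e -> continuous (G s) t.

Lemma is_derive_linear_CRInt_param (L : C -> R) :
  is_linear (U := C_R_NormedModule) (V := R_NormedModule) L ->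
  is_derive (fun s => L (CRInt (G s) a b)) s0 (L (CRInt (dG s0) a b)).
Proof.
  intros HL.
  assert (near : forall Q : R -> Prop, (forall s, Rabs (s - s0) < e -> Q s) -> locally s0 Q).
  { intros Q HQ. exists (mkposreal e He). exact HQ. }
  assert (Hs0 : Rabs (s0 - s0) < e) by (rewrite Rminus_diag, Rabs_R0; exact He).
  assert (HdG : forall t, continuous (dG s0) t).
  { intros t. apply (continuous_comp_2 (fun _ => s0) (fun t => t) dG); auto with cont. }
  assert (HLc : forall z : C, continuous L z).
  { intros z. apply (filterdiff_continuous (U := C_R_NormedModule) (V := R_NormedModule)).
    exists L. now apply filterdiff_linear. }
  assert (HLd : forall s t, Rabs (s - s0) < e -> is_derive (fun u => L (G u t)) s (L (dG s t))).
  { intros s t Hs. now apply (is_derive_linear L (fun u => G u t)), Hd. }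
  assert (HLi := RInt_linear (V := C_R_CompleteNormedModule) (W := R_CompleteNormedModule) L).
  apply is_derive_ext_loc with (fun s => RInt (fun t => L (G s t)) a b).
  { apply near. intros s Hs. apply (HLi (G s)); auto. }
  replace (L (CRInt (dG s0) a b)) with (RInt (fun t => Derive (fun u => L (G u t)) s0) a b).
  2: { rewrite <- (HLi (dG s0)) by auto. apply RInt_ext. intros t _.
       now apply is_derive_unique, HLd. }
  apply is_derive_RInt_param.
  - apply near. intros s Hs t _. eexists. now apply HLd.
  - intros t _. apply continuity_2d_pt_ext_loc with (fun s t => L (dG s t)).
    + exists (mkposreal e He). intros s v Hs _. symmetry. now apply is_derive_unique, HLd.
    + apply continuity_2d_pt_filterlim.
      apply (continuous_comp (fun p : R * R => dG (fst p) (snd p)) L); auto.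
  - apply near. intros s Hs. apply (ex_RInt_continuous_all (V := R_CompleteNormedModule)).
    intros t. apply (continuous_comp (G s) L); auto.
Qed.

Lemma is_curve_derive_CRInt_param :
  is_curve_derive (fun s => CRInt (G s) a b) s0 (CRInt (dG s0) a b).
Proof.
  apply is_curve_derive_Re_Im; apply is_derive_linear_CRInt_param;
    [apply is_linear_Re|apply is_linear_Im].
Qed.
End IntegralParameter.

Definition C1_near_disc (f f' : C -> C) (a : C) (r : R) : Prop :=
  0 < r /\ exists rho, r < rho /\ C1_on (Cdisc a rho) f f'.

Lemma C1_near_disc_circle (f f' : C -> C) (a : C) (r t : R) :
  C1_near_disc f f' a r -> continuous (fun t => f (circle a r t)) t.
Proof.
  intros [Hr [rho [Hrho Hf]]]. apply (continuous_comp (circle a r) f); [apply continuous_circle|].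
  apply (C1_on_continuous _ _ _ _ Hf). unfold Cdisc. rewrite Cmod_circle_minus; lra.
Qed.

Lemma continuous_pair_snd (g : R -> C) (s t : R) :
  continuous g t -> continuous (fun p : R * R => g (snd p)) (s, t).
Proof. intros H. apply (continuous_comp (@snd R R) g); [apply continuous_snd|exact H]. Qed.

Section CauchyFormula.
Variables (f f' : C -> C) (a h : C) (r rho : R).
Hypothesis Hh : Cmod h < r.
Hypothesis Hrho : r < rho.
Hypothesis Hf : C1_on (Cdisc a rho) f f'.

(* The circle shrinks to the point [a + h] along segments. *)
Let homotopy (s t : R) : C := seg (a + h) (circle a r t) s.

Let radius_pos : 0 < r.
Proof. assert (Q := Cmod_ge_0 h). lra. Qed.

Lemma homotopy_in_disc (s0 s t : R) : 0 <= s0 <= 1 -> Rabs (s - s0) < (rho - r) / (2 * r) ->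
  Cdisc a rho (homotopy s t).
Proof.
  intros Hs0 Hs. unfold Cdisc, homotopy.
  assert (Hc := Cmod_circle_minus a r t (Rlt_le _ _ radius_pos)).
  assert (K := seg_dist_point (a + h) (circle a r t) a s0 Hs0). rewrite Cmod_plus_minus_l, Hc in K.
  assert (D := seg_dist_param (a + h) (circle a r t) s s0).
  assert (Hd : Cmod (circle a r t - (a + h)) <= 2 * r).
  { replace (circle a r t - (a + h))%C with ((circle a r t - a) - h)%C by ring.
    eapply Rle_trans; [apply Cmod_minus_le|]. lra. }
  apply Rlt_div_r in Hs; [|lra]. assert (Ps := Rabs_pos (s - s0)).
  assert (T := Cmod_dist_triangle (seg (a + h) (circle a r t) s) (seg (a + h) (circle a r t) s0) a).
  rewrite D in T. nra.
Qed.

Lemma homotopy_in_disc_unit (s t : R) : 0 <= s <= 1 -> Cdisc a rho (homotopy s t).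
Proof.
  intros Hs. apply homotopy_in_disc with s; [exact Hs|]. rewrite Rminus_diag, Rabs_R0.
  apply Rdiv_lt_0_compat; lra.
Qed.

Lemma continuous_homotopy (s t : R) : continuous (fun p : R * R => homotopy (fst p) (snd p)) (s, t).
Proof.
  unfold homotopy, seg. apply continuous_Cplus; [auto with cont|].
  apply continuous_Cmult; [apply continuous_RtoC, continuous_fst|].
  apply continuous_Cminus; [|auto with cont]. apply continuous_pair_snd, continuous_circle.
Qed.

Lemma continuous_homotopy_t (s t : R) : continuous (homotopy s) t.
Proof.
  apply (continuous_comp_2 (fun _ => s) (fun t => t) homotopy); auto with cont.
  apply continuous_homotopy.
Qed.

Lemma is_curve_derive_homotopy_t (s t : R) :
  is_curve_derive (homotopy s) t (RtoC s * (RtoC r * (Ci * cis t)))%C.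
Proof.
  apply is_curve_derive_plus_const, is_curve_derive_scal.
  apply (is_derive_ext (fun t => (- (a + h) + circle a r t)%C)).
  { intros u. change (- (a + h) + circle a r u = circle a r u - (a + h))%C. ring. }
  apply is_curve_derive_plus_const, is_curve_derive_circle.
Qed.

Lemma circle_integral_homotopy_derivative (s : R) : 0 <= s <= 1 ->
  CRInt (fun t => (f' (homotopy s t) * (RtoC r * cis t))%C) 0 (2 * PI) = RtoC 0 :> C.
Proof.
  intros Hs. destruct (Req_dec s 0) as [->|Hs0].
  - rewrite (CRInt_derive (fun t => (f' (a + h) * RtoC r / Ci * cis t)%C)).
    + rewrite cis_2PI. ring.
    + intros t. eapply is_curve_derive_eq; [apply is_curve_derive_scal, is_curve_derive_cis|].
      unfold homotopy. rewrite seg_0. field. apply Ci_nz.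
    + intros t. apply continuous_Cmult; [|auto with cont]. unfold homotopy.
      apply continuous_ext with (fun _ => f' (a + h)%C); [intros u; now rewrite seg_0|].
      apply continuous_const.
  - assert (Hsn : RtoC s <> RtoC 0) by now apply RtoC_neq_0.
    rewrite (CRInt_derive (fun t => (/ (RtoC s * Ci) * f (homotopy s t))%C)).
    + unfold homotopy. rewrite circle_2PI. ring.
    + intros t. eapply is_curve_derive_eq.
      * apply is_curve_derive_scal, is_curve_derive_comp; [|apply is_curve_derive_homotopy_t].
        now apply Hf, homotopy_in_disc_unit.
      * field. auto using Ci_nz.
    + intros t. apply continuous_Cmult; [|auto with cont].
      apply (continuous_comp (homotopy s) f'); [apply continuous_homotopy_t|].
      now apply Hf, homotopy_in_disc_unit.
Qed.

Lemma is_curve_derive_homotopy_integral (s : R) : 0 <= s <= 1 ->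
  is_curve_derive (fun s => CRInt (fun t => (f (homotopy s t) * cauchy_kernel r h t)%C) 0 (2 * PI))
    s (RtoC 0).
Proof.
  intros Hs. rewrite <- (circle_integral_homotopy_derivative s Hs).
  apply is_curve_derive_CRInt_param with
    (dG := fun s t => (f' (homotopy s t) * (RtoC r * cis t))%C) (e := (rho - r) / (2 * r)).
  - apply Rdiv_lt_0_compat; lra.
  - intros s' t Hs'.
    apply (is_derive_ext (fun s => (cauchy_kernel r h t * f (homotopy s t))%C)).
    { intros u. apply Cmult_comm. }
    eapply is_curve_derive_eq.
    + apply is_curve_derive_scal, (is_curve_derive_comp f (fun s => homotopy s t));
        [|apply is_curve_derive_seg].
      now apply Hf, (homotopy_in_disc s).
    + unfold cauchy_kernel, circle. field. now apply rcis_minus_neq_0.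
  - intros t. apply continuous_Cmult.
    + apply (continuous_comp (fun p : R * R => homotopy (fst p) (snd p)) f');
        [apply continuous_homotopy|]. now apply Hf, homotopy_in_disc_unit.
    + apply (continuous_pair_snd (fun t => (RtoC r * cis t)%C)). auto with cont.
  - intros s' t Hs'. apply continuous_Cmult; [|now apply continuous_cauchy_kernel].
    apply (continuous_comp (homotopy s') f); [apply continuous_homotopy_t|].
    now apply (C1_on_continuous _ _ _ _ Hf), (homotopy_in_disc s).
Qed.

Lemma cauchy_formula :
  circle_mean (fun t => (f (circle a r t) * cauchy_kernel r h t)%C) = f (a + h)%C.
Proof.
  set (I := fun s => CRInt (fun t => (f (homotopy s t) * cauchy_kernel r h t)%C) 0 (2 * PI)).
  assert (E : I 1 = I 0).
  { apply Ceq_of_dist_le_0.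
    apply Rle_trans with (0 * (1 - 0)); [|lra].
    apply (curve_mean_value I (fun _ => RtoC 0)); [lra| |].
    - intros s Hs. now apply is_curve_derive_homotopy_integral.
    - intros s _. rewrite Cmod_0. lra. }
  transitivity (circle_mean (fun t => (f (a + h) * cauchy_kernel r h t)%C)).
  - unfold circle_mean. f_equal. transitivity (I 1).
    + apply CRInt_ext. intros t. unfold homotopy. now rewrite seg_1.
    + rewrite E. apply CRInt_ext. intros t. unfold homotopy. now rewrite seg_0.
  - rewrite circle_mean_scal, circle_mean_cauchy_kernel; [ring|exact Hh|].
    intros t. now apply continuous_cauchy_kernel.
Qed.
End CauchyFormula.

(** * Taylor expansions *)

Definition taylor_coef (f : C -> C) (a : C) (r : R) (n : nat) : C :=
  circle_coef r (fun t => f (circle a r t)) n.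

Definition taylor_rem (f : C -> C) (a : C) (r : R) (h : C) (n : nat) : C :=
  circle_rem r (fun t => f (circle a r t)) h n.

Section Taylor.
Variables (f f' : C -> C) (a : C) (r : R).
Hypothesis Hf : C1_near_disc f f' a r.

Let radius_pos : 0 < r := proj1 Hf.

Let continuous_on_circle (t : R) : continuous (fun t => f (circle a r t)) t :=
  C1_near_disc_circle f f' a r t Hf.

Lemma taylor_rem_0 (h : C) : Cmod h < r -> taylor_rem f a r h 0 = f (a + h)%C.
Proof.
  intros Hh. destruct (proj2 Hf) as [rho [Hrho Hd]].
  rewrite <- (cauchy_formula f f' a h r rho Hh Hrho Hd).
  apply circle_mean_ext. intros t. simpl. ring.
Qed.

Lemma taylor_rem_S (h : C) (n : nat) : Cmod h < r ->
  taylor_rem f a r h n = (taylor_coef f a r n + h * taylor_rem f a r h (S n))%C.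
Proof. apply circle_rem_S; [exact radius_pos|exact continuous_on_circle]. Qed.

Lemma taylor_coef_0 : taylor_coef f a r 0 = f a.
Proof.
  rewrite <- (Cplus_0_r a) at 2. rewrite <- taylor_rem_0 by now rewrite Cmod_0.
  symmetry. apply circle_rem_h0; [exact radius_pos|exact continuous_on_circle].
Qed.

Lemma taylor_coef_bound (n : nat) (M : R) : (forall z, Cmod (z - a) = r -> Cmod (f z) <= M) ->
  Cmod (taylor_coef f a r n) <= M * (/ r) ^ n.
Proof.
  intros HM. apply circle_coef_bound; [exact radius_pos|exact continuous_on_circle|].
  intros t. apply HM, Cmod_circle_minus. lra.
Qed.

Lemma bounded_on_circle : exists M, 0 <= M /\ forall t, Cmod (f (circle a r t)) <= M.
Proof.
  destruct (circle_bounded f a r) as [z0 [_ Hz0]]; [lra| |].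
  - destruct (proj2 Hf) as [rho [Hrho Hd]]. intros z Hz.
    apply (C1_on_continuous _ _ _ _ Hd). unfold Cdisc. lra.
  - exists (Cmod (f z0)). split; [apply Cmod_ge_0|]. intros t.
    apply Hz0, Cmod_circle_minus. lra.
Qed.

Lemma taylor_rem_bound (h : C) (n : nat) (M : R) : Cmod h < r ->
  (forall t, Cmod (f (circle a r t)) <= M) ->
  Cmod (taylor_rem f a r h n) <= M * (/ r) ^ n * (r / (r - Cmod h)).
Proof. apply circle_rem_bound; [exact radius_pos|exact continuous_on_circle]. Qed.

Lemma taylor_rem_bounded (n : nat) :
  exists B, 0 <= B /\ forall h, Cmod h <= r / 2 -> Cmod (taylor_rem f a r h n) <= B.
Proof.
  destruct bounded_on_circle as [M [HM0 HM]].
  assert (Hn : 0 <= (/ r) ^ n) by (apply pow_le; left; now apply Rinv_0_lt_compat).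
  exists (M * (/ r) ^ n * 2). split; [nra|]. intros h Hh.
  eapply Rle_trans; [apply taylor_rem_bound; [lra|exact HM]|].
  apply Rmult_le_compat_l; [nra|]. apply Rle_div_l; lra.
Qed.

Lemma taylor_rem_eq_0 (h : C) (n : nat) : Cmod h < r ->
  (forall m, (n <= m)%nat -> taylor_coef f a r m = RtoC 0) -> taylor_rem f a r h n = RtoC 0.
Proof.
  intros Hh. destruct bounded_on_circle as [M [_ HM]].
  now apply circle_rem_eq_0 with M.
Qed.

Lemma taylor_coef_1 : taylor_coef f a r 1 = f' a.
Proof.
  destruct (taylor_rem_bounded 2) as [B [HB0 HB]].
  assert (Hc : is_C_derive f a (taylor_coef f a r 1)).
  { apply is_C_derive_eps. intros e He. exists (Rmin (r / 2) (e / (B + 1))).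
    split; [apply Rmin_pos; [lra|apply Rdiv_lt_0_compat; lra]|]. intros w Hw.
    destruct (Rmin_Rgt_l _ _ _ Hw) as [W1 W2]. apply Rlt_div_r in W2; [|lra].
    set (h := (w - a)%C) in *.
    assert (Ew : f w = (f a + h * (taylor_coef f a r 1 + h * taylor_rem f a r h 2))%C).
    { replace w with (a + h)%C by (unfold h; ring).
      rewrite <- taylor_rem_0, <- taylor_coef_0, <- !taylor_rem_S by lra. reflexivity. }
    rewrite Ew. replace (f a + h * (taylor_coef f a r 1 + h * taylor_rem f a r h 2) - f a
      - taylor_coef f a r 1 * h)%C with (h * taylor_rem f a r h 2 * h)%C by ring.
    rewrite Cmod_mult. apply Rmult_le_compat_r; [apply Cmod_ge_0|]. rewrite Cmod_mult.
    specialize (HB h ltac:(lra)). assert (Q := Cmod_ge_0 h). nra. }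
  assert (Ha : is_C_derive f a (f' a)).
  { destruct (proj2 Hf) as [rho [Hrho Hd]]. apply Hd, Cdisc_center. lra. }
  rewrite <- (is_C_derive_unique _ _ _ Hc). now apply is_C_derive_unique.
Qed.
End Taylor.

Lemma Cmod_center_le (f f' : C -> C) (a : C) (r M : R) : C1_near_disc f f' a r ->
  (forall z, Cmod (z - a) = r -> Cmod (f z) <= M) -> Cmod (f a) <= M.
Proof.
  intros Hf HM. rewrite <- (taylor_coef_0 f f' a r Hf), <- (Rmult_1_r M).
  exact (taylor_coef_bound f f' a r Hf 0 M HM).
Qed.

Lemma circle_mean_mult_cis (f f' : C -> C) (a : C) (r : R) : C1_near_disc f f' a r ->
  circle_mean (fun t => (f (circle a r t) * cis t)%C) = RtoC 0.
Proof.
  intros Hf. assert (Hc := fun t => C1_near_disc_circle f f' a r t Hf).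
  destruct Hf as [Hr [rho [Hrho Hd]]].
  assert (Hg : C1_near_disc (fun z => ((z - a) * f z)%C)
    (fun z => (1 * f z + (z - a) * f' z)%C) a r).
  { split; [exact Hr|]. exists rho. split; [exact Hrho|]. intros z Hz.
    destruct (Hd z Hz) as [D1 D2]. assert (D3 := is_C_derive_continuous _ _ _ D1).
    split; [|auto with cont]. apply (is_C_derive_mult (fun z => (z - a)%C) f); [|exact D1].
    apply is_C_derive_minus_const, is_C_derive_id. }
  assert (K := taylor_coef_0 _ _ a r Hg). unfold taylor_coef, circle_coef in K.
  rewrite (circle_mean_ext _ (fun t => (RtoC r * (f (circle a r t) * cis t))%C)) in K.
  - rewrite circle_mean_scal in K by auto with cont. cbv beta in K.
    apply NNPP. intros Hn. apply (Cmult_neq_0 (RtoC r)) in Hn; [|apply RtoC_neq_0; lra].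
    apply Hn. rewrite K. ring.
  - intros t. unfold circle. simpl. ring.
Qed.

(* [conj f / cis] is conjugate to [f cis], so its mean vanishes as well. *)
Lemma circle_mean_Re_div_cis (f f' : C -> C) (a : C) (r : R) : C1_near_disc f f' a r ->
  circle_mean (fun t => (RtoC (2 * Re (f (circle a r t))) * / cis t)%C) = (RtoC r * f' a)%C.
Proof.
  intros Hf. assert (Hc := fun t => C1_near_disc_circle f f' a r t Hf).
  assert (Hr0 : RtoC r <> RtoC 0) by (apply RtoC_neq_0; destruct Hf; lra).
  assert (Hcis : forall t, continuous (fun t => (/ cis t)%C) t).
  { intros t. apply continuous_Cinv; [apply continuous_cis|apply cis_neq_0]. }
  transitivity (circle_mean (fun t =>
    (f (circle a r t) * / cis t + Cconj (f (circle a r t) * cis t))%C)).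
  { apply circle_mean_ext. intros t. rewrite Cmult_conj, Cconj_cis, <- Cmult_plus_distr_r. f_equal.
    apply injective_projections; simpl; unfold Re; ring. }
  rewrite circle_mean_plus, circle_mean_Cconj, (circle_mean_mult_cis f f' a r Hf) by auto with cont.
  rewrite <- (taylor_coef_1 f f' a r Hf). unfold taylor_coef, circle_coef.
  rewrite <- circle_mean_scal.
  - rewrite (circle_mean_ext (fun t => (RtoC r * (f (circle a r t) * (/ (RtoC r * cis t)) ^ 1))%C)
      (fun t => (f (circle a r t) * / cis t)%C)).
    + apply injective_projections; simpl; ring.
    + intros t. simpl. field. split; [apply cis_neq_0|exact Hr0].
  - intros t. apply continuous_circle_coef; [now destruct Hf|exact Hc].
Qed.

Lemma Cmod_derive_le_of_Re_nonneg (f f' : C -> C) (a : C) (r : R) : C1_near_disc f f' a r ->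
  (forall z, Cmod (z - a) = r -> 0 <= Re (f z)) -> Cmod (f' a) <= 2 / r * Re (f a).
Proof.
  intros Hf Hpos. assert (Hr := proj1 Hf).
  assert (Hc := fun t => C1_near_disc_circle f f' a r t Hf).
  assert (Em : circle_mean (fun t => (RtoC 2 * f (circle a r t))%C) = (RtoC 2 * f a)%C).
  { rewrite circle_mean_scal by auto. rewrite <- (taylor_coef_0 f f' a r Hf). f_equal.
    apply circle_mean_ext. intros t. simpl. ring. }
  assert (K : Cmod (RtoC r * f' a) <= Re (RtoC 2 * f a)).
  { rewrite <- (circle_mean_Re_div_cis f f' a r Hf), <- Em. apply Cmod_circle_mean_le.
    - intros t. apply continuous_Cdiv; [|apply continuous_cis|apply cis_neq_0].
      apply continuous_RtoC, (continuous_mult (K := R_AbsRing)); auto with cont.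
    - auto with cont.
    - intros t. specialize (Hpos _ (Cmod_circle_minus a r t (Rlt_le _ _ Hr))).
      rewrite Cmod_mult, Cmod_inv, Cmod_cis, Cmod_R, Rabs_pos_eq, re_scal_l
        by (lra || apply cis_neq_0).
      lra. }
  rewrite Cmod_scal, Rabs_pos_eq, re_scal_l in K by lra.
  apply Rmult_le_reg_l with r; [exact Hr|].
  replace (r * (2 / r * Re (f a))) with (2 * Re (f a)) by (field; lra). exact K.
Qed.

Lemma derive_lipschitz (f f' : C -> C) (p q : C) (rho r M : R) : 0 < r -> Cmod (q - p) < rho - r ->
  C1_on (Cdisc p rho) f f' -> (forall z, Cdisc p rho z -> Cmod (f' z) <= M) ->
  Cmod (f' q - f' p) <= M / r * Cmod (q - p).
Proof.
  intros Hr Hq Hf HM. assert (Hd := Cmod_ge_0 (q - p)). set (d := Cmod (q - p)) in *.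
  assert (Np : C1_near_disc f f' p r) by (split; [exact Hr|]; exists rho; split; [lra|exact Hf]).
  assert (Nq : C1_near_disc f f' q r).
  { split; [exact Hr|]. exists (rho - d). split; [lra|]. eapply C1_on_incl; [|exact Hf].
    intros z. apply Cdisc_incl. fold d. lra. }
  assert (Cp := fun t => C1_near_disc_circle f f' p r t Np).
  assert (Cq := fun t => C1_near_disc_circle f f' q r t Nq).
  rewrite <- (taylor_coef_1 f f' p r Np), <- (taylor_coef_1 f f' q r Nq). unfold taylor_coef.
  rewrite <- circle_coef_minus by auto.
  replace (M / r * d) with (M * d * (/ r) ^ 1) by (simpl; field; lra).
  apply circle_coef_bound; [exact Hr|auto with cont|]. intros t.
  replace d with (Cmod (circle q r t - circle p r t)) by (unfold d, circle; f_equal; ring).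
  apply (mean_value_convex (Cdisc p rho) f f'); [apply convex_Cdisc|apply Hf|exact HM| |].
  - unfold Cdisc. rewrite Cmod_circle_minus; lra.
  - apply (Cdisc_incl p q rho (rho - d)); [fold d; lra|].
    unfold Cdisc. rewrite Cmod_circle_minus; lra.
Qed.

(** * Entire functions *)

Lemma closed_disc_uniform_radius (r : R) (Q : C -> posreal -> Prop) :
  (forall p, exists e, Q p e) ->
  exists d : posreal, forall z, Cmod z <= r ->
    exists p e, Q p e /\ Cmod (z - p) < 2 * e /\ d <= e.
Proof.
  intros HQ.
  set (delta := fun u v : R => proj1_sig (constructive_indefinite_description _ (HQ (u, v)))).
  destruct (compactness_value_2d (- r) r (- r) r delta) as [d Hd].
  exists d. intros z Hz. apply NNPP. intros Hno.
  assert (R1 := re_le_Cmod z). assert (R2 := Im_le_Cmod z). apply Rabs_le_between in R1, R2.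
  apply (Hd (Re z) (Im z)); [lra|lra|]. intros [u [v [_ [_ [H1 [H2 H3]]]]]].
  apply Hno. exists (u, v), (delta u v). split; [|split; [|exact H3]].
  - unfold delta. apply proj2_sig.
  - eapply Rle_lt_trans; [apply Cmod_le_Re_Im|]. rewrite Re_minus, Im_minus.
    unfold Re at 2, Im at 2. simpl. lra.
Qed.

(* Around every point there is a radius [e] with [|f| <= 1 / e]; a uniform lower bound for these
   radii is at the same time a bound for [f]. *)
Lemma bounded_on_closed_disc (f : C -> C) (r : R) : (forall z, continuous f z) ->
  exists M, forall z, Cmod z <= r -> Cmod (f z) <= M.
Proof.
  intros Hf.
  destruct (closed_disc_uniform_radius r
    (fun p e => forall z, Cmod (z - p) < 2 * e -> Cmod (f z) <= / e)) as [d Hd].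
  - intros p. destruct (proj1 (continuous_C_eps _ _) (Hf p) 1 Rlt_0_1) as [d [Hd K]].
    assert (Q := Cmod_ge_0 (f p)).
    assert (Hi : 0 < / (Cmod (f p) + 1)) by (apply Rinv_0_lt_compat; lra).
    assert (He : 0 < Rmin (d / 2) (/ (Cmod (f p) + 1))) by (apply Rmin_pos; lra).
    exists (mkposreal _ He). simpl. intros z Hz.
    assert (M1 := Rmin_l (d / 2) (/ (Cmod (f p) + 1))).
    assert (M2 := Rmin_r (d / 2) (/ (Cmod (f p) + 1))).
    specialize (K z ltac:(unfold Cdisc; lra)). assert (T := Cmod_minus_ge (f z) (f p)).
    apply Rinv_le_contravar in M2; [|exact He]. rewrite Rinv_inv in M2. lra.
  - exists (/ d). intros z Hz. destruct (Hd z Hz) as [p [e [He [Hz' Hde]]]].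
    eapply Rle_trans; [now apply He|]. apply Rinv_le_contravar; [apply cond_pos|exact Hde].
Qed.

Definition C1_entire (f f' : C -> C) : Prop := C1_on (fun _ => True) f f'.

Lemma C1_entire_on (D : C -> Prop) (f f' : C -> C) : C1_entire f f' -> C1_on D f f'.
Proof. apply C1_on_incl. auto. Qed.

Lemma C1_entire_derive (f f' : C -> C) (z : C) : C1_entire f f' -> is_C_derive f z (f' z).
Proof. intros Hf. now apply Hf. Qed.

Lemma C1_entire_continuous (f f' : C -> C) (z : C) : C1_entire f f' -> continuous f z.
Proof. intros Hf. now apply (C1_on_continuous _ _ _ _ Hf). Qed.

Lemma C1_entire_near_disc (f f' : C -> C) (a : C) (r : R) :
  C1_entire f f' -> 0 < r -> C1_near_disc f f' a r.
Proof.
  intros Hf Hr. split; [exact Hr|]. exists (r + 1). split; [lra|now apply C1_entire_on].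
Qed.

Section DerivativeIsContinuous.
Variables F f : C -> C.
Hypothesis HF : forall z, is_C_derive F z (f z).
Hypothesis Hf : forall z, continuous f z.

Let f1 (p : C) : C := circle_coef 1 (fun t => f (circle p 1 t)) 1.

Let F_C1 : C1_entire F f := fun z _ => conj (HF z) (Hf z).

Let continuous_circle_F (p : C) (t : R) : continuous (fun t => F (circle p 1 t)) t.
Proof.
  apply (continuous_comp (circle p 1) F); [apply continuous_circle|].
  apply (C1_entire_continuous F f), F_C1.
Qed.

Let continuous_circle_f (p : C) (t : R) : continuous (fun t => f (circle p 1 t)) t.
Proof. apply (continuous_comp (circle p 1) f); [apply continuous_circle|apply Hf]. Qed.

Lemma locally_lipschitz (p : C) : exists M, 0 <= M /\ forall q q',
  Cmod (q - p) <= 1 -> Cmod (q' - q) < 1 -> Cmod (f q' - f q) <= M * Cmod (q' - q).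
Proof.
  destruct (bounded_on_closed_disc f (Cmod p + 4) Hf) as [M HM]. exists M. split.
  - eapply Rle_trans; [apply Cmod_ge_0|apply (HM 0)]. rewrite Cmod_0.
    assert (Q := Cmod_ge_0 p). lra.
  - intros q q' Hq Hqq. replace M with (M / 1) by field.
    apply (derive_lipschitz F f q q' 2 1 M); [lra|lra|now apply C1_entire_on|].
    intros z Hz. apply HM. unfold Cdisc in Hz. assert (T := Cmod_dist_triangle z q p).
    assert (T' := Cmod_minus_ge z p). lra.
Qed.

Lemma lipschitz_on_circle (p : C) : exists M, 0 <= M /\ forall q t, Cmod (q - p) < 1 ->
  Cmod (f (circle p 1 t + (q - p)) - f (circle p 1 t)) <= M * Cmod (q - p).
Proof.
  destruct (locally_lipschitz p) as [M [HM0 HM]]. exists M. split; [exact HM0|]. intros q t Hq.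
  rewrite <- (Cmod_plus_minus_l (circle p 1 t) (q - p)). apply HM.
  - rewrite Cmod_circle_minus; lra.
  - now rewrite Cmod_plus_minus_l.
Qed.

Lemma is_C_derive_circle_coef (p : C) : is_C_derive f p (f1 p).
Proof.
  assert (EF : forall p, f p = circle_coef 1 (fun t => F (circle p 1 t)) 1).
  { intros q. symmetry. apply (taylor_coef_1 F f q 1), C1_entire_near_disc; [exact F_C1|lra]. }
  destruct (lipschitz_on_circle p) as [M [HM0 HM]].
  apply is_C_derive_eps. intros e He. exists (Rmin 1 (e / (M + 1))).
  split; [apply Rmin_pos; [lra|apply Rdiv_lt_0_compat; lra]|]. intros w Hw.
  destruct (Rmin_Rgt_l _ _ _ Hw) as [W1 W2]. apply Rlt_div_r in W2; [|lra].
  assert (Q := Cmod_ge_0 (w - p)). set (d := Cmod (w - p)) in *.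
  rewrite (EF w), (EF p). unfold f1. rewrite (Cmult_comm _ (w - p)).
  rewrite <- circle_coef_scal, <- !circle_coef_minus by (auto with cont; lra).
  apply Rle_trans with (M * d * d * (/ 1) ^ 1); [|simpl; rewrite Rinv_1; nra].
  apply circle_coef_bound; [lra|auto with cont|]. intros t.
  rewrite <- (circle_minus_circle p w 1 t), (Cmult_comm _ (f _)).
  replace (M * d * d) with (M * d * Cmod (circle w 1 t - circle p 1 t))
    by (unfold d; rewrite circle_minus_circle; reflexivity).
  apply (mean_value_convex_affine (fun z => Cmod (z - circle p 1 t) <= d) F f);
    [apply convex_closed_Cdisc|auto| | |].
  - intros z Hz. specialize (HM (p + (z - circle p 1 t))%C t). rewrite !Cmod_plus_minus_l in HM.
    replace (circle p 1 t + (p + (z - circle p 1 t) - p))%C with z in HM by ring.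
    eapply Rle_trans; [apply HM; lra|]. now apply Rmult_le_compat_l.
  - now rewrite Cmod_minus_diag.
  - rewrite circle_minus_circle. unfold d. lra.
Qed.

Lemma continuous_circle_coef_center (p : C) : continuous f1 p.
Proof.
  destruct (lipschitz_on_circle p) as [M [HM0 HM]]. apply continuous_C_eps. intros e He.
  exists (Rmin 1 (e / (M + 1))).
  split; [apply Rmin_pos; [lra|apply Rdiv_lt_0_compat; lra]|]. intros w Hw.
  destruct (Rmin_Rgt_l _ _ _ Hw) as [W1 W2]. apply Rlt_div_r in W2; [|lra].
  assert (Q := Cmod_ge_0 (w - p)). unfold f1. rewrite <- circle_coef_minus by (auto with cont; lra).
  apply Rle_lt_trans with (M * Cmod (w - p) * (/ 1) ^ 1); [|simpl; rewrite Rinv_1; nra].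
  apply circle_coef_bound; [lra|auto with cont|]. intros t.
  replace (circle w 1 t) with (circle p 1 t + (w - p))%C by (unfold circle; ring). now apply HM.
Qed.
End DerivativeIsContinuous.

(* A primitive [F] of [f] is continuously differentiable, so Cauchy's formula for [F' = f] applies;
   differentiating it under the integral sign gives a formula for [f'] in terms of [f]. *)
Lemma C1_entire_exists (f : C -> C) :
  (forall z, exists l, is_C_derive f z l) -> exists f', C1_entire f f'.
Proof.
  intros Hd.
  assert (Hf := ex_C_derive_continuous f Hd).
  destruct (primitive_exists f Hd) as [F HF].
  exists (fun p => circle_coef 1 (fun t => f (circle p 1 t)) 1). intros z _. split.
  - now apply is_C_derive_circle_coef with F.
  - now apply continuous_circle_coef_center with F.
Qed.

Fixpoint taylor_poly (f : C -> C) (N : nat) (z : C) : C :=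
  match N with
  | O => RtoC 0
  | S n => (taylor_poly f n z + taylor_coef f 0 1 n * z ^ n)%C
  end.

Lemma poly_eval_rcons (l : list C) (c z : C) :
  poly_eval (l ++ c :: nil) z = (poly_eval l z + c * z ^ length l)%C.
Proof.
  induction l as [|b l IH]; simpl.
  - change (c + z * 0 = 0 + c * 1)%C. ring.
  - rewrite IH. change (b + z * (poly_eval l z + c * z ^ length l)
      = b + z * poly_eval l z + c * (z * z ^ length l))%C. ring.
Qed.

Lemma is_polynomial_taylor_poly (f : C -> C) (N : nat) : is_polynomial (taylor_poly f N).
Proof.
  exists (map (taylor_coef f 0 1) (seq 0 N)). intros z. induction N; [reflexivity|].
  now rewrite seq_S, map_app, (poly_eval_rcons _ (taylor_coef f 0 1 N)), <- IHN, length_map,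
    length_seq.
Qed.

Section EntireFunctions.
Variables f f' : C -> C.
Hypothesis Hf : C1_entire f f'.

Let near (a : C) (r : R) (Hr : 0 < r) : C1_near_disc f f' a r := C1_entire_near_disc f f' a r Hf Hr.

Lemma taylor_coef_eq_of_rem_eq (a : C) (r r' m : R) (n : nat) : 0 < r -> 0 < r' -> 0 < m ->
  (forall h, h <> RtoC 0 -> Cmod h < m -> taylor_rem f a r h n = taylor_rem f a r' h n) ->
  taylor_coef f a r n = taylor_coef f a r' n.
Proof.
  intros Hr Hr' Hm H.
  destruct (taylor_rem_bounded f f' a r (near a r Hr) (S n)) as [B [_ HB]].
  destruct (taylor_rem_bounded f f' a r' (near a r' Hr') (S n)) as [B' [_ HB']].
  apply Ceq_of_dist_le_0.
  apply Rle_0_of_le_eps with (B' + B). intros e He.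
  set (x := Rmin e (Rmin (m / 2) (Rmin (r / 2) (r' / 2)))).
  assert (Hx : 0 < x) by (repeat apply Rmin_pos; lra).
  assert (Xe : x <= e) by apply Rmin_l.
  assert (Xm : x <= m / 2) by (eapply Rle_trans; [apply Rmin_r|apply Rmin_l]).
  assert (Xr : x <= r / 2) by (do 2 (eapply Rle_trans; [apply Rmin_r|]); apply Rmin_l).
  assert (Xr' : x <= r' / 2) by (do 2 (eapply Rle_trans; [apply Rmin_r|]); apply Rmin_r).
  assert (Mx : Cmod (RtoC x) = x) by (rewrite Cmod_R, Rabs_pos_eq; lra).
  assert (E := H (RtoC x) ltac:(apply RtoC_neq_0; lra) ltac:(lra)).
  rewrite (taylor_rem_S f f' a r (near a r Hr)),
    (taylor_rem_S f f' a r' (near a r' Hr')) in E by lra.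
  specialize (HB (RtoC x) ltac:(lra)). specialize (HB' (RtoC x) ltac:(lra)).
  replace (taylor_coef f a r n - taylor_coef f a r' n)%C
    with (RtoC x * (taylor_rem f a r' (RtoC x) (S n) - taylor_rem f a r (RtoC x) (S n)))%C.
  - rewrite Cmod_scal, Rabs_pos_eq by lra.
    assert (T := Cmod_minus_le (taylor_rem f a r' (RtoC x) (S n))
      (taylor_rem f a r (RtoC x) (S n))).
    assert (Q := Cmod_ge_0 (taylor_rem f a r' (RtoC x) (S n) - taylor_rem f a r (RtoC x) (S n))).
    apply Rmult_le_compat; lra.
  - transitivity ((taylor_coef f a r' n + RtoC x * taylor_rem f a r' (RtoC x) (S n))
      - RtoC x * taylor_rem f a r (RtoC x) (S n) - taylor_coef f a r' n)%C; [ring|].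
    rewrite <- E. ring.
Qed.

Lemma taylor_coef_radius (a : C) (r r' : R) (n : nat) : 0 < r -> 0 < r' ->
  taylor_coef f a r n = taylor_coef f a r' n.
Proof.
  intros Hr Hr'. set (m := Rmin r r'). assert (Hm : 0 < m) by now apply Rmin_pos.
  assert (M1 : m <= r) by apply Rmin_l. assert (M2 : m <= r') by apply Rmin_r.
  apply taylor_coef_eq_of_rem_eq with m; auto.
  induction n; intros h Hh Hhm.
  - rewrite (taylor_rem_0 f f' a r (near a r Hr)), (taylor_rem_0 f f' a r' (near a r' Hr')) by lra.
    reflexivity.
  - assert (E := IHn h Hh Hhm).
    rewrite (taylor_rem_S f f' a r (near a r Hr)), (taylor_rem_S f f' a r' (near a r' Hr')),
      (taylor_coef_eq_of_rem_eq a r r' m n Hr Hr' Hm IHn) in E by lra.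
    transitivity
      (/ h * (taylor_coef f a r' n + h * taylor_rem f a r h (S n) - taylor_coef f a r' n))%C.
    + field. exact Hh.
    + rewrite E. field. exact Hh.
Qed.

Lemma taylor_poly_remainder (N : nat) (r : R) (z : C) : Cmod z < r ->
  (f z - taylor_poly f N z)%C = (z ^ N * taylor_rem f 0 r z N)%C.
Proof.
  intros Hz. assert (Hr : 0 < r) by (assert (Q := Cmod_ge_0 z); lra). induction N.
  - simpl. rewrite (taylor_rem_0 f f' 0 r (near 0 r Hr)), Cplus_0_l by exact Hz. ring.
  - simpl. rewrite (taylor_rem_S f f' 0 r (near 0 r Hr)), (taylor_coef_radius 0 r 1) in IHN by lra.
    transitivity (f z - taylor_poly f N z - taylor_coef f 0 1 N * z ^ N)%C; [ring|].
    rewrite IHN. ring.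
Qed.

Lemma is_polynomial_of_taylor_coef (N : nat) :
  (forall n, (N <= n)%nat -> taylor_coef f 0 1 n = RtoC 0) -> is_polynomial f.
Proof.
  intros H. destruct (is_polynomial_taylor_poly f N) as [l Hl]. exists l. intros z. rewrite <- Hl.
  set (r := Cmod z + 1). assert (Q := Cmod_ge_0 z).
  assert (Hr : 0 < r) by (unfold r; lra). assert (Hz : Cmod z < r) by (unfold r; lra).
  apply Ceq_minus. rewrite (taylor_poly_remainder N r z Hz).
  rewrite (taylor_rem_eq_0 f f' 0 r (near 0 r Hr)); [ring|exact Hz|].
  intros n Hn. rewrite (taylor_coef_radius 0 r 1) by lra. now apply H.
Qed.

Lemma taylor_poly_uniform_limit (r e : R) : 0 <= r -> 0 < e ->
  exists N0, forall N z, (N0 <= N)%nat -> Cmod z <= r -> Cmod (f z - taylor_poly f N z) <= e.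
Proof.
  intros Hr He. set (r' := 2 * r + 1). assert (Hr' : 0 < r') by (unfold r'; lra).
  destruct (bounded_on_circle f f' 0 r' (near 0 r' Hr')) as [M [HM0 HM]].
  destruct (pow_small (2 * M) (1 / 2) e) as [N0 HN0]; [lra|exact He|].
  exists N0. intros N z HN Hz. assert (Q := Cmod_ge_0 z).
  assert (Hzr : Cmod z < r') by (unfold r'; lra).
  rewrite (taylor_poly_remainder N r' z Hzr), Cmod_mult, Cmod_pow.
  assert (B := taylor_rem_bound f f' 0 r' (near 0 r' Hr') z N M Hzr HM).
  assert (B2 : r' / (r' - Cmod z) <= 2) by (apply Rle_div_l; unfold r'; lra).
  assert (Hp : 0 <= Cmod z ^ N) by now apply pow_le.
  assert (Hi : 0 < / r') by now apply Rinv_0_lt_compat.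
  assert (Hip : 0 <= (/ r') ^ N) by (apply pow_le; lra).
  assert (Hq : Cmod z ^ N * (/ r') ^ N <= (1 / 2) ^ N).
  { rewrite <- Rpow_mult_distr. apply pow_incr. split; [apply Rmult_le_pos; lra|].
    apply Rle_div_l; unfold r'; lra. }
  specialize (HN0 N HN).
  apply Rle_trans with (Cmod z ^ N * (M * (/ r') ^ N * 2)).
  - apply Rmult_le_compat_l; [exact Hp|]. eapply Rle_trans; [exact B|].
    apply Rmult_le_compat_l; [now apply Rmult_le_pos|exact B2].
  - replace (Cmod z ^ N * (M * (/ r') ^ N * 2)) with (2 * M * (Cmod z ^ N * (/ r') ^ N)) by ring.
    apply Rle_trans with (2 * M * (1 / 2) ^ N); [apply Rmult_le_compat_l|]; lra.
Qed.

Hypothesis Htr : ~ is_polynomial f.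

Lemma transcendental_taylor_coef (N : nat) :
  exists n, (N <= n)%nat /\ taylor_coef f 0 1 n <> RtoC 0.
Proof.
  apply NNPP. intros H. apply Htr, (is_polynomial_of_taylor_coef N). intros n Hn.
  apply NNPP. intros Hc. apply H. now exists n.
Qed.

Lemma transcendental_growth (k : nat) :
  exists r0, 1 <= r0 /\ forall r, r0 <= r -> exists z, Cmod z = r /\ r ^ k <= Cmod (f z).
Proof.
  destruct (transcendental_taylor_coef (S k)) as [n [Hn Hc]]. apply Cmod_gt_0 in Hc.
  set (c := Cmod (taylor_coef f 0 1 n)) in *.
  exists (Rmax 1 (2 / c)). split; [apply Rmax_l|]. intros r Hr.
  assert (R1 := Rle_trans _ _ _ (Rmax_l _ _) Hr). assert (R2 := Rle_trans _ _ _ (Rmax_r _ _) Hr).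
  apply Rle_div_l in R2; [|lra].
  apply NNPP. intros Hno.
  assert (HM : forall z, Cmod (z - 0) = r -> Cmod (f z) <= r ^ k).
  { intros z Hz. replace (z - 0)%C with z in Hz by ring.
    apply Rnot_lt_le. intros Hlt. apply Hno. exists z. split; [exact Hz|lra]. }
  assert (B := taylor_coef_bound f f' 0 r (near 0 r ltac:(lra)) n _ HM).
  rewrite (taylor_coef_radius 0 r 1) in B by lra. fold c in B.
  assert (Hpow : r ^ k * (/ r) ^ n <= / r).
  { replace n with (k + S (n - S k))%nat by lia.
    rewrite pow_add, <- Rmult_assoc, <- Rpow_mult_distr.
    rewrite Rinv_r, pow1, Rmult_1_l by lra. simpl.
    assert (Hi : 0 < / r <= 1).
    { split; [apply Rinv_0_lt_compat; lra|]. rewrite <- Rinv_1. apply Rinv_le_contravar; lra. }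
    assert ((/ r) ^ (n - S k) <= 1) by (rewrite <- (pow1 (n - S k)); apply pow_incr; lra).
    nra. }
  assert (c * r <= 1); [|lra]. rewrite <- (Rinv_l r) by lra. apply Rmult_le_compat_r; lra.
Qed.

Lemma nonconstant_taylor_coef (a : C) : exists n, (0 < n)%nat /\ taylor_coef f a 1 n <> RtoC 0.
Proof.
  apply NNPP. intros Hno. apply Htr. exists (f a :: nil). intros z.
  assert (Q := Cmod_ge_0 (z - a)). set (r := Cmod (z - a) + 1).
  assert (Hr : 0 < r) by (unfold r; lra).
  assert (Hz : Cmod (z - a) < r) by (unfold r; lra).
  change (f z = f a + z * 0)%C. replace z with (a + (z - a))%C at 1 by ring.
  rewrite <- (taylor_rem_0 f f' a r (near a r Hr)), (taylor_rem_S f f' a r (near a r Hr))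
    by exact Hz.
  rewrite (taylor_coef_0 f f' a r (near a r Hr)), (taylor_rem_eq_0 f f' a r (near a r Hr));
    [ring|exact Hz|].
  intros n Hn. rewrite (taylor_coef_radius a r 1) by lra.
  apply NNPP. intros Hc. apply Hno. exists n. split; [lia|exact Hc].
Qed.

Lemma isolated_value (a : C) :
  exists d, 0 < d /\ forall h, h <> RtoC 0 -> Cmod h < d -> f (a + h)%C <> f a.
Proof.
  destruct (dec_inh_nat_subset_has_unique_least_element
    (fun n => (0 < n)%nat /\ taylor_coef f a 1 n <> RtoC 0)) as [n [[[Hn Hc] Hleast] _]];
    [intros; apply classic|apply nonconstant_taylor_coef|].
  destruct (taylor_rem_bounded f f' a 1 (near a 1 Rlt_0_1) (S n)) as [B [HB0 HB]].
  assert (Hc0 := proj1 (Cmod_gt_0 _) Hc).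
  exists (Rmin (1 / 2) (Cmod (taylor_coef f a 1 n) / (B + 1))).
  split; [apply Rmin_pos; [lra|apply Rdiv_lt_0_compat; lra]|]. intros h Hh Hhd E.
  destruct (Rmin_Rgt_l _ _ _ Hhd) as [H1 H2]. apply Rlt_div_r in H2; [|lra].
  assert (E1 : (h * taylor_rem f a 1 h 1)%C = RtoC 0).
  { rewrite <- (taylor_rem_0 f f' a 1 (near a 1 Rlt_0_1)),
      (taylor_rem_S f f' a 1 (near a 1 Rlt_0_1)),
        (taylor_coef_0 f f' a 1 (near a 1 Rlt_0_1)) in E by lra.
    transitivity (f a + h * taylor_rem f a 1 h 1 - f a)%C; [ring|]. rewrite E. ring. }
  assert (Eshift : taylor_rem f a 1 h 1 = (h ^ (n - 1) * taylor_rem f a 1 h n)%C).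
  { replace n with (1 + (n - 1))%nat at 2 by lia. unfold taylor_rem.
    apply circle_rem_shift; [lra| |lra|].
    - intros t. apply (C1_near_disc_circle f f'), near. lra.
    - intros m Hm. apply NNPP. intros Hm0. assert (K := Hleast m (conj (proj1 Hm) Hm0)). lia. }
  rewrite Eshift, (taylor_rem_S f f' a 1 (near a 1 Rlt_0_1)) in E1 by lra.
  apply (Cmult_neq_0 h (h ^ (n - 1) * (taylor_coef f a 1 n + h * taylor_rem f a 1 h (S n)))) in E1;
    [exact E1|exact Hh|].
  apply Cmult_neq_0; [now apply Cpow_nz|]. apply Cmod_gt_0.
  specialize (HB h ltac:(lra)).
  assert (T := Cmod_minus_ge (taylor_coef f a 1 n) (- (h * taylor_rem f a 1 h (S n)))).
  rewrite Cmod_opp, Cmod_mult in T. apply Cmod_gt_0 in Hh.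
  replace (taylor_coef f a 1 n - - (h * taylor_rem f a 1 h (S n)))%C
    with (taylor_coef f a 1 n + h * taylor_rem f a 1 h (S n))%C in T by ring.
  nra.
Qed.
End EntireFunctions.

Lemma circle_lower_bound (f : C -> C) (a : C) (r : R) : 0 <= r ->
  (forall z, Cmod (z - a) = r -> continuous f z /\ f z <> RtoC 0) ->
  exists m, 0 < m /\ forall z, Cmod (z - a) = r -> m <= Cmod (f z).
Proof.
  intros Hr Hf. destruct (circle_bounded (fun z => (/ f z)%C) a r Hr) as [z0 [Ez0 Hz0]].
  { intros z Hz. now apply continuous_Cinv; apply Hf. }
  assert (Hn := fun z Hz => proj2 (Hf z Hz)).
  exists (Cmod (f z0)). split; [now apply Cmod_gt_0, Hn|]. intros z Hz.
  specialize (Hz0 z Hz). rewrite !Cmod_inv in Hz0 by auto.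
  assert (Pz := proj1 (Cmod_gt_0 _) (Hn z Hz)).
  apply Rinv_le_contravar in Hz0; [|now apply Rinv_0_lt_compat]. now rewrite !Rinv_inv in Hz0.
Qed.

Lemma zero_of_small_center (f f' : C -> C) (a : C) (r rho m : R) : 0 < r < rho ->
  C1_on (Cdisc a rho) f f' -> (forall z, Cmod (z - a) = r -> m <= Cmod (f z)) ->
  Cmod (f a) < m -> exists z, Cdisc a rho z /\ f z = RtoC 0.
Proof.
  intros Hr Hf Hm Ha. apply NNPP. intros Hno.
  assert (Hn : forall z, Cdisc a rho z -> f z <> RtoC 0).
  { intros z Hz E. apply Hno. now exists z. }
  assert (Na := Hn a (Cdisc_center a rho ltac:(lra))). assert (Pa := proj1 (Cmod_gt_0 _) Na).
  assert (K : Cmod (/ f a) <= / m).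
  { apply (Cmod_center_le (fun z => (/ f z)%C) (fun z => (- f' z / (f z * f z))%C) a r).
    - split; [lra|]. exists rho. split; [lra|]. intros z Hz. destruct (Hf z Hz) as [D1 D2].
      assert (D3 := is_C_derive_continuous _ _ _ D1). split; [now apply is_C_derive_inv, Hn|].
      apply continuous_Cdiv; [auto with cont|auto with cont|]. now apply Cmult_neq_0; apply Hn.
    - intros z Hz. rewrite Cmod_inv by (apply Hn; unfold Cdisc; lra).
      apply Rinv_le_contravar; [lra|auto]. }
  rewrite Cmod_inv in K by exact Na. apply Rinv_lt_contravar in Ha; [lra|nra].
Qed.

Lemma open_mapping (f f' : C -> C) (a : C) (e : R) : C1_entire f f' -> ~ is_polynomial f -> 0 < e ->
  exists d, 0 < d /\ forall w, Cmod (w - f a) < d -> exists z, Cmod (z - a) < e /\ f z = w.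
Proof.
  intros Hf Htr He. destruct (isolated_value f f' Hf Htr a) as [d0 [Hd0 Hiso]].
  set (rho := Rmin e d0). assert (Hrho : 0 < rho) by now apply Rmin_pos.
  assert (R1 : rho <= e) by apply Rmin_l. assert (R2 : rho <= d0) by apply Rmin_r.
  destruct (circle_lower_bound (fun z => (f z - f a)%C) a (rho / 2)) as [m [Hm Hbd]]; [lra| |].
  { intros z Hz. split.
    - apply continuous_Cminus; [now apply (C1_entire_continuous f f')|apply continuous_const].
    - apply Cminus_eq_contra. replace z with (a + (z - a))%C by ring. apply Hiso; [|lra].
      apply Cmod_gt_0. lra. }
  exists (m / 2). split; [lra|]. intros w Hw. rewrite Cmod_minus_sym in Hw.
  destruct (zero_of_small_center (fun z => (f z - w)%C) f' a (rho / 2) rho (m / 2)) as [z [Hz Ez]].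
  - lra.
  - intros z _. split; [now apply is_C_derive_minus_const, C1_entire_derive|now apply Hf].
  - intros z Hz. specialize (Hbd z Hz). assert (T := Cmod_dist_triangle (f z) w (f a)).
    rewrite (Cmod_minus_sym w) in T. lra.
  - exact Hw.
  - exists z. unfold Cdisc in Hz. split; [lra|now apply Ceq_minus].
Qed.

(** * Local inverses *)

Section NearlyAffine.
Variables (f f' : C -> C) (p A : C) (r : R).
Hypothesis HA : A <> RtoC 0.
Hypothesis Hf : forall z, Cdisc p r z -> is_C_derive f z (f' z).
Hypothesis HfA : forall z, Cdisc p r z -> Cmod (f' z - A) <= Cmod A / 2.

Lemma nearly_affine_remainder (x y : C) : Cdisc p r x -> Cdisc p r y ->
  Cmod (f y - f x - A * (y - x)) <= Cmod A / 2 * Cmod (y - x).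
Proof.
  intros Hx Hy. apply (mean_value_convex_affine (Cdisc p r) f f'); auto. apply convex_Cdisc.
Qed.

Lemma nearly_affine_expanding (x y : C) : Cdisc p r x -> Cdisc p r y ->
  Cmod A / 2 * Cmod (x - y) <= Cmod (f x - f y).
Proof.
  intros Hx Hy. assert (K := nearly_affine_remainder y x Hy Hx).
  assert (T := Cmod_minus_ge (A * (x - y)) (A * (x - y) - (f x - f y))).
  replace (A * (x - y) - (A * (x - y) - (f x - f y)))%C with (f x - f y)%C in T by ring.
  rewrite Cmod_mult in T. rewrite Cmod_minus_sym in K. lra.
Qed.

(* [f z = w] says that [z] is fixed by the Newton map [z - (f z - w) / A]. *)
Lemma nearly_affine_surjective (w : C) : Cmod (w - f p) < Cmod A * r / 2 ->
  exists z, Cdisc p r z /\ f z = w.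
Proof.
  intros Hw. assert (HA0 := proj1 (Cmod_gt_0 _) HA).
  destruct (contraction_fixed_point (fun z => (z - (f z - w) / A)%C) p r (1 / 2)) as [z [Hz Ez]].
  - lra.
  - intros x y Hx Hy.
    replace (y - (f y - w) / A - (x - (f x - w) / A))%C with (- (f y - f x - A * (y - x)) / A)%C
      by (field; auto).
    rewrite Cmod_div, Cmod_opp by auto. apply Rle_div_l; auto.
    assert (K := nearly_affine_remainder x y Hx Hy). lra.
  - replace (p - (f p - w) / A - p)%C with ((w - f p) / A)%C by (field; auto).
    rewrite Cmod_div by auto. apply Rlt_div_l; lra.
  - exists z. split; [exact Hz|]. apply Ceq_minus.
    transitivity (- A * (z - (f z - w) / A - z))%C; [field; auto|]. rewrite Ez. ring.
Qed.
End NearlyAffine.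

Lemma local_inverse (P P' : C -> C) (p : C) : C1_entire P P' -> P' p <> RtoC 0 ->
  exists r a e, 0 < r /\ 0 < a /\ 0 < e /\
    (forall x y, Cdisc p r x -> Cdisc p r y -> a * Cmod (x - y) <= Cmod (P x - P y)) /\
    (forall w, Cdisc (P p) e w -> exists z, Cdisc p r z /\ P z = w).
Proof.
  intros HP Hn. assert (H0 := proj1 (Cmod_gt_0 _) Hn).
  destruct (proj1 (continuous_C_eps _ _) (proj2 (HP p I)) (Cmod (P' p) / 2)) as [r [Hr Hd]]; [lra|].
  assert (Hd' : forall z, Cdisc p r z -> Cmod (P' z - P' p) <= Cmod (P' p) / 2).
  { intros z Hz. left. auto. }
  assert (HPd : forall z, Cdisc p r z -> is_C_derive P z (P' z)) by (intros; now apply HP).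
  exists r, (Cmod (P' p) / 2), (Cmod (P' p) * r / 2).
  split; [exact Hr|]. split; [lra|]. split; [nra|]. split.
  - intros x y. now apply nearly_affine_expanding with P'.
  - intros w. now apply nearly_affine_surjective with P'.
Qed.

(** * Lifting through a map without singular values over the target *)

Lemma real_induction (Q : R -> Prop) : Q 0 ->
  (forall t, 0 <= t < 1 -> Q t -> exists d, 0 < d /\ forall s, t < s < t + d -> s <= 1 -> Q s) ->
  (forall t, 0 < t <= 1 -> (forall s, 0 <= s < t -> Q s) -> Q t) ->
  forall t, 0 <= t <= 1 -> Q t.
Proof.
  intros H0 Hop Hcl.
  set (E := fun t => 0 <= t <= 1 /\ forall s, 0 <= s <= t -> Q s).
  assert (E0 : E 0). { split; [lra|]. intros s Hs. now replace s with 0 by lra. }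
  destruct (completeness E) as [m [Hub Hlub]].
  { exists 1. intros x [Hx _]. lra. }
  { now exists 0. }
  assert (Hm0 : 0 <= m) by (apply Hub; auto).
  assert (Hm1 : m <= 1) by (apply Hlub; intros x [Hx _]; lra).
  assert (Hlt : forall s, 0 <= s < m -> Q s).
  { intros s Hs. apply NNPP. intros Hn. assert (K : is_upper_bound E s).
    { intros x [Hx Hq]. apply Rnot_lt_le. intros Hsx. apply Hn, Hq. lra. }
    specialize (Hlub s K). lra. }
  assert (HQm : Q m). { destruct (Req_dec m 0) as [->|]; auto. apply Hcl; auto. lra. }
  assert (Em : E m).
  { split; [lra|]. intros s Hs. destruct (Req_dec s m) as [->|]; auto. apply Hlt. lra. }
  destruct (Req_dec m 1) as [E1|E1].
  { intros t Ht. apply Em. lra. }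
  exfalso. destruct (Hop m ltac:(lra) HQm) as [d [Hd Hd2]].
  set (s := Rmin 1 (m + d / 2)).
  assert (S1 : s <= 1) by apply Rmin_l. assert (S2 : s <= m + d / 2) by apply Rmin_r.
  assert (S3 : m < s) by (apply Rmin_glb_lt; lra).
  assert (Es : E s).
  { split; [lra|]. intros x Hx. destruct (Rle_dec x m); [apply Em; lra|]. apply Hd2; lra. }
  specialize (Hub s Es). lra.
Qed.

Lemma curve_eq_of_eq_before (c1 c2 : R -> C) (t : R) : 0 < t ->
  continuous c1 t -> continuous c2 t -> (forall s, 0 <= s < t -> c1 s = c2 s) -> c1 t = c2 t.
Proof.
  intros Ht H1 H2 Hs. apply Ceq_of_dist_le_0.
  apply Rle_0_of_le_eps with 2. intros e He.
  destruct (proj1 (continuous_curve_eps _ _) H1 e He) as [d1 [Hd1 K1]].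
  destruct (proj1 (continuous_curve_eps _ _) H2 e He) as [d2 [Hd2 K2]].
  set (d := Rmin (Rmin d1 d2) t). assert (Hd : 0 < d) by (repeat apply Rmin_pos; lra).
  assert (M0 : d <= t) by apply Rmin_r. assert (M : d <= Rmin d1 d2) by apply Rmin_l.
  assert (M1 := Rmin_l d1 d2). assert (M2 := Rmin_r d1 d2).
  assert (Ha : Rabs (t - d / 2 - t) = d / 2) by (rewrite Rabs_left; lra).
  specialize (K1 (t - d / 2) ltac:(lra)). specialize (K2 (t - d / 2) ltac:(lra)).
  rewrite Cmod_minus_sym in K1. rewrite <- (Hs (t - d / 2)) in K2 by lra.
  assert (T := Cmod_dist_triangle (c1 t) (c1 (t - d / 2)) (c2 t)). lra.
Qed.

Lemma curve_lift_unique (P P' : C -> C) (c1 c2 : R -> C) : C1_entire P P' ->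
  (forall t, 0 <= t <= 1 -> continuous c1 t /\ continuous c2 t) ->
  (forall t, 0 <= t <= 1 -> P (c1 t) = P (c2 t)) ->
  (forall t, 0 <= t <= 1 -> P' (c1 t) <> RtoC 0) ->
  c1 0 = c2 0 -> forall t, 0 <= t <= 1 -> c1 t = c2 t.
Proof.
  intros HP Hc HE Hn H0. apply real_induction; [exact H0| |].
  - intros t Ht Et. destruct (Hc t ltac:(lra)) as [H1 H2].
    destruct (local_inverse P P' (c1 t) HP (Hn t ltac:(lra))) as [r [a [e [Hr [Ha [_ [Hinj _]]]]]]].
    destruct (proj1 (continuous_curve_eps _ _) H1 r Hr) as [d1 [Hd1 K1]].
    destruct (proj1 (continuous_curve_eps _ _) H2 r Hr) as [d2 [Hd2 K2]].
    exists (Rmin d1 d2). split; [now apply Rmin_pos|]. intros s Hs Hs1.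
    assert (M1 := Rmin_l d1 d2). assert (M2 := Rmin_r d1 d2).
    specialize (K1 s ltac:(rewrite Rabs_pos_eq; lra)).
    specialize (K2 s ltac:(rewrite Rabs_pos_eq; lra)).
    rewrite <- Et in K2. specialize (Hinj _ _ K1 K2).
    rewrite (HE s), Cmod_minus_diag in Hinj by lra.
    apply Ceq_minus, Cmod_eq_0. assert (Q := Cmod_ge_0 (c1 s - c2 s)). nra.
  - intros t Ht. apply curve_eq_of_eq_before; [lra| |]; apply Hc; lra.
Qed.

Lemma bounded_accumulation (c : R -> C) (t M : R) :
  (forall s, s < t -> exists s', s < s' < t /\ Cmod (c s') <= M) ->
  exists p, forall e s, 0 < e -> s < t -> exists s', s < s' < t /\ Cmod (c s' - p) < e.
Proof.
  intros H. apply NNPP. intros Hno.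
  destruct (closed_disc_uniform_radius M
    (fun p e => forall s', t - e < s' < t -> 2 * e <= Cmod (c s' - p))) as [d Hd].
  - intros p. apply NNPP. intros Hp. apply Hno. exists p. intros e s He Hs.
    apply NNPP. intros Hs'. apply Hp.
    assert (Hpos : 0 < Rmin (e / 2) (t - s)) by (apply Rmin_pos; lra).
    exists (mkposreal _ Hpos). simpl. intros s' Hs2.
    assert (R1 := Rmin_l (e / 2) (t - s)). assert (R2 := Rmin_r (e / 2) (t - s)).
    apply Rnot_lt_le. intros Hlt. apply Hs'. exists s'. split; lra.
  - assert (Q := cond_pos d). destruct (H (t - d)) as [s' [Hs' Hc]]; [lra|].
    destruct (Hd _ Hc) as [p [e [He [Hz Hde]]]]. specialize (He s' ltac:(lra)). lra.
Qed.

Lemma accumulation_point_value (P : C -> C) (c : R -> C) (p w : C) (t : R) : continuous P p ->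
  (forall e s, 0 < e -> s < t -> exists s', s < s' < t /\ Cmod (c s' - p) < e) ->
  (forall e, 0 < e -> exists s0, s0 < t /\ forall s, s0 < s < t -> Cmod (P (c s) - w) < e) ->
  P p = w.
Proof.
  intros HP Hp Hlim. apply Ceq_of_dist_le_0.
  apply Rle_0_of_le_eps with 2. intros e He.
  destruct (proj1 (continuous_C_eps _ _) HP e He) as [d [Hd K]].
  destruct (Hlim e He) as [s0 [Hs0 Ks]]. destruct (Hp d s0 Hd Hs0) as [s [Hs Hsp]].
  specialize (Ks s Hs). specialize (K (c s) Hsp). rewrite Cmod_minus_sym in K.
  assert (T := Cmod_dist_triangle (P p) (P (c s)) w). lra.
Qed.

Lemma Cnorm_Cmod (z : C) : Cnorm z = Cmod z.
Proof. unfold Cnorm, Cmod. f_equal. ring. Qed.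

Lemma Cnorm_Csub (z w : C) : Cnorm (Csub z w) = Cmod (z - w).
Proof. apply (Cnorm_Cmod (z - w)). Qed.

(* The time change [t / (1 + t)] maps the half-line of [asymptotic_value] to [0, 1). *)
Lemma asymptotic_value_of_path (P : C -> C) (c : R -> C) (w : C) :
  (forall s, 0 <= s < 1 -> forall e, 0 < e -> exists d, 0 < d /\
     forall s', 0 <= s' < 1 -> Rabs (s' - s) < d -> Cmod (c s' - c s) < e) ->
  (forall M, exists s, s < 1 /\ forall s', s < s' < 1 -> M < Cmod (c s')) ->
  (forall e, 0 < e -> exists s, s < 1 /\ forall s', s < s' < 1 -> Cmod (P (c s') - w) < e) ->
  asymptotic_value P w.
Proof.
  intros Hc Hinf Hlim. set (h := fun t => t / (1 + t)).
  assert (Hh : forall t, 0 <= t -> 0 <= h t < 1).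
  { intros t Ht. unfold h. split; [apply Rdiv_le_0_compat; lra|apply Rlt_div_l; lra]. }
  assert (Hlip : forall a b, 0 <= a -> 0 <= b -> Rabs (h a - h b) <= Rabs (a - b)).
  { intros a b Ha Hb. unfold h.
    replace (a / (1 + a) - b / (1 + b)) with (/ ((1 + a) * (1 + b)) * (a - b)) by (field; lra).
    assert (Hi : 0 < / ((1 + a) * (1 + b)) <= 1).
    { split; [apply Rinv_0_lt_compat; nra|]. rewrite <- Rinv_1. apply Rinv_le_contravar; nra. }
    rewrite Rabs_mult, (Rabs_pos_eq (/ _)) by lra. assert (Q := Rabs_pos (a - b)). nra. }
  assert (Hto1 : forall s, s < 1 -> exists T, 0 <= T /\ forall t, T <= t -> s < h t < 1).
  { intros s Hs. exists (Rmax 0 (1 / (1 - s))). split; [apply Rmax_l|]. intros t Ht.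
    assert (T0 := Rle_trans _ _ _ (Rmax_l _ _) Ht). assert (T1 := Rle_trans _ _ _ (Rmax_r _ _) Ht).
    split; [|now apply Hh]. apply Rle_div_l in T1; [|lra]. apply Rlt_div_r; nra. }
  exists (fun t => c (h t)). split; [|split].
  - intros t Ht e He. destruct (Hc (h t) (Hh t Ht) e He) as [d [Hd K]]. exists d.
    split; [exact Hd|].
    intros s Hs Hst. rewrite Cnorm_Csub. apply K; [now apply Hh|].
    eapply Rle_lt_trans; [now apply Hlip|exact Hst].
  - intros M. destruct (Hinf M) as [s [Hs K]]. destruct (Hto1 s Hs) as [T [_ HT]].
    exists T. intros t Ht. rewrite Cnorm_Cmod. apply K, HT. lra.
  - intros e He. destruct (Hlim e He) as [s [Hs K]]. destruct (Hto1 s Hs) as [T [_ HT]].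
    exists T. intros t Ht. rewrite Cnorm_Csub. apply K, HT. lra.
Qed.

Definition tube (x y : C) (d : R) (u : C) : Prop := exists t, 0 <= t <= 1 /\ Cdisc (seg x y t) d u.

Lemma tube_seg (x y : C) (d t : R) : 0 < d -> 0 <= t <= 1 -> tube x y d (seg x y t).
Proof. intros Hd Ht. exists t. split; [exact Ht|now apply Cdisc_center]. Qed.

Lemma tube_start (x y : C) (d : R) : 0 < d -> tube x y d x.
Proof. intros Hd. rewrite <- (seg_0 x y) at 2. apply tube_seg; lra. Qed.

Lemma Cdisc_tube_end (x y : C) (d : R) (u : C) : Cdisc y d u -> tube x y d u.
Proof. intros Hu. exists 1. split; [lra|]. now rewrite seg_1. Qed.

Lemma tube_end (x y : C) (d : R) : 0 < d -> tube x y d y.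
Proof. intros Hd. now apply Cdisc_tube_end, Cdisc_center. Qed.

Lemma open_Cdisc (a : C) (r : R) : open (Cdisc a r).
Proof.
  intros z Hz. apply locally_Cdisc. exists (r - Cmod (z - a)).
  split; [unfold Cdisc in Hz; lra|]. intros w. apply Cdisc_incl. lra.
Qed.

Lemma open_tube (x y : C) (d : R) : open (tube x y d).
Proof.
  intros u [t [Ht Hu]]. generalize (open_Cdisc _ _ u Hu). apply filter_imp.
  intros v Hv. now exists t.
Qed.

Lemma convex_tube (x y : C) (d : R) : convex (tube x y d).
Proof.
  intros u v s [t [Ht Hu]] [t' [Ht' Hv]] Hs. exists (t + s * (t' - t)). split; [nra|].
  replace (seg x y (t + s * (t' - t))) with (seg (seg x y t) (seg x y t') s).
  2: { unfold seg. rewrite RtoC_plus, RtoC_mult, RtoC_minus. ring. }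
  unfold Cdisc in *. eapply Rle_lt_trans; [now apply seg_dist|].
  destruct (Rle_dec (1 / 2) s); nra.
Qed.

Lemma tube_incl (x y y' : C) (d d' : R) (u : C) :
  Cmod (y' - y) + d' <= d -> tube x y' d' u -> tube x y d u.
Proof.
  intros Hd [t [Ht Hu]]. exists t. split; [exact Ht|]. revert Hu. apply Cdisc_incl.
  assert (K := seg_dist x y' x y t Ht). rewrite Cmod_minus_diag in K.
  assert (Q := Cmod_ge_0 (y' - y)). nra.
Qed.

Lemma seg_seg (x y : C) (s t : R) : seg x (seg x y s) t = seg x y (t * s).
Proof. unfold seg. rewrite RtoC_mult. ring. Qed.

Lemma tube_cover (x y : C) (s d : R) (u : C) : 0 <= s <= 1 -> tube x y d u ->
  tube x (seg x y s) d u \/ Cdisc y (Cmod (seg x y s - y) + d) u.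
Proof.
  intros Hs [t [Ht Hu]]. destruct (Rle_dec t s) as [Hle|Hgt].
  - left. destruct (Req_dec s 0) as [Es|Es].
    + exists 0. split; [lra|]. rewrite seg_0. replace t with 0 in Hu by lra.
      now rewrite seg_0 in Hu.
    + exists (t / s). split; [split; [apply Rdiv_le_0_compat|apply Rle_div_l]; lra|].
      rewrite seg_seg. now replace (t / s * s) with t by (field; auto).
  - right. revert Hu. apply Cdisc_incl. apply Rplus_le_compat_r.
    rewrite <- (seg_1 x y) at 2 4. rewrite !seg_dist_param.
    apply Rmult_le_compat_r; [apply Cmod_ge_0|].
    rewrite !Rabs_left1; lra.
Qed.

Lemma seg_to_end (x y : C) (e : R) : 0 < e ->
  exists s0, 0 <= s0 < 1 /\ forall s, s0 < s <= 1 -> Cdisc y e (seg x y s).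
Proof.
  intros He. assert (Q := Cmod_ge_0 (y - x)). set (L := Cmod (y - x) + 1).
  assert (HeL : 0 < e / L) by (apply Rdiv_lt_0_compat; unfold L; lra).
  exists (Rmax 0 (1 - e / L)). split; [split; [apply Rmax_l|apply Rmax_lub_lt; lra]|].
  intros s Hs. assert (B := Rmax_r 0 (1 - e / L)). unfold Cdisc. rewrite <- (seg_1 x y) at 2.
  rewrite seg_dist_param, Rabs_left1 by lra.
  apply Rle_lt_trans with (- (s - 1) * L); [apply Rmult_le_compat_l; unfold L; lra|].
  apply Rlt_div_r; unfold L in *; lra.
Qed.

Section Lifting.
Variables (P P' E : C -> C) (U : C -> Prop).
Hypothesis HP : C1_entire P P'.
Hypothesis Uopen : open U.
Hypothesis HE : forall u, U u -> continuous E u.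
Hypothesis Hcrit : forall u z, U u -> P z = E u -> P' z <> RtoC 0.

Definition is_lift (V : C -> Prop) (psi : C -> C) : Prop :=
  forall u, V u -> continuous psi u /\ P (psi u) = E u.

Lemma is_lift_incl (V W : C -> Prop) (psi : C -> C) :
  (forall u, W u -> V u) -> is_lift V psi -> is_lift W psi.
Proof. intros Hi H u Hu. apply H, Hi, Hu. Qed.

Lemma lift_unique (V : C -> Prop) (psi1 psi2 : C -> C) (x y : C) : convex V ->
  (forall u, V u -> U u) -> is_lift V psi1 -> is_lift V psi2 -> V x -> V y ->
  psi1 x = psi2 x -> psi1 y = psi2 y.
Proof.
  intros HV HVU L1 L2 Hx Hy Exy. rewrite <- (seg_1 x y).
  apply (curve_lift_unique P P' (fun t => psi1 (seg x y t)) (fun t => psi2 (seg x y t)) HP).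
  - intros t Ht. split; (apply (continuous_comp (seg x y)); [apply continuous_seg|]);
      [apply L1|apply L2]; now apply HV.
  - intros t Ht. destruct (L1 (seg x y t)) as [_ ->]; [now apply HV|].
    symmetry. apply L2. now apply HV.
  - intros t Ht. apply (Hcrit (seg x y t)); [|apply L1]; auto.
  - now rewrite !seg_0.
  - lra.
Qed.

Lemma lift_glue (V W : C -> Prop) (psi1 psi2 : C -> C) : open V -> open W ->
  is_lift V psi1 -> is_lift W psi2 -> (forall u, V u -> W u -> psi1 u = psi2 u) ->
  exists psi, is_lift (fun u => V u \/ W u) psi /\ forall u, V u -> psi u = psi1 u.
Proof.
  intros HV HW L1 L2 Hagree.
  set (psi := fun u => if excluded_middle_informative (V u) then psi1 u else psi2 u).
  assert (E1 : forall u, V u -> psi u = psi1 u).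
  { intros u Hu. unfold psi. now destruct (excluded_middle_informative (V u)). }
  assert (E2 : forall u, W u -> psi u = psi2 u).
  { intros u Hu. unfold psi. destruct (excluded_middle_informative (V u)); auto. }
  exists psi. split; [|exact E1].
  assert (on : forall (D : C -> Prop) phi, open D -> is_lift D phi ->
    (forall u, D u -> psi u = phi u) ->
    is_lift D psi).
  { intros D phi HD L Eq u Hu. destruct (L u Hu) as [L1' L2']. split; [|now rewrite Eq].
    destruct (proj1 (locally_Cdisc _ _) (HD u Hu)) as [e [He K]].
    apply continuous_C_ext_loc with phi e; auto. intros w Hw. symmetry. auto. }
  intros u [Hu|Hu]; [now apply (on V psi1)|now apply (on W psi2)].
Qed.

Lemma local_section (p u : C) : U u -> P p = E u ->
  exists r d sigma, 0 < r /\ 0 < d /\ (forall v, Cdisc u d v -> U v) /\ is_lift (Cdisc u d) sigma /\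
    (forall v z, Cdisc u d v -> Cdisc p r z -> P z = E v -> sigma v = z).
Proof.
  intros Hu Hp.
  destruct (local_inverse P P' p HP (Hcrit u p Hu Hp)) as [r [a [e [Hr [Ha [He [Hinj Hsur]]]]]]].
  rewrite Hp in Hsur.
  destruct (proj1 (locally_Cdisc _ _) (Uopen u Hu)) as [d0 [Hd0 HU]].
  destruct (proj1 (continuous_C_eps _ _) (HE u Hu) e He) as [d1 [Hd1 HE1]].
  set (d := Rmin d0 d1). assert (Hd : 0 < d) by now apply Rmin_pos.
  assert (HdU : forall v, Cdisc u d v -> U v).
  { intros v Hv. apply HU. eapply Rlt_le_trans; [exact Hv|apply Rmin_l]. }
  set (sigma := fun v => epsilon (inhabits (RtoC 0)) (fun z => Cdisc p r z /\ P z = E v)).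
  assert (Hs : forall v, Cdisc u d v -> Cdisc p r (sigma v) /\ P (sigma v) = E v).
  { intros v Hv. unfold sigma. apply epsilon_spec, Hsur, HE1.
    eapply Rlt_le_trans; [exact Hv|apply Rmin_r]. }
  exists r, d, sigma. split; [exact Hr|]. split; [exact Hd|]. split; [exact HdU|]. split.
  - intros v Hv. split; [|now apply Hs].
    apply continuous_C_eps. intros eps Heps.
    destruct (proj1 (continuous_C_eps _ _) (HE v (HdU v Hv)) (a * eps)) as [d2 [Hd2 HE2]]; [nra|].
    exists (Rmin d2 (d - Cmod (v - u))).
    split; [unfold Cdisc in Hv; apply Rmin_pos; lra|]. intros w Hw.
    destruct (Rmin_Rgt_l _ _ _ Hw) as [W1 W2].
    assert (Hwu : Cdisc u d w) by (apply (Cdisc_incl u v d (d - Cmod (v - u))); [lra|exact W2]).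
    destruct (Hs v Hv) as [S1 S2]. destruct (Hs w Hwu) as [S3 S4].
    specialize (Hinj _ _ S3 S1). rewrite S2, S4 in Hinj. specialize (HE2 w W1).
    apply Rmult_lt_reg_l with a; lra.
  - intros v z Hv Hz HPz. destruct (Hs v Hv) as [S1 S2].
    specialize (Hinj _ _ S1 Hz). rewrite S2, HPz, Cmod_minus_diag in Hinj.
    apply Ceq_minus, Cmod_eq_0. assert (Q := Cmod_ge_0 (sigma v - z)). nra.
Qed.

Variables x0 z0 : C.
Hypothesis Hx0 : U x0.
Hypothesis Hz0 : P z0 = E x0.

Definition tube_lift (y : C) (d : R) (psi : C -> C) : Prop :=
  0 < d /\ (forall u, tube x0 y d u -> U u) /\ is_lift (tube x0 y d) psi /\ psi x0 = z0.

(* [z] is the value at [y] of the continuation along the segment [[x0, y]] of the germ at [x0] with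
   value [z0]. *)
Definition continuation (y z : C) : Prop := exists d psi, tube_lift y d psi /\ psi y = z.

Lemma continuation_start : continuation x0 z0.
Proof.
  destruct (local_section z0 x0 Hx0 Hz0) as [r [d [sigma [Hr [Hd [HU [HL Hs]]]]]]].
  assert (E0 : sigma x0 = z0) by (apply Hs; auto using Cdisc_center).
  assert (Ht : forall u, tube x0 x0 d u -> Cdisc x0 d u).
  { intros u [t [_ Hu]]. now rewrite seg_diag in Hu. }
  exists d, sigma. split; [|exact E0]. split; [exact Hd|]. split; [auto|]. split; [|exact E0].
  now apply is_lift_incl with (Cdisc x0 d).
Qed.

Lemma tube_lift_shrink (y y' : C) (d d' : R) (psi : C -> C) :
  tube_lift y d psi -> 0 < d' -> Cmod (y' - y) + d' <= d -> tube_lift y' d' psi.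
Proof.
  intros [_ [HU [HL H0]]] Hd' Hy.
  assert (Hi : forall u, tube x0 y' d' u -> tube x0 y d u) by (intros u; now apply tube_incl).
  split; [exact Hd'|]. split; [auto|]. split; [|exact H0].
  now apply is_lift_incl with (tube x0 y d).
Qed.

Lemma tube_lift_agree (y y' : C) (d d' : R) (psi psi' : C -> C) :
  tube_lift y d psi -> tube_lift y' d' psi' -> Cmod (y' - y) < d -> psi y' = psi' y'.
Proof.
  intros T T' Hy. set (e := Rmin d' (d - Cmod (y' - y))).
  assert (He : 0 < e) by (apply Rmin_pos; [apply T'|lra]).
  assert (E1 : e <= d') by apply Rmin_l. assert (E2 : e <= d - Cmod (y' - y)) by apply Rmin_r.
  destruct (tube_lift_shrink y y' d e psi T He ltac:(lra)) as [_ [HU [HL H0]]].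
  destruct (tube_lift_shrink y' y' d' e psi' T' He) as [_ [_ [HL' H0']]].
  { rewrite Cmod_minus_diag. lra. }
  apply (lift_unique (tube x0 y' e) psi psi' x0 y'); auto using convex_tube, tube_start, tube_end.
  congruence.
Qed.

Lemma continuation_unique (y z z' : C) : continuation y z -> continuation y z' -> z = z'.
Proof.
  intros [d [psi [T <-]]] [d' [psi' [T' <-]]]. apply (tube_lift_agree y y d d'); auto.
  rewrite Cmod_minus_diag. apply T.
Qed.

Lemma continuation_lift (y z : C) : continuation y z -> P z = E y.
Proof. intros [d [psi [[Hd [_ [HL _]]] <-]]]. now apply HL, tube_end. Qed.

Lemma continuation_near (y z : C) : continuation y z ->
  exists d psi, 0 < d /\ psi y = z /\ continuous psi y /\
    forall y', Cdisc y d y' -> continuation y' (psi y').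
Proof.
  intros [d [psi [T E0]]]. assert (HT := T). destruct HT as [Hd [_ [HL _]]].
  exists d, psi. split; [exact Hd|]. split; [exact E0|].
  split; [now apply HL, tube_end|]. intros y' Hy'. exists (d - Cmod (y' - y)), psi.
  split; [|reflexivity]. unfold Cdisc in Hy'. apply tube_lift_shrink with y d; [exact T|lra|lra].
Qed.

Lemma continuation_dist (y z : C) (e : R) : continuation y z -> 0 < e ->
  exists d, 0 < d /\ forall y' z', Cdisc y d y' -> continuation y' z' -> Cmod (z' - z) < e.
Proof.
  intros Hz He. destruct (continuation_near y z Hz) as [d [psi [Hd [E0 [Hc Hn]]]]].
  destruct (proj1 (continuous_C_eps _ _) Hc e He) as [d' [Hd' K]].
  exists (Rmin d d'). split; [now apply Rmin_pos|]. intros y' z' Hy' Hz'.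
  destruct (Rmin_Rgt_l _ _ _ Hy') as [Y1 Y2].
  rewrite (continuation_unique y' z' (psi y') Hz' (Hn y' Y1)), <- E0. now apply K.
Qed.

Lemma continuation_close (y p : C) : U y -> P p = E y ->
  exists r eta, 0 < r /\ 0 < eta /\ forall s z, 0 <= s <= 1 -> Cdisc y eta (seg x0 y s) ->
    Cdisc p r z -> continuation (seg x0 y s) z -> exists z', continuation y z'.
Proof.
  intros Hy Hp.
  destruct (local_section p y Hy Hp) as [r [eta [sigma [Hr [Heta [HUs [HLs Hs]]]]]]].
  exists r, eta. split; [exact Hr|]. split; [exact Heta|]. intros s z Hs01 Hnear Hz Hcont.
  assert (HPz := continuation_lift _ _ Hcont). destruct Hcont as [d [psi [[Hd [HU [HL H0]]] Epsi]]].
  set (xs := seg x0 y s) in *.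
  destruct (lift_glue (tube x0 xs d) (Cdisc y eta) psi sigma) as [phi [HLphi Ephi]];
    [apply open_tube|apply open_Cdisc|exact HL|exact HLs| |].
  { intros u Hu1 Hu2.
    apply (lift_unique (fun v => tube x0 xs d v /\ Cdisc y eta v) psi sigma xs u).
    - intros v w t [Hv1 Hv2] [Hw1 Hw2] Ht. split; [now apply convex_tube|now apply convex_Cdisc].
    - intros v [Hv _]. auto.
    - apply is_lift_incl with (tube x0 xs d); [tauto|exact HL].
    - apply is_lift_incl with (Cdisc y eta); [tauto|exact HLs].
    - split; [now apply tube_end|exact Hnear].
    - now split.
    - symmetry. rewrite Epsi. now apply Hs. }
  set (d' := Rmin d (eta - Cmod (xs - y))).
  assert (Hd' : 0 < d') by (unfold Cdisc in Hnear; apply Rmin_pos; lra).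
  assert (D1 : d' <= d) by apply Rmin_l. assert (D2 : d' <= eta - Cmod (xs - y)) by apply Rmin_r.
  assert (Cover : forall u, tube x0 y d' u -> tube x0 xs d u \/ Cdisc y eta u).
  { intros u Hu. destruct (tube_cover x0 y s d' u Hs01 Hu) as [K|K]; fold xs in K.
    - left. apply (tube_incl x0 xs xs d d'); [rewrite Cmod_minus_diag; lra|exact K].
    - right. unfold Cdisc in *. lra. }
  exists (phi y), d', phi. split; [|reflexivity]. split; [exact Hd'|]. split; [|split].
  - intros u Hu. destruct (Cover u Hu); auto.
  - now apply is_lift_incl with (fun u => tube x0 xs d u \/ Cdisc y eta u).
  - rewrite Ephi; [exact H0|now apply tube_start].
Qed.

Hypothesis Uconv : convex U.
Hypothesis Hasym : forall u, U u -> ~ asymptotic_value P (E u).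

Lemma continuation_path_continuous (y : C) (c : R -> C) :
  (forall s, 0 <= s < 1 -> continuation (seg x0 y s) (c s)) ->
  forall s e, 0 <= s < 1 -> 0 < e -> exists d, 0 < d /\
    forall s', 0 <= s' < 1 -> Rabs (s' - s) < d -> Cmod (c s' - c s) < e.
Proof.
  intros Hc s e Hs He. destruct (continuation_dist _ _ e (Hc s Hs) He) as [d [Hd K]].
  assert (Q := Cmod_ge_0 (y - x0)). exists (d / (Cmod (y - x0) + 1)).
  split; [apply Rdiv_lt_0_compat; lra|]. intros s' Hs' Hss. apply Rlt_div_r in Hss; [|lra].
  apply (K (seg x0 y s')); [|now apply Hc]. unfold Cdisc. rewrite seg_dist_param.
  assert (Q' := Rabs_pos (s' - s)). nra.
Qed.

Lemma continuation_end (y : C) : U y ->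
  (forall s, 0 <= s < 1 -> exists z, continuation (seg x0 y s) z) -> exists z, continuation y z.
Proof.
  intros Hy Hex.
  set (c := fun s => epsilon (inhabits (RtoC 0)) (continuation (seg x0 y s))).
  assert (Hc : forall s, 0 <= s < 1 -> continuation (seg x0 y s) (c s)).
  { intros s Hs. apply epsilon_spec. auto. }
  assert (Hlim : forall e, 0 < e -> exists s0, s0 < 1 /\
    forall s, s0 < s < 1 -> Cmod (P (c s) - E y) < e).
  { intros e He. destruct (proj1 (continuous_C_eps _ _) (HE y Hy) e He) as [d [Hd K]].
    destruct (seg_to_end x0 y d Hd) as [s0 [Hs0 Ks]]. exists s0. split; [lra|].
    intros s Hs. rewrite (continuation_lift _ _ (Hc s ltac:(lra))). apply K, Ks. lra. }
  destruct (classic (exists M, forall s, s < 1 -> exists s', s < s' < 1 /\ Cmod (c s') <= M))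
    as [[M HM]|Hinf].
  - destruct (bounded_accumulation c 1 M HM) as [p Hp].
    assert (EPp := accumulation_point_value P c p (E y) 1 (C1_entire_continuous P P' p HP) Hp Hlim).
    destruct (continuation_close y p Hy EPp) as [r [eta [Hr [Heta Hclose]]]].
    destruct (seg_to_end x0 y eta Heta) as [s0 [Hs0 Ks]].
    destruct (Hp r s0 Hr) as [s [Hs Hsp]]; [lra|].
    apply (Hclose s (c s)); [lra|apply Ks; lra|exact Hsp|apply Hc; lra].
  - exfalso. apply (Hasym y Hy), (asymptotic_value_of_path P c); [| |exact Hlim].
    + intros s Hs e. now apply (continuation_path_continuous y c Hc).
    + intros M. apply NNPP. intros HM. apply Hinf. exists M. intros s Hs.
      apply NNPP. intros Hno. apply HM. exists s. split; [exact Hs|]. intros s' Hs'.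
      apply Rnot_le_lt. intros Hle. apply Hno. now exists s'.
Qed.

Lemma continuation_exists (y : C) : U y -> exists z, continuation y z.
Proof.
  intros Hy. rewrite <- (seg_1 x0 y).
  apply (real_induction (fun t => exists z, continuation (seg x0 y t) z)); [| | |lra].
  - rewrite seg_0. exists z0. apply continuation_start.
  - intros t Ht [z Hz]. destruct (continuation_near _ _ Hz) as [d [psi [Hd [_ [_ Hn]]]]].
    assert (Q := Cmod_ge_0 (y - x0)). exists (d / (Cmod (y - x0) + 1)).
    split; [apply Rdiv_lt_0_compat; lra|]. intros s Hs _. exists (psi (seg x0 y s)).
    apply Hn. unfold Cdisc. rewrite seg_dist_param, Rabs_pos_eq by lra.
    assert (Hst : s - t < d / (Cmod (y - x0) + 1)) by lra. apply Rlt_div_r in Hst; nra.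
  - intros t Ht IH. apply continuation_end; [apply Uconv; auto; lra|].
    intros s Hs. rewrite seg_seg. apply IH. nra.
Qed.

Lemma lift_exists : exists psi, psi x0 = z0 /\ is_lift U psi.
Proof.
  set (psi := fun y => epsilon (inhabits (RtoC 0)) (continuation y)).
  assert (Hpsi : forall y, U y -> continuation y (psi y)).
  { intros y Hy. apply epsilon_spec, continuation_exists, Hy. }
  exists psi. split.
  - apply (continuation_unique x0); [now apply Hpsi|apply continuation_start].
  - intros y Hy. split; [|now apply continuation_lift, Hpsi].
    apply continuous_C_eps. intros e He.
    destruct (continuation_dist _ _ e (Hpsi y Hy) He) as [d [Hd K]].
    destruct (proj1 (locally_Cdisc _ _) (Uopen y Hy)) as [d' [Hd' HU]].
    exists (Rmin d d'). split; [now apply Rmin_pos|]. intros w Hw.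
    destruct (Rmin_Rgt_l _ _ _ Hw) as [W1 W2]. apply (K w); [exact W1|now apply Hpsi, HU].
Qed.
End Lifting.

(** * Bloch's theorem *)

(* If no point near [w] dominated [g] up to a factor two on its own disc, a geometric chain of
   counterexamples would converge to a point where [g] is discontinuous. *)
Lemma doubling_point (g : C -> R) (w : C) (d : R) : 0 < d -> 0 < g w ->
  (forall z, Cmod (z - w) <= 2 * d -> continuous g z) ->
  exists a r, 0 < r /\ Cmod (a - w) + 2 * r <= 2 * d /\ d * g w <= r * g a /\
    forall z, Cdisc a r z -> g z <= 2 * g a.
Proof.
  intros Hd Hg Hc. apply NNPP. intros Hno.
  assert (Hhalf : forall n, 0 < (1 / 2) ^ n) by (intros; apply pow_lt; lra).
  destruct (dependent_choice
    (fun n a => Cmod (a - w) <= 2 * d - 2 * d * (1 / 2) ^ n /\ 2 ^ n * g w <= g a)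
    (fun n a b => Cmod (b - a) <= d * (1 / 2) ^ n) w) as [s [_ Hs]].
  - simpl. rewrite Cmod_minus_diag. lra.
  - intros n a [H1 H2]. apply NNPP. intros Hb. apply Hno. specialize (Hhalf n).
    exists a, (d * (1 / 2) ^ n). split; [nra|]. split; [lra|]. split.
    + assert (E : (1 / 2) ^ n * 2 ^ n = 1).
      { rewrite <- Rpow_mult_distr. replace (1 / 2 * 2) with 1 by field. apply pow1. }
      replace (d * g w) with (d * (1 / 2) ^ n * (2 ^ n * g w))
        by (transitivity (d * g w * ((1 / 2) ^ n * 2 ^ n)); [ring|rewrite E; ring]).
      apply Rmult_le_compat_l; nra.
    + intros z Hz. apply Rnot_lt_le. intros Hlt. apply Hb. exists z. unfold Cdisc in Hz.
      assert (T := Cmod_dist_triangle z a w). simpl pow. repeat split; lra.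
  - destruct (geometric_limit s d (1 / 2)) as [p Hp]; [lra|intros n; apply Hs|].
    assert (Hpw : Cmod (p - w) <= 2 * d).
    { apply (geometric_limit_in_disc s p w d (1 / 2)); [lra|exact Hp|]. intros n.
      specialize (Hhalf n). destruct (Hs n) as [[K _] _]. nra. }
    assert (Hnear := proj1 (filterlim_locally _ _) (Hc p Hpw) (mkposreal 1 Rlt_0_1)).
    apply locally_Cdisc in Hnear. destruct Hnear as [e [He Hnear]].
    destruct (pow_small (2 * d) (1 / 2) e) as [N1 HN1]; [lra|exact He|].
    destruct (Pow_x_infinity 2 ltac:(rewrite Rabs_pos_eq; lra) ((g p + 2) / g w)) as [N2 HN2].
    set (n := (N1 + N2)%nat).
    specialize (HN1 n ltac:(unfold n; lia)). specialize (HN2 n ltac:(unfold n; lia)).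
    assert (Hb : Rabs (g (s n) - g p) < 1).
    { apply Hnear. unfold Cdisc. specialize (Hp n). lra. }
    apply Rabs_lt_between in Hb. destruct (Hs n) as [[_ H2] _].
    rewrite Rabs_pos_eq in HN2 by (apply pow_le; lra).
    apply Rge_le, Rle_div_l in HN2; lra.
Qed.

Lemma bloch (f f' : C -> C) (w : C) (d : R) : 0 < d -> C1_on (Cdisc w d) f f' ->
  exists b, forall v, Cdisc b (d * Cmod (f' w) / 64) v -> exists z, Cdisc w d z /\ f z = v.
Proof.
  intros Hd Hf. assert (Hw := Cmod_ge_0 (f' w)).
  destruct (Req_dec (Cmod (f' w)) 0) as [E0|E0].
  { exists (RtoC 0). intros v Hv. unfold Cdisc in Hv. rewrite E0 in Hv.
    assert (Q := Cmod_ge_0 (v - 0)). lra. }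
  destruct (doubling_point (fun z => Cmod (f' z)) w (d / 4)) as [a [r [Hr [Har [Hra Hdom]]]]].
  { lra. }
  { lra. }
  { intros z Hz. apply (continuous_Cmod f'). apply Hf. unfold Cdisc. lra. }
  cbv beta in Hra, Hdom. set (A := Cmod (f' a)) in *.
  assert (HA : 0 < A) by nra.
  assert (Hin : forall z, Cdisc a r z -> Cdisc w d z).
  { intros z. apply Cdisc_incl. lra. }
  assert (Hsmall : forall z, Cdisc a (r / 8) z -> Cdisc a r z).
  { intros z. apply Cdisc_incl. rewrite Cmod_minus_diag. lra. }
  exists (f a). intros v Hv.
  destruct (nearly_affine_surjective f f' a (f' a) (r / 8)) with (w := v) as [z [Hz Ez]].
  - now apply Cmod_gt_0.
  - intros z Hz. apply Hf, Hin, Hsmall, Hz.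
  - intros z Hz. unfold Cdisc in Hz.
    eapply Rle_trans; [apply (derive_lipschitz f f' a z r (r / 2) (2 * A))|].
    + lra.
    + lra.
    + now apply C1_on_incl with (Cdisc w d).
    + exact Hdom.
    + fold A. replace (2 * A / (r / 2) * Cmod (z - a)) with (4 * A * Cmod (z - a) / r)
        by (field; lra).
      apply Rle_div_l; [lra|]. nra.
  - unfold Cdisc in Hv. fold A. nra.
  - exists z. split; [now apply Hin, Hsmall|exact Ez].
Qed.

(** * The exponential has no nonzero finite asymptotic value *)

Lemma cos_pos_variation (y : R -> R) (a b : R) : a <= b -> (forall t, continuous y t) ->
  (forall t, a <= t <= b -> 0 < cos (y t)) -> Rabs (y b - y a) < 2 * PI.
Proof.
  intros Hab Hy Hcos. apply Rnot_le_lt. intros Hbig. assert (HP := PI_RGT_0).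
  (* An interval of length [2 pi] contains an odd multiple of [pi]. *)
  assert (Hodd : exists k : Z, Rmin (y a) (y b) <= PI + 2 * PI * IZR k <= Rmax (y a) (y b)).
  { set (m := Rmin (y a) (y b)).
    assert (Hlen : m + 2 * PI <= Rmax (y a) (y b)).
    { unfold m, Rmin, Rmax. unfold Rabs in Hbig.
      destruct (Rle_dec (y a) (y b)), (Rcase_abs (y b - y a)); lra. }
    destruct (archimed ((m - PI) / (2 * PI))) as [A1 A2].
    exists (up ((m - PI) / (2 * PI))). set (k := IZR (up ((m - PI) / (2 * PI)))) in *.
    assert (Em : m = PI + 2 * PI * ((m - PI) / (2 * PI))) by (field; lra).
    split; nra. }
  destruct Hodd as [k Hk].
  destruct (IVT_gen y a b (PI + 2 * PI * IZR k)) as [x [Hx Ex]]; [|exact Hk|].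
  { intros t. apply continuity_pt_filterlim, Hy. }
  rewrite Rmin_left, Rmax_right in Hx by lra. specialize (Hcos x Hx).
  assert (Ecos := f_equal fst (cis_period PI k)). simpl in Ecos.
  rewrite Ex, Ecos, cos_PI in Hcos. lra.
Qed.

Lemma cexp_near_1 (z : C) : Cmod (cexp z - 1) < 1 / 2 -> 0 < cos (Im z) /\ Rabs (Re z) <= 1.
Proof.
  intros Hz. assert (Hexp := exp_pos (Re z)). assert (B := exp_ineq1_le 1). split.
  - assert (K := Re_dist_le (cexp z) 1). unfold cexp in K at 1. rewrite re_scal_l, re_RtoC in K.
    change (Re (cis (Im z))) with (cos (Im z)) in K.
    assert (K' : Rabs (exp (Re z) * cos (Im z) - 1) < 1 / 2) by lra.
    apply Rabs_lt_between in K'. nra.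
  - assert (K1 := Cmod_minus_ge (cexp z) 1). assert (K2 := Cmod_minus_ge 1 (cexp z)).
    rewrite (Cmod_minus_sym 1) in K2. rewrite Cmod_1, Cmod_cexp in K1, K2. apply Rabs_le. split.
    + apply Rnot_lt_le. intros Hlt. apply exp_increasing in Hlt. rewrite exp_Ropp in Hlt.
      assert (/ exp 1 <= / (1 + 1)) by (apply Rinv_le_contravar; lra). lra.
    + apply Rnot_lt_le. intros Hlt. apply exp_increasing in Hlt. lra.
Qed.

Lemma Rmax_dist_le (a b T : R) : Rabs (Rmax a T - Rmax b T) <= Rabs (a - b).
Proof.
  unfold Rmax. destruct (Rle_dec a T), (Rle_dec b T);
    unfold Rabs; repeat destruct (Rcase_abs _); lra.
Qed.

Lemma cexp_no_asymptotic_value (w : C) : w <> RtoC 0 -> ~ asymptotic_value cexp w.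
Proof.
  intros Hw [gam [Hc [Hinf Hlim]]]. destruct (clog_exists w Hw) as [s Es].
  apply Cmod_gt_0 in Hw.
  destruct (Hlim (Cmod w / 2) ltac:(lra)) as [T1 HT1]. set (T := Rmax T1 0).
  assert (HT0 : 0 <= T) by apply Rmax_r. assert (HTT : T1 <= T) by apply Rmax_l.
  assert (Hnear : forall t, T <= t -> 0 < cos (Im (gam t - s)) /\ Rabs (Re (gam t - s)) <= 1).
  { intros t Ht. apply cexp_near_1. specialize (HT1 t ltac:(lra)). rewrite Cnorm_Csub in HT1.
    replace (cexp (gam t) - w)%C with (w * (cexp (gam t - s) - 1))%C in HT1.
    - rewrite Cmod_mult in HT1. nra.
    - rewrite <- Es, cexp_minus. field. apply cexp_neq_0. }
  set (y := fun t => Im (gam (Rmax t T) - s)).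
  assert (Hy : forall t, continuous y t).
  { intros t. apply (continuous_Im (fun t => (gam (Rmax t T) - s)%C)).
    apply continuous_Cminus; [|apply continuous_const].
    assert (HTm : forall u, 0 <= Rmax u T).
    { intros u. eapply Rle_trans; [exact HT0|apply Rmax_r]. }
    apply (continuous_curve_eps (fun t => gam (Rmax t T))). intros e He.
    destruct (Hc (Rmax t T) (HTm t) e He) as [d [Hd K]]. exists d. split; [exact Hd|].
    intros u Hu. rewrite <- Cnorm_Csub. apply K; [apply HTm|].
    eapply Rle_lt_trans; [apply Rmax_dist_le|exact Hu]. }
  destruct (Hinf (1 + Cmod s + Rabs (y T) + 2 * PI)) as [T2 HT2]. set (t := Rmax T2 T).
  assert (Ht : T <= t) by apply Rmax_r. assert (Ht2 : T2 <= t) by apply Rmax_l.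
  specialize (HT2 t ltac:(lra)). rewrite Cnorm_Cmod in HT2.
  assert (Hvar : Rabs (y t - y T) < 2 * PI).
  { apply cos_pos_variation; [exact Ht|exact Hy|]. intros u Hu. unfold y.
    rewrite Rmax_left by lra. apply Hnear. lra. }
  assert (K1 := proj2 (Hnear t Ht)). assert (K2 := Cmod_le_Re_Im (gam t - s)).
  assert (K3 := Cmod_minus_ge (gam t) s). assert (K4 := Rabs_triang_inv (y t) (y T)).
  unfold y at 1 in K4. rewrite Rmax_left in K4 by lra. lra.
Qed.

(** * Logarithmic coordinates over a half-plane without singular values *)

Lemma log_derivative_variation (u du : R -> R) (s t : R) :
  (forall v, 0 < u v /\ is_derive u v (du v) /\ Rabs (du v) <= u v) ->
  u s <= exp (Rabs (s - t)) * u t.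
Proof.
  intros Hu. destruct (Hu s) as [Ps _]. destruct (Hu t) as [Pt _].
  assert (K : Rabs (ln (u s) - ln (u t)) <= 1 * Rabs (s - t)).
  { apply (bounded_variation (fun v => ln (u v)) (fun v => du v / u v)). intros v _.
    destruct (Hu v) as [Pv [Dv Bv]]. split.
    - apply (is_derive_comp (V := R_NormedModule) ln u); [|exact Dv].
      now apply is_derive_Reals, derivable_pt_lim_ln.
    - unfold Rdiv. rewrite Rabs_mult, Rabs_inv, (Rabs_pos_eq (u v)) by lra.
      apply Rle_div_l; lra. }
  assert (Hln : ln (u s) <= Rabs (s - t) + ln (u t))
    by (assert (Q := Rle_abs (ln (u s) - ln (u t))); lra).
  rewrite <- (exp_ln (u s)), <- (exp_ln (u t)), <- exp_plus by assumption.
  now apply exp_le.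
Qed.

Lemma bounded_on_unit (g : R -> C) : (forall t, continuous g t) ->
  exists K, 0 <= K /\ forall t, 0 <= t <= 1 -> Cmod (g t) <= K.
Proof.
  intros Hg. destruct (continuity_ab_maj (fun t => Cmod (g t)) 0 1) as [t0 [H0 _]]; [lra| |].
  - intros t _. apply continuity_pt_filterlim. now apply (continuous_Cmod g).
  - exists (Cmod (g t0)). split; [apply Cmod_ge_0|exact H0].
Qed.

Definition halfplane (ell : R) (u : C) : Prop := ell < Re u.

Lemma halfplane_Cdisc (ell : R) (u v : C) : Cdisc u (Re u - ell) v -> halfplane ell v.
Proof.
  unfold halfplane, Cdisc. intros Hv. assert (K := Re_dist_le v u).
  assert (K' : Rabs (Re v - Re u) < Re u - ell) by lra. apply Rabs_lt_between in K'. lra.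
Qed.

Lemma open_halfplane (ell : R) : open (halfplane ell).
Proof.
  intros u Hu. apply locally_Cdisc. exists (Re u - ell).
  split; [unfold halfplane in Hu; lra|]. apply halfplane_Cdisc.
Qed.

Lemma convex_halfplane (ell : R) : convex (halfplane ell).
Proof.
  unfold halfplane. intros u v s Hu Hv Hs. rewrite Re_seg. destruct (Rle_dec (1 / 2) s); nra.
Qed.

(* The bound on [f 0] keeps inverse branches over [|w| > exp ell] away from 0, where they have no
   logarithm. *)
Definition unramified_beyond (f f' : C -> C) (ell : R) : Prop :=
  (forall z, exp ell < Cmod (f z) -> f' z <> RtoC 0) /\
  (forall w, exp ell < Cmod w -> ~ asymptotic_value f w) /\
  Cmod (f 0) < exp ell.

Definition log_branch (f : C -> C) (ell : R) (Phi Phi' : C -> C) : Prop :=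
  C1_on (halfplane ell) Phi Phi' /\ forall u, halfplane ell u -> f (cexp (Phi u)) = cexp u.

Lemma is_lift_C1_on (P P' E E' psi : C -> C) (U : C -> Prop) : C1_entire P P' -> open U ->
  C1_on U E E' -> (forall u z, U u -> P z = E u -> P' z <> RtoC 0) -> is_lift P E U psi ->
  C1_on U psi (fun u => (E' u / P' (psi u))%C).
Proof.
  intros HP HU HE Hcrit HL u Hu. destruct (HL u Hu) as [Cpsi Epsi]. destruct (HE u Hu) as [DE CE].
  destruct (HP (psi u) I) as [DP CP]. assert (Hn := Hcrit u (psi u) Hu Epsi). split.
  - destruct (proj1 (locally_Cdisc _ _) (HU u Hu)) as [e [He K]].
    apply (is_C_derive_lift P E psi u (P' (psi u)) (E' u) e He); auto.
    intros w Hw. apply HL, K, Hw.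
  - apply continuous_Cdiv; [exact CE|now apply (continuous_comp psi P')|exact Hn].
Qed.

Section LogCoordinates.
Variables (f f' : C -> C) (ell : R).
Hypothesis Hf : C1_entire f f'.
Hypothesis Hell : unramified_beyond f f' ell.

Let H := halfplane ell.

Lemma exp_lt_Cmod_cexp (u : C) : H u -> exp ell < Cmod (cexp u).
Proof. intros Hu. rewrite Cmod_cexp. now apply exp_increasing. Qed.

Lemma unramified_over_cexp (u z : C) : H u -> f z = cexp u -> f' z <> RtoC 0.
Proof. intros Hu E. apply Hell. rewrite E. now apply exp_lt_Cmod_cexp. Qed.

Let cexp_unramified (E : C -> C) (u z : C) : H u -> cexp z = E u -> cexp z <> RtoC 0 :=
  fun _ _ => cexp_neq_0 z.

Lemma log_branch_exists (om s0 : C) : H om -> f (cexp s0) = cexp om ->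
  exists Phi Phi', Phi om = s0 /\ log_branch f ell Phi Phi'.
Proof.
  intros Hom E0. assert (Hcexp : C1_entire cexp cexp) by apply C1_on_cexp.
  assert (Hcont : forall u, H u -> continuous cexp u).
  { intros u _. apply continuous_cexp, continuous_id. }
  destruct (lift_exists f f' cexp H Hf (open_halfplane ell) Hcont unramified_over_cexp
    om (cexp s0) Hom E0 (convex_halfplane ell)) as [psi [Epsi Hpsi]].
  { intros u Hu. apply Hell. now apply exp_lt_Cmod_cexp. }
  assert (Hnz : forall u, H u -> psi u <> RtoC 0).
  { intros u Hu E. assert (K := exp_lt_Cmod_cexp u Hu). destruct (Hpsi u Hu) as [_ Eu].
    rewrite <- Eu, E in K. destruct Hell as [_ [_ Hf0]]. lra. }
  assert (HC1 : C1_on H psi (fun u => (cexp u / f' (psi u))%C)).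
  { exact (is_lift_C1_on f f' cexp cexp psi H Hf (open_halfplane ell) (C1_on_cexp H)
      unramified_over_cexp Hpsi). }
  destruct (lift_exists cexp cexp psi H Hcexp (open_halfplane ell) (fun u Hu => proj1 (Hpsi u Hu))
    (cexp_unramified psi) om s0 Hom (eq_sym Epsi) (convex_halfplane ell)) as [Phi [EPhi HPhi]].
  { intros u Hu. now apply cexp_no_asymptotic_value, Hnz. }
  exists Phi. eexists. split; [exact EPhi|]. split.
  - apply (is_lift_C1_on cexp cexp psi _ Phi H Hcexp (open_halfplane ell) HC1
      (cexp_unramified psi) HPhi).
  - intros u Hu. destruct (HPhi u Hu) as [_ ->]. now apply Hpsi.
Qed.

Section Branch.
Variables Phi Phi' : C -> C.
Hypothesis HPhi : log_branch f ell Phi Phi'.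

Lemma log_branch_continuous (u : C) : H u -> continuous Phi u.
Proof. intros Hu. now apply (C1_on_continuous _ _ _ _ (proj1 HPhi)). Qed.

Lemma log_branch_Re_lower : exists c, forall u, H u -> c <= Re (Phi u).
Proof.
  destruct Hell as [_ [_ Hf0]].
  destruct (proj1 (continuous_C_eps _ _) (C1_entire_continuous f f' 0 Hf) (exp ell - Cmod (f 0)))
    as [d [Hd K]]; [lra|].
  exists (ln d). intros u Hu. apply Rnot_lt_le. intros Hlt.
  assert (Hs : Cdisc 0 d (cexp (Phi u))).
  { unfold Cdisc. replace (cexp (Phi u) - 0)%C with (cexp (Phi u)) by ring.
    rewrite Cmod_cexp, <- (exp_ln d) by exact Hd. now apply exp_increasing. }
  specialize (K _ Hs). rewrite (proj2 HPhi u Hu) in K.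
  assert (K2 := exp_lt_Cmod_cexp u Hu). assert (K3 := Cmod_minus_ge (cexp u) (f 0)). lra.
Qed.

Lemma log_branch_derive_le_Re (c : R) (z : C) : (forall u, H u -> c <= Re (Phi u)) -> H z ->
  Cmod (Phi' z) <= 4 / (Re z - ell) * (Re (Phi z) - c).
Proof.
  intros Hc Hz. assert (Hd : 0 < Re z - ell) by (unfold H, halfplane in Hz; lra).
  replace (4 / (Re z - ell)) with (2 / ((Re z - ell) / 2)) by (field; lra).
  replace (Re (Phi z) - c) with (Re (Phi z - RtoC c)) by now rewrite Re_minus, re_RtoC.
  apply (Cmod_derive_le_of_Re_nonneg (fun w => (Phi w - RtoC c)%C)).
  - split; [lra|]. exists (Re z - ell). split; [lra|]. intros w Hw.
    apply halfplane_Cdisc in Hw. destruct (proj1 HPhi w Hw) as [D1 D2].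
    split; [now apply is_C_derive_minus_const|exact D2].
  - intros w Hw. rewrite Re_minus, re_RtoC.
    assert (Hw' : H w) by (apply (halfplane_Cdisc ell z); unfold Cdisc; lra).
    specialize (Hc w Hw'). lra.
Qed.

Section PeriodicBranch.
Variable k : Z.
Hypothesis Hper : forall u, H u -> Phi (u + period k)%C = (Phi u + period 1)%C.

Let line (x : R) : R -> C := seg (RtoC x) (RtoC x + period k)%C.

Lemma Re_line (x t : R) : Re (line x t) = x.
Proof. unfold line. rewrite Re_seg, Re_plus_period, re_RtoC. ring. Qed.

Lemma line_in_halfplane (x t : R) : ell < x -> H (line x t).
Proof. intros Hx. unfold H, halfplane. now rewrite Re_line. Qed.

Lemma branch_line_end (x : R) : ell < x -> Phi (line x 1) = (Phi (line x 0) + period 1)%C.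
Proof.
  intros Hx. assert (H0 := line_in_halfplane x 0 Hx). unfold line in *. rewrite seg_0 in *.
  rewrite seg_1. now apply Hper.
Qed.

Lemma is_curve_derive_branch_line (x t : R) : ell < x ->
  is_curve_derive (fun t => Phi (line x t)) t (Phi' (line x t) * period k)%C.
Proof.
  intros Hx. eapply is_curve_derive_eq.
  - apply (is_curve_derive_comp Phi (line x)); [|apply is_curve_derive_seg].
    apply (proj1 HPhi), (line_in_halfplane x t Hx).
  - ring.
Qed.

Lemma continuous_branch_line (x t : R) : ell < x -> continuous (fun t => Phi (line x t)) t.
Proof. intros Hx. eapply is_curve_derive_continuous. now apply is_curve_derive_branch_line. Qed.

(* [contour x s] is [zeta^s d zeta / zeta] along the loop [zeta = cexp (Phi (line x t))]. *)
Definition contour (x s t : R) : C :=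
  (cexp (RtoC s * Phi (line x t)) * (Phi' (line x t) * period k))%C.

Lemma continuous_contour (x s t : R) : ell < x -> continuous (contour x s) t.
Proof.
  intros Hx. assert (K := continuous_branch_line x t Hx).
  apply continuous_Cmult; [auto with cont|]. apply continuous_Cmult; [|apply continuous_const].
  apply (continuous_comp (line x) Phi'); [apply continuous_seg|].
  now apply (proj1 HPhi), line_in_halfplane.
Qed.

Lemma contour_plus (x s s' t : R) :
  contour x (s + s') t = (cexp (RtoC s' * Phi (line x t)) * contour x s t)%C.
Proof.
  unfold contour. rewrite RtoC_plus, Cmult_plus_distr_r, cexp_plus. ring.
Qed.

Lemma contour_integral (x : R) (m : Z) : ell < x ->
  CRInt (contour x (IZR m)) 0 1 = (if Z.eq_dec m 0 then period 1 else RtoC 0) :> C.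
Proof.
  intros Hx. assert (Hend := branch_line_end x Hx). destruct (Z.eq_dec m 0) as [->|Hm].
  - rewrite (CRInt_derive (fun t => Phi (line x t))).
    + rewrite Hend. ring.
    + intros t. eapply is_curve_derive_eq; [now apply is_curve_derive_branch_line|].
      unfold contour. rewrite Cmult_0_l, cexp_0. ring.
    + intros t. now apply continuous_contour.
  - assert (Hm0 : RtoC (IZR m) <> RtoC 0) by now apply RtoC_neq_0, not_0_IZR.
    rewrite (CRInt_derive (fun t => (/ RtoC (IZR m) * cexp (RtoC (IZR m) * Phi (line x t)))%C)).
    + rewrite Hend. replace (RtoC (IZR m) * (Phi (line x 0) + period 1))%C
        with (RtoC (IZR m) * Phi (line x 0) + period m)%C.
      * rewrite cexp_plus_period. ring.
      * rewrite Cmult_plus_distr_l. f_equal. apply injective_projections; simpl; ring.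
    + intros t. eapply is_curve_derive_eq.
      * apply is_curve_derive_scal, (is_curve_derive_comp cexp); [apply is_C_derive_cexp|].
        now apply is_curve_derive_scal, is_curve_derive_branch_line.
      * unfold contour. field. exact Hm0.
    + intros t. now apply continuous_contour.
Qed.

Lemma contour_taylor_poly (x : R) (n N : nat) : ell < x ->
  CRInt (fun t => (taylor_poly f N (cexp (Phi (line x t))) * contour x (- INR n) t)%C) 0 1 =
  (if le_lt_dec N n then RtoC 0 else taylor_coef f 0 1 n * period 1)%C :> C.
Proof.
  intros Hx. assert (Hline := fun t => continuous_branch_line x t Hx).
  assert (Hcont := fun t => continuous_contour x (- INR n) t Hx).
  assert (Hpoly : forall N t, continuous (fun t => taylor_poly f N (cexp (Phi (line x t)))) t).
  { intros M t. induction M; simpl; auto with cont. }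
  induction N as [|N IH].
  - rewrite (CRInt_ext _ (fun _ => RtoC 0)), CRInt_const by (intros t; simpl; ring).
    destruct (le_lt_dec 0 n); [ring|lia].
  - rewrite (CRInt_ext _ (fun t => (taylor_poly f N (cexp (Phi (line x t))) * contour x (- INR n) t
      + taylor_coef f 0 1 N * contour x (IZR (Z.of_nat N - Z.of_nat n)) t)%C)).
    + rewrite CRInt_plus, IH, CRInt_scal, contour_integral; auto with cont.
      * destruct (le_lt_dec N n), (le_lt_dec (S N) n),
          (Z.eq_dec (Z.of_nat N - Z.of_nat n) 0); try lia;
          try (replace n with N by lia); ring.
      * intros t. now apply continuous_contour.
      * intros t. apply continuous_Cmult; [apply continuous_const|now apply continuous_contour].
    + intros t. rewrite minus_IZR, <- !INR_IZR_INZ.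
      replace (INR N - INR n) with (- INR n + INR N) by ring.
      rewrite contour_plus, cexp_INR_mult. simpl. ring.
Qed.

(* Cauchy's coefficient formula on the loop [zeta = cexp (Phi (line x t))], where
   [f zeta = cexp (line x t)]. *)
Lemma contour_taylor_coef (x : R) (n : nat) : ell < x ->
  CRInt (fun t => (cexp (line x t) * contour x (- INR n) t)%C) 0 1 =
  (taylor_coef f 0 1 n * period 1)%C :> C.
Proof.
  intros Hx. assert (Hline := fun t => continuous_branch_line x t Hx).
  assert (Hcont := fun t => continuous_contour x (- INR n) t Hx).
  set (psi := fun t => cexp (Phi (line x t))).
  assert (Hpsi : forall t, continuous psi t) by (unfold psi; auto with cont).
  assert (Hfpsi : forall t, continuous (fun t => f (psi t)) t).
  { intros t. apply (continuous_comp psi f); [apply Hpsi|]. now apply (C1_entire_continuous f f'). }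
  assert (Hpoly : forall N t, continuous (fun t => taylor_poly f N (psi t)) t).
  { intros M t. induction M; simpl; auto with cont. }
  destruct (bounded_on_unit psi Hpsi) as [r [Hr Kr]].
  destruct (bounded_on_unit (contour x (- INR n)) Hcont) as [K [_ KK]].
  rewrite (CRInt_ext _ (fun t => (f (psi t) * contour x (- INR n) t)%C)).
  2: { intros t. unfold psi. now rewrite (proj2 HPhi) by now apply line_in_halfplane. }
  apply Ceq_of_dist_le_0.
  apply Rle_0_of_le_eps with K. intros e He.
  destruct (taylor_poly_uniform_limit f f' Hf r e Hr He) as [N0 HN0].
  set (N := (N0 + n + 1)%nat).
  assert (EN := contour_taylor_poly x n N Hx).
  destruct (le_lt_dec N n) as [Hle|_]; [unfold N in Hle; lia|].
  rewrite <- EN, <- CRInt_minus by (intros t; apply continuous_Cmult; auto).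
  replace (e * K) with ((1 - 0) * (e * K)) by ring.
  apply Cmod_CRInt_le; [lra|intros t; apply continuous_Cminus; apply continuous_Cmult; auto|].
  intros t Ht. change (cexp (Phi (line x t))) with (psi t).
  replace (f (psi t) * contour x (- INR n) t - taylor_poly f N (psi t) * contour x (- INR n) t)%C
    with ((f (psi t) - taylor_poly f N (psi t)) * contour x (- INR n) t)%C by ring.
  rewrite Cmod_mult. apply Rmult_le_compat; auto using Cmod_ge_0.
  apply HN0; [unfold N; lia|now apply Kr].
Qed.

Section Growth.
Variable c : R.
Hypothesis Hc : forall u, H u -> c < Re (Phi u).

Let height (x t : R) : R := Re (Phi (line x t)) - c.

Lemma height_pos (x t : R) : ell < x -> 0 < height x t.
Proof. intros Hx. assert (K := Hc _ (line_in_halfplane x t Hx)). unfold height. lra. Qed.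

Lemma branch_line_speed_le (x t : R) : ell < x ->
  Cmod (Phi' (line x t) * period k) <= 4 * Cmod (period k) / (x - ell) * height x t.
Proof.
  intros Hx.
  assert (K := log_branch_derive_le_Re c (line x t) (fun u Hu => Rlt_le _ _ (Hc u Hu))
    (line_in_halfplane x t Hx)).
  rewrite Re_line in K. rewrite Cmod_mult.
  replace (4 * Cmod (period k) / (x - ell) * height x t)
    with (4 / (x - ell) * height x t * Cmod (period k)) by (field; lra).
  apply Rmult_le_compat_r; [apply Cmod_ge_0|exact K].
Qed.

Lemma branch_line_speed_le_height (x t : R) : ell < x -> 4 * Cmod (period k) <= x - ell ->
  Cmod (Phi' (line x t) * period k) <= height x t.
Proof.
  intros Hx Hk. eapply Rle_trans; [now apply branch_line_speed_le|].
  assert (Q := height_pos x t Hx). rewrite <- (Rmult_1_l (height x t)) at 2.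
  apply Rmult_le_compat_r; [lra|]. apply Rle_div_l; lra.
Qed.

Lemma height_variation (x s t : R) : ell < x -> 4 * Cmod (period k) <= x - ell ->
  height x s <= exp (Rabs (s - t)) * height x t.
Proof.
  intros Hx Hk.
  apply (log_derivative_variation (height x) (fun t => Re (Phi' (line x t) * period k)%C)).
  intros v. split; [now apply height_pos|]. split.
  - assert (D := is_derive_linear Re _ _ _ is_linear_Re (is_curve_derive_branch_line x v Hx)).
    rewrite <- (Rminus_0_r (Re (Phi' (line x v) * period k)%C)).
    apply (is_derive_minus (V := R_NormedModule) _ (fun _ => c)); [exact D|].
    apply (is_derive_const (V := R_NormedModule)).
  - eapply Rle_trans; [apply re_le_Cmod|]. now apply branch_line_speed_le_height.
Qed.

(* [Phi] moves by [2 pi] along the line while its speed is controlled by the height. *)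
Lemma height_growth (x t : R) : ell < x -> 4 * Cmod (period k) <= x - ell -> 0 <= t <= 1 ->
  PI * (x - ell) <= 6 * Cmod (period k) * height x t.
Proof.
  intros Hx Hk Ht. assert (Q := Cmod_ge_0 (period k)). assert (Pt := height_pos x t Hx).
  assert (Hvar : forall s, 0 <= s <= 1 -> height x s <= 3 * height x t).
  { intros s Hs. eapply Rle_trans; [now apply (height_variation x s t)|].
    apply Rmult_le_compat_r; [lra|]. eapply Rle_trans; [|apply exp_le_3].
    apply exp_le, Rabs_le. lra. }
  assert (K : Cmod (Phi (line x 1) - Phi (line x 0))
    <= 4 * Cmod (period k) / (x - ell) * (3 * height x t) * (1 - 0)).
  { apply (curve_mean_value (fun t => Phi (line x t))
      (fun t => (Phi' (line x t) * period k)%C)); [lra| |].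
    - intros s _. now apply is_curve_derive_branch_line.
    - intros s Hs. eapply Rle_trans; [now apply branch_line_speed_le|].
      apply Rmult_le_compat_l; [apply Rdiv_le_0_compat; lra|]. now apply Hvar. }
  rewrite branch_line_end, Cmod_plus_minus_l, Cmod_period_1 in K by exact Hx.
  replace (4 * Cmod (period k) / (x - ell) * (3 * height x t) * (1 - 0))
    with (12 * Cmod (period k) * height x t / (x - ell)) in K by (field; lra).
  apply Rle_div_r in K; lra.
Qed.

Lemma taylor_coef_exp_bound (n : nat) (d : R) : 12 * Cmod (period k) <= (INR n - 1) * PI ->
  0 < d -> 4 * Cmod (period k) <= d ->
  Cmod (taylor_coef f 0 1 n * period 1) <= exp (ell - INR n * c) * exp (- d).
Proof.
  intros Hn Hd Hk. assert (HP := PI_RGT_0). assert (Hx : ell < ell + d) by lra.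
  assert (Hk' : 4 * Cmod (period k) <= ell + d - ell) by lra.
  rewrite <- (contour_taylor_coef (ell + d) n Hx).
  rewrite <- (Rmult_1_l (exp _ * _)). replace 1 with (1 - 0) at 2 by ring.
  apply Cmod_CRInt_le; [lra| |].
  - intros t. apply continuous_Cmult; [|now apply continuous_contour].
    apply continuous_cexp, continuous_seg.
  - intros t Ht. unfold contour. rewrite !(Cmod_mult (cexp _)), !Cmod_cexp, Re_line, re_scal_l.
    set (h := height (ell + d) t). assert (Ph : 0 < h) by now apply height_pos.
    assert (Hspeed : Cmod (Phi' (line (ell + d) t) * period k) <= exp h).
    { eapply Rle_trans; [now apply branch_line_speed_le_height|]. fold h.
      assert (B := exp_ineq1_le h). lra. }
    replace (Re (Phi (line (ell + d) t))) with (h + c) by (unfold h, height; ring).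
    apply Rle_trans with (exp (ell + d) * (exp (- INR n * (h + c)) * exp h)).
    { apply Rmult_le_compat_l; [left; apply exp_pos|].
      apply Rmult_le_compat_l; [left; apply exp_pos|exact Hspeed]. }
    rewrite <- !exp_plus.
    assert (Hexp : ell + d + (- INR n * (h + c) + h) <= ell - INR n * c + - d).
    { assert (K := height_growth (ell + d) t Hx Hk' Ht). fold h in K.
      assert (12 * Cmod (period k) * h <= (INR n - 1) * PI * h) by (apply Rmult_le_compat_r; lra).
      assert (2 * d <= (INR n - 1) * h) by nra. lra. }
    now apply exp_le.
Qed.

Lemma taylor_coef_eq_0 (n : nat) : 12 * Cmod (period k) <= (INR n - 1) * PI ->
  taylor_coef f 0 1 n = RtoC 0.
Proof.
  intros Hn. assert (HP := PI_RGT_0). assert (Q := Cmod_ge_0 (period k)).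
  assert (K : (taylor_coef f 0 1 n * period 1)%C = RtoC 0).
  { apply Cmod_le_0.
    apply Rle_0_of_le_eps with (exp (ell - INR n * c)). intros e He.
    assert (He' := Rinv_0_lt_compat e He).
    eapply Rle_trans; [apply (taylor_coef_exp_bound n (4 * Cmod (period k) + / e)); lra|].
    rewrite Rmult_comm. apply Rmult_le_compat_r; [left; apply exp_pos|].
    rewrite exp_Ropp. rewrite <- (Rinv_inv e) at 2.
    assert (B := exp_ineq1_le (4 * Cmod (period k) + / e)).
    apply Rinv_le_contravar; lra. }
  apply NNPP. intros Hne. apply (Cmult_neq_0 _ (period 1) Hne); [|exact K].
  apply Cmod_gt_0. rewrite Cmod_period_1. lra.
Qed.
End Growth.

Lemma periodic_branch_polynomial : is_polynomial f.
Proof.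
  destruct log_branch_Re_lower as [c Hc]. assert (HP := PI_RGT_0).
  destruct (INR_unbounded (12 * Cmod (period k) / PI + 1)) as [N HN].
  apply (is_polynomial_of_taylor_coef f f' Hf N). intros n Hn. apply le_INR in Hn.
  apply (taylor_coef_eq_0 (c - 1)).
  - intros u Hu. specialize (Hc u Hu). lra.
  - apply Rle_div_l; lra.
Qed.
End PeriodicBranch.

Lemma log_branch_shift (u1 u2 : C) : H u1 -> H u2 -> Phi u1 = (Phi u2 + period 1)%C ->
  exists k, forall u, H u -> Phi (u + period k)%C = (Phi u + period 1)%C.
Proof.
  intros Hu1 Hu2 E12.
  destruct (cexp_eq u1 u2) as [k Hk].
  { rewrite <- (proj2 HPhi u1 Hu1), <- (proj2 HPhi u2 Hu2), E12. now rewrite cexp_plus_period. }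
  exists k.
  assert (Hshift : forall u, H u -> H (u + period k)%C).
  { intros u Hu. unfold H, halfplane. now rewrite Re_plus_period. }
  assert (Cshift : forall u, H u -> continuous (fun u => Phi (u + period k)%C) u).
  { intros u Hu. apply (continuous_comp (fun u => (u + period k)%C) Phi); [auto with cont|].
    now apply log_branch_continuous, Hshift. }
  assert (Ecexp : forall u, H u -> cexp (Phi (u + period k)) = cexp (Phi u)).
  { intros u Hu. apply (lift_unique f f' cexp H Hf unramified_over_cexp H
      (fun u => cexp (Phi (u + period k)%C)) (fun u => cexp (Phi u)) u2 u);
      auto using convex_halfplane.
    - apply convex_halfplane.
    - intros v Hv. split; [now apply continuous_cexp, Cshift|].
      rewrite (proj2 HPhi) by now apply Hshift. apply cexp_plus_period.
    - intros v Hv. split; [now apply continuous_cexp, log_branch_continuous|now apply HPhi].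
    - rewrite <- Hk, E12. apply cexp_plus_period. }
  intros u Hu.
  apply (lift_unique cexp cexp (fun u => cexp (Phi u)) H (C1_on_cexp _) (cexp_unramified _) H
    (fun u => Phi (u + period k)%C) (fun u => (Phi u + period 1)%C) u2 u); auto.
  - apply convex_halfplane.
  - intros v Hv. split; [now apply Cshift|now apply Ecexp].
  - intros v Hv. split; [|apply cexp_plus_period].
    apply continuous_Cplus; [now apply log_branch_continuous|apply continuous_const].
  - now rewrite <- Hk.
Qed.

Hypothesis Htr : ~ is_polynomial f.

Lemma log_branch_omits (b : C) : exists p, Cmod (p - b) <= PI /\ forall u, H u -> Phi u <> p.
Proof.
  apply NNPP. intros Hno.
  assert (Hsur : forall p, Cmod (p - b) <= PI -> exists u, H u /\ Phi u = p).
  { intros p Hp. apply NNPP. intros Hu. apply Hno. exists p. split; [exact Hp|].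
    intros u Hu1 Hu2. apply Hu. now exists u. }
  set (q := (RtoC (1 / 2) * period 1)%C).
  assert (Hq : Cmod q = PI) by (unfold q; rewrite Cmod_half, Cmod_period_1; field).
  destruct (Hsur (b + q)%C) as [u1 [Hu1 E1]]; [rewrite Cmod_plus_minus_l; lra|].
  destruct (Hsur (b - q)%C) as [u2 [Hu2 E2]].
  { unfold Cminus at 2. rewrite Cmod_plus_minus_l, Cmod_opp. lra. }
  destruct (log_branch_shift u1 u2 Hu1 Hu2) as [k Hk].
  { rewrite E1, E2, <- (half_plus_half (period 1)). unfold q. ring. }
  now apply Htr, (periodic_branch_polynomial k).
Qed.

Lemma eremenko_lyubich (u : C) : H u -> Cmod (Phi' u) <= 256 / (Re u - ell).
Proof.
  intros Hu. assert (Hd : 0 < Re u - ell) by (unfold H, halfplane in Hu; lra).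
  destruct (bloch Phi Phi' u (Re u - ell) Hd) as [b Hb].
  { apply C1_on_incl with (halfplane ell); [apply halfplane_Cdisc|apply HPhi]. }
  destruct (log_branch_omits b) as [p [Hp Hpo]]. assert (HP := PI_4).
  apply Rle_div_r; [exact Hd|]. apply Rnot_lt_le. intros Hlt.
  destruct (Hb p) as [z [Hz Ez]]; [unfold Cdisc; lra|].
  apply (Hpo z); [now apply (halfplane_Cdisc ell u)|exact Ez].
Qed.

Lemma log_branch_lipschitz (m : R) (u v : C) : 0 < m -> ell + m <= Re u -> ell + m <= Re v ->
  Cmod (Phi v - Phi u) <= 256 / m * Cmod (v - u).
Proof.
  intros Hm. apply (mean_value_convex (fun z => ell + m <= Re z) Phi Phi').
  - intros a b t Ha Hb Ht. rewrite Re_seg. nra.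
  - intros z Hz. apply (proj1 HPhi). unfold halfplane. lra.
  - intros z Hz. eapply Rle_trans; [apply eremenko_lyubich; unfold H, halfplane; lra|].
    apply Rmult_le_compat_l; [lra|]. apply Rinv_le_contravar; lra.
Qed.
End Branch.
End LogCoordinates.

(** * Functions of bounded type *)

Lemma has_cderiv_is_C_derive (f : C -> C) (z l : C) : has_cderiv f z l <-> is_C_derive f z l.
Proof.
  rewrite is_C_derive_eps. split; intros H e He; destruct (H e He) as [d [Hd K]]; exists d;
    (split; [exact Hd|]).
  - intros w Hw. destruct (Ceq_dec w z) as [->|Hn].
    + replace (f z - f z - l * (z - z))%C with (RtoC 0) by ring.
      rewrite Cmod_0, Cmod_minus_diag. lra.
    + apply Cminus_eq_contra, Cmod_gt_0 in Hn. specialize (K (w - z)%C). rewrite !Cnorm_Cmod in K.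
      replace (Cadd z (w - z)%C) with w in K by (change (w = z + (w - z))%C; ring).
      apply K. unfold Cdisc in Hw. lra.
  - intros h Hh. rewrite !Cnorm_Cmod in *. specialize (K (z + h)%C).
    unfold Cdisc in K. rewrite Cmod_plus_minus_l in K.
    replace (f (z + h)%C - f z - l * (z + h - z))%C with (f (z + h)%C - f z - l * h)%C in K by ring.
    apply K. lra.
Qed.

Lemma bounded_type_C1_entire (f : C -> C) : bounded_type f -> exists f', C1_entire f f'.
Proof.
  intros [[He _] _]. apply C1_entire_exists. intros z. destruct (He z) as [l Hl]. exists l.
  now apply has_cderiv_is_C_derive.
Qed.

Lemma bounded_type_not_polynomial (f : C -> C) : bounded_type f -> ~ is_polynomial f.
Proof. now intros [[_ Hp] _]. Qed.

Lemma bounded_type_unramified_beyond (f f' : C -> C) : bounded_type f -> C1_entire f f' ->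
  exists ell, unramified_beyond f f' ell.
Proof.
  intros [_ [M HM]] Hf. assert (HM0 := Rabs_pos M). assert (HM1 := Rle_abs M).
  assert (Hf0 := Cmod_ge_0 (f 0)). exists (ln (Rabs M + Cmod (f 0) + 1)).
  assert (Hbound : forall w, sing_values f w -> Cmod w <= M).
  { intros w Hw. rewrite <- Cnorm_Cmod. apply HM. now left. }
  unfold unramified_beyond. rewrite exp_ln by lra. split; [|split].
  - intros z Hz E0. specialize (Hbound (f z)).
    assert (Hs : sing_values f (f z)); [|specialize (Hbound Hs); lra].
    left. exists z. split; [|reflexivity]. apply has_cderiv_is_C_derive.
    change C0 with (RtoC 0). rewrite <- E0. now apply C1_entire_derive.
  - intros w Hw Ha. specialize (Hbound w (or_intror Ha)). lra.
  - lra.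
Qed.

Definition contracting_branch (F : C -> C) (om : C) (Phi : C -> C) : Prop :=
  (forall u, Cmod (u - om) <= 8 -> F (cexp (Phi u)) = cexp u) /\
  (forall u v, Cmod (u - om) <= 8 -> Cmod (v - om) <= 8 ->
     Cmod (Phi v - Phi u) <= 1 / 2 * Cmod (v - u)).

Definition log_expanding (F : C -> C) (X : R) : Prop :=
  (forall om s, X <= Re om -> F (cexp s) = cexp om ->
     exists Phi, Phi om = s /\ contracting_branch F om Phi) /\
  (forall x, X <= x -> exists z, Cmod z = exp x /\ exp (2 * x) <= Cmod (F z)).

Lemma log_expanding_mono (F : C -> C) (X Y : R) : X <= Y -> log_expanding F X -> log_expanding F Y.
Proof.
  intros HXY [H1 H2]. split.
  - intros om s Hom. apply H1. lra.
  - intros x Hx. apply H2. lra.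
Qed.

Lemma contracting_branch_exists (F F' : C -> C) (ell : R) (om s : C) :
  C1_entire F F' -> ~ is_polynomial F -> unramified_beyond F F' ell ->
  ell + 520 <= Re om -> F (cexp s) = cexp om ->
  exists Phi, Phi om = s /\ contracting_branch F om Phi.
Proof.
  intros HF Htr Hell Hom Es.
  assert (Hom' : halfplane ell om) by (unfold halfplane; lra).
  destruct (log_branch_exists F F' ell HF Hell om s Hom' Es) as [Phi [Phi' [E1 E2]]].
  assert (Hre : forall u, Cmod (u - om) <= 8 -> ell + 512 <= Re u).
  { intros u Hu. assert (K := Re_dist_le u om).
    assert (K' : Rabs (Re u - Re om) <= 8) by lra. apply Rabs_le_between in K'. lra. }
  exists Phi. split; [exact E1|]. split.
  - intros u Hu. apply E2. unfold halfplane. specialize (Hre u Hu). lra.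
  - intros u v Hu Hv. replace (1 / 2) with (256 / 512) by field.
    apply (log_branch_lipschitz F F' ell HF Hell Phi Phi' E2 Htr); auto. lra.
Qed.

Lemma bounded_type_log_expanding (F : C -> C) : bounded_type F ->
  exists X, 1 <= X /\ log_expanding F X.
Proof.
  intros HB. destruct (bounded_type_C1_entire F HB) as [F' HF].
  assert (Htr := bounded_type_not_polynomial F HB).
  destruct (bounded_type_unramified_beyond F F' HB HF) as [ell Hell].
  destruct (transcendental_growth F F' HF Htr 2) as [r0 [Hr0 Hgr]].
  exists (Rmax 1 (Rmax (ell + 520) (ln r0))). split; [apply Rmax_l|]. split.
  - intros om s Hom. apply (contracting_branch_exists F F' ell); auto.
    eapply Rle_trans; [|exact Hom]. eapply Rle_trans; [apply Rmax_l|apply Rmax_r].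
  - intros x Hx. assert (Hlx : ln r0 <= x).
    { eapply Rle_trans; [|exact Hx]. eapply Rle_trans; [apply Rmax_r|apply Rmax_r]. }
    destruct (Hgr (exp x)) as [z [Hz1 Hz2]].
    + rewrite <- (exp_ln r0) by lra.
      now apply exp_le.
    + exists z. split; [exact Hz1|]. replace (exp (2 * x)) with (exp x ^ 2); [exact Hz2|].
      replace (2 * x) with (x + x) by ring. rewrite exp_plus. ring.
Qed.

(** * Escaping points of the composition *)

Lemma log_expanding_step (F : C -> C) (X : R) (om : C) :
  1 <= X -> log_expanding F X -> X <= Re om ->
  exists om' Phi, 2 * Re om <= Re om' /\ Cmod (Phi om' - om) <= 4 /\ contracting_branch F om' Phi.
Proof.
  intros HX [H1 H2] Hom. destruct (H2 (Re om) Hom) as [z [Hz1 Hz2]].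
  assert (P1 := exp_pos (Re om)). assert (P2 := exp_pos (2 * Re om)).
  destruct (clog_near z (Im om)) as [s [Es Hs]]; [apply Cmod_gt_0; lra|].
  destruct (clog_exists (F z)) as [om' Eo]; [apply Cmod_gt_0; lra|].
  assert (Hre : Re s = Re om) by (apply exp_inv; now rewrite <- Cmod_cexp, Es).
  assert (Hre' : 2 * Re om <= Re om').
  { rewrite <- Eo, Cmod_cexp in Hz2. apply exp_le_inv. lra. }
  destruct (H1 om' s) as [Phi [E1 E2]]; [lra|now rewrite Es|].
  exists om', Phi. split; [exact Hre'|]. split; [|exact E2].
  rewrite E1. eapply Rle_trans; [apply Cmod_le_Re_Im|].
  rewrite Re_minus, Im_minus, Hre, Rminus_diag, Rabs_R0. assert (HP := PI_4). lra.
Qed.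

Lemma log_expanding_orbit (F : nat -> C -> C) (X : R) (om0 : C) : 1 <= X ->
  (forall n, log_expanding (F n) X) -> X <= Re om0 ->
  exists p : nat -> C, Cmod (p 0%nat - om0) <= 8 /\
    forall n, F n (cexp (p n)) = cexp (p (S n)) /\ INR n - 8 <= Re (p n).
Proof.
  intros HX HF H0.
  destruct (dependent_choice
    (fun n (s : C * (C -> C)) => X <= Re (fst s) /\ INR n <= Re (fst s))
    (fun n s s' => Cmod (snd s' (fst s') - fst s) <= 4 /\
      contracting_branch (F n) (fst s') (snd s'))
    (om0, fun z => z)) as [s [E0 Hs]].
  - simpl. lra.
  - intros n [om Phi0] [H1 H2]. cbn [fst snd] in *.
    destruct (log_expanding_step (F n) X om HX (HF n) H1) as [om' [Phi [K1 [K2 K3]]]].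
    exists (om', Phi). rewrite S_INR. cbn [fst snd]. split; [lra|]. now split.
  - destruct (backward_shadowing (fun n => snd (s (S n))) (fun n => fst (s n)) 8 (1 / 2)) as [p Hp].
    + lra.
    + intros n. destruct (Hs n) as [_ [K _]]. lra.
    + intros n. apply (Hs n).
    + exists p. split; [change om0 with (fst (om0, fun z : C => z)); rewrite <- E0; apply Hp|].
      intros n. destruct (Hp n) as [Kn En]. destruct (Hp (S n)) as [Kn' _].
      destruct (Hs n) as [[_ Hn] [_ [K _]]]. split.
      * rewrite En. now apply K.
      * assert (D := Re_dist_le (p n) (fst (s n))).
        assert (D' : Rabs (Re (p n) - Re (fst (s n))) <= 8) by lra.
        apply Rabs_le_between in D'. lra.
Qed.

Lemma escaping_near (f g : C -> C) (X : R) (om0 : C) : 1 <= X ->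
  log_expanding f X -> log_expanding g X -> X <= Re om0 ->
  exists p, Cmod (p - om0) <= 8 /\ escaping (fun z => f (g z)) (cexp p).
Proof.
  intros HX Ef Eg H0.
  destruct (log_expanding_orbit (fun n => if Nat.even n then g else f) X om0 HX) as [p [Hp0 Hp]].
  { intros n. now destruct (Nat.even n). }
  { exact H0. }
  exists (p 0%nat). split; [exact Hp0|].
  assert (Hit : forall m, iterate (fun z => f (g z)) m (cexp (p 0%nat)) = cexp (p (2 * m)%nat)).
  { induction m; [reflexivity|].
    change (f (g (iterate (fun z => f (g z)) m (cexp (p 0%nat)))) = cexp (p (2 * S m)%nat)).
    destruct (Hp (2 * m)%nat) as [K1 _]. destruct (Hp (S (2 * m))) as [K2 _].
    assert (Hev : Nat.even (2 * m) = true) by apply Nat.even_mul.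
    rewrite Nat.even_succ, <- Nat.negb_even, Hev in K2. rewrite Hev in K1.
    rewrite IHm, K1. cbn [negb] in K2. rewrite K2. do 2 f_equal. lia. }
  intros M. destruct (INR_unbounded (M + 8)) as [N HN]. exists N. intros n Hn.
  rewrite Hit, Cnorm_Cmod, Cmod_cexp. destruct (Hp (2 * n)%nat) as [_ K].
  assert (KN : INR N <= INR (2 * n)) by (apply le_INR; lia).
  assert (B := exp_ineq1_le (Re (p (2 * n)%nat))). lra.
Qed.

Lemma pullback_along_orbit (f : C -> C) (X : R) (s : nat -> C) (n0 : nat) : log_expanding f X ->
  (forall n, (n0 <= n)%nat -> X <= Re (s n) /\ f (cexp (s n)) = cexp (s (S n))) ->
  forall j u r, r <= 8 -> Cmod (u - s (n0 + j)%nat) <= r ->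
  exists v, Cmod (v - s n0) <= r * (1 / 2) ^ j /\ iterate f j (cexp v) = cexp u.
Proof.
  intros [Hf _] Hs. induction j; intros u r Hr Hu.
  - exists u. rewrite Nat.add_0_r in Hu. simpl. split; [lra|reflexivity].
  - rewrite Nat.add_succ_r in Hu.
    destruct (Hs (n0 + j)%nat ltac:(lia)) as [_ E].
    destruct (Hs (S (n0 + j)) ltac:(lia)) as [Hre _].
    destruct (Hf _ _ Hre E) as [Phi [E1 [E2 E3]]].
    assert (K := E3 (s (S (n0 + j))) u ltac:(rewrite Cmod_minus_diag; lra) ltac:(lra)).
    rewrite E1 in K.
    destruct (IHj (Phi u) (r / 2)) as [v [Hv1 Hv2]]; [lra|lra|].
    exists v. split; [simpl; lra|].
    change (f (iterate f j (cexp v)) = cexp u). rewrite Hv2. apply E2. lra.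
Qed.

Section Commuting.
Variables f g : C -> C.
Hypothesis Bf : bounded_type f.
Hypothesis Hcomm : forall z, f (g z) = g (f z).

Let h (z : C) : C := f (g z).

Lemma iterate_comm (n : nat) (z : C) : iterate h n (f z) = f (iterate h n z).
Proof.
  induction n; [reflexivity|]. change (h (iterate h n (f z)) = f (h (iterate h n z))).
  rewrite IHn. unfold h. now rewrite <- Hcomm.
Qed.

Lemma escaping_of_image (z : C) : escaping h (f z) -> escaping h z.
Proof.
  intros H M. destruct (bounded_type_C1_entire f Bf) as [f' Hf].
  destruct (bounded_on_closed_disc f M (fun w => C1_entire_continuous f f' w Hf)) as [B HB].
  destruct (H B) as [N HN]. exists N. intros n Hn. specialize (HN n Hn).
  rewrite iterate_comm, Cnorm_Cmod in HN. rewrite Cnorm_Cmod.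
  apply Rnot_le_gt. intros Hle. specialize (HB _ Hle). lra.
Qed.

Lemma escaping_of_iterate (j : nat) (z : C) : escaping h (iterate f j z) -> escaping h z.
Proof. induction j; [auto|]. intros H. apply IHj, escaping_of_image, H. Qed.

Lemma closure_escaping_of_image (z : C) : Cclosure (escaping h) (f z) -> Cclosure (escaping h) z.
Proof.
  intros H e He. destruct (bounded_type_C1_entire f Bf) as [f' Hf].
  destruct (open_mapping f f' z e Hf (bounded_type_not_polynomial f Bf) He) as [d [Hd Hop]].
  destruct (H d Hd) as [w [Hw1 Hw2]]. rewrite Cnorm_Csub in Hw2.
  destruct (Hop w Hw2) as [v [Hv1 Hv2]]. exists v. split.
  - apply escaping_of_image. now rewrite Hv2.
  - now rewrite Cnorm_Csub.
Qed.

Lemma closure_escaping_of_iterate (j : nat) (z : C) :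
  Cclosure (escaping h) (iterate f j z) -> Cclosure (escaping h) z.
Proof. induction j; [auto|]. intros H. apply IHj, closure_escaping_of_image, H. Qed.

Lemma escaping_log_orbit (X : R) (z : C) : escaping f z ->
  exists N s, forall n, (N <= n)%nat -> X <= Re (s n) /\ cexp (s n) = iterate f n z.
Proof.
  intros Hz. destruct (Hz (exp X)) as [N HN].
  exists N, (fun n => epsilon (inhabits (RtoC 0)) (fun s => cexp s = iterate f n z)).
  intros n Hn. specialize (HN n Hn). rewrite Cnorm_Cmod in HN.
  assert (Hs : exists s, cexp s = iterate f n z).
  { apply clog_exists, Cmod_gt_0. assert (P := exp_pos X). lra. }
  assert (E := epsilon_spec (inhabits (RtoC 0)) _ Hs). cbv beta in E. split; [|exact E].
  rewrite <- E, Cmod_cexp in HN. apply exp_le_inv. lra.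
Qed.

Lemma escaping_in_closure (z : C) : bounded_type g -> escaping f z -> Cclosure (escaping h) z.
Proof.
  intros Bg Hz.
  destruct (bounded_type_log_expanding f Bf) as [Xf [Xf1 Ef]].
  destruct (bounded_type_log_expanding g Bg) as [Xg [_ Eg]].
  set (X := Rmax Xf Xg).
  apply (log_expanding_mono _ _ X) in Ef; [|apply Rmax_l].
  apply (log_expanding_mono _ _ X) in Eg; [|apply Rmax_r].
  assert (HX : 1 <= X) by (eapply Rle_trans; [exact Xf1|apply Rmax_l]).
  destruct (escaping_log_orbit X z Hz) as [N [s Hs]].
  apply (closure_escaping_of_iterate N). destruct (Hs N (le_n N)) as [_ <-]. intros e He.
  destruct (proj1 (continuous_C_eps _ _) (continuous_cexp _ _ (continuous_id (s N))) e He)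
    as [d [Hd Hc]].
  destruct (pow_small 8 (1 / 2) d) as [j Hj]; [lra|exact Hd|]. specialize (Hj j (le_n j)).
  destruct (escaping_near f g X (s (N + j)%nat) HX Ef Eg) as [p [Hp1 Hp2]]; [apply Hs; lia|].
  destruct (pullback_along_orbit f X s N Ef) with (j := j) (u := p) (r := 8) as [v [Hv1 Hv2]].
  - intros n Hn. destruct (Hs n Hn) as [K1 K2]. destruct (Hs (S n)) as [_ K3]; [lia|].
    split; [exact K1|]. now rewrite K2, K3.
  - lra.
  - exact Hp1.
  - exists (cexp v). split.
    + apply (escaping_of_iterate j). now rewrite Hv2.
    + rewrite Cnorm_Csub. apply Hc. unfold Cdisc. lra.
Qed.
End Commuting.

Lemma Cclosure_min (E F : C -> Prop) (w : C) :
  (forall z, E z -> Cclosure F z) -> Cclosure E w -> Cclosure F w.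
Proof.
  intros H Hw e He. destruct (Hw (e / 2) ltac:(lra)) as [z [Hz1 Hz2]].
  destruct (H z Hz1 (e / 2) ltac:(lra)) as [y [Hy1 Hy2]]. exists y. split; [exact Hy1|].
  rewrite Cnorm_Csub in *. assert (T := Cmod_dist_triangle y z w). lra.
Qed.

Lemma Cclosure_incl (E F : C -> Prop) (w : C) :
  (forall z, E z -> F z) -> Cclosure E w -> Cclosure F w.
Proof. intros H Hw e He. destruct (Hw e He) as [z [Hz1 Hz2]]. exists z. auto. Qed.

Lemma escaping_ext (f g : C -> C) (z : C) :
  (forall z, f z = g z) -> escaping f z -> escaping g z.
Proof.
  intros E H M. destruct (H M) as [N HN]. exists N. intros n Hn.
  replace (iterate g n z) with (iterate f n z); [auto|].
  clear - E. unfold iterate. induction n; simpl; [reflexivity|]. now rewrite IHn, E.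
Qed.

Theorem theorem5 (f g : CC -> CC) :
  bounded_type f -> bounded_type g ->
  (forall z, f (g z) = g (f z)) ->
  forall w, (Cclosure (escaping f) w \/ Cclosure (escaping g) w) ->
    Cclosure (escaping (fun z => f (g z))) w.
Proof.
  intros Bf Bg Hcomm w [Hw|Hw]; revert Hw; apply Cclosure_min; intros z Hz.
  - now apply escaping_in_closure.
  - apply Cclosure_incl with (escaping (fun z => g (f z))).
    + intros v. apply escaping_ext. intros u. symmetry. apply Hcomm.
    + apply escaping_in_closure; auto.
Qed.
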